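(* Let $(M,\omega)$ be a closed symplectic manifold, let $\psi_t$ ($t\in[0,1]$, $\psi_0=\mathrm{id}$) be a symplectic isotopy of $(M,\omega)$, and let $\gamma$ be a contractible loop in $M$. Then there exists a symplectic isotopy $\phi_t$ ($t\in[0,1]$, $\phi_0=\mathrm{id}$) obtained by a Hamiltonian deformation of $\psi_t$ such that $\gamma$ is a hyperbolic one-periodic orbit of $\phi_1$.
   Context: Isotopies and loops are smooth; loops are parametrized by $S^1=\mathbb R/\mathbb Z$. For a time-dependent Hamiltonian $H$ on $M$, the Hamiltonian vector field is defined by $\omega(X_H,\cdot)=-dH$; a Hamiltonian diffeomorphism is the time-one map of the flow of such a vector field. A symplectic isotopy $\phi_t$ of $(M,\omega)$ is said to be obtained by a Hamiltonian deformation of another symplectic isotopy $\psi_t$ when $\phi_t\circ\psi_t^{-1}$ is a Hamiltonian diffeomorphism for all $t$. A loop $\gamma$ is a one-periodic orbit of $\phi_1$ (with respect to the isotopy $\phi_t$) if $\gamma(t)=\phi_t(\gamma(0))$ for all $t\in[0,1]$ (so $\phi_1(\gamma(0))=\gamma(0)$). It is hyperbolic if the linearized return map $d(\phi_1)_{\gamma(0)}:T_{\gamma(0)}M\to T_{\gamma(0)}M$ has no eigenvalue of absolute value $1$. *)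

(* Defs.v *)
From mathcomp Require Import all_boot all_order all_algebra.
From mathcomp Require Import complex.
From mathcomp Require Import boolp classical_sets functions set_interval reals.
From mathcomp Require Import topology normedtype derive.

Set Implicit Arguments.
Unset Strict Implicit.
Unset Printing Implicit Defensive.

Import Order.TTheory GRing.Theory Num.Theory.
Import numFieldNormedType.Exports.

Local Open Scope classical_set_scope.
Local Open Scope ring_scope.

Section SmoothCalculus.
Context {R : realType} {V W : normedModType R}.

(* Class C^k on an open set.  V is finite-dimensional wherever this is used, so
   that it suffices to iterate derivatives along fixed directions. *)
Fixpoint Ck_on (k : nat) (U : set V) (f : V -> W) : Prop :=
  if k is k'.+1 then
    (forall x, U x -> differentiable f x) /\
    (forall v, Ck_on k' U (fun x => 'D_v f x))
  else forall x, U x -> {for x, continuous f}.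

(* Smoothness on an arbitrary set: f is locally the restriction of a C^infinity
   map defined on an open set of V.  For open A this is ordinary smoothness;
   for A relatively open in [0, 1] x R^n it is smoothness up to the boundary. *)
Definition smooth_on (A : set V) (f : V -> W) : Prop :=
  forall x, A x -> exists (U : set V) (g : V -> W),
    [/\ open U, U x, forall k, Ck_on k U g & forall y, U y -> A y -> f y = g y].

End SmoothCalculus.

Section Charts.
Context {R : realType} {n : nat} {M : topologicalType}.

(* [cmap] and [cinv] are total functions; only the values of [cmap] on [cdom]
   and of [cinv] on the image of [cdom] are meaningful. *)
Record chart := Chart {
  cdom : set M;
  cmap :> M -> 'rV[R]_n;
  cinv : 'rV[R]_n -> M }.

Definition cimg (c : chart) : set 'rV[R]_n := c @` cdom c.

Record is_chart (c : chart) : Prop := IsChart {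
  cdom_open : open (cdom c);
  cimg_open : open (cimg c);
  cmapK : forall p, cdom c p -> cinv c (c p) = p;
  cmap_continuous : {within cdom c, continuous c};
  cinv_continuous : {within cimg c, continuous (cinv c)} }.

End Charts.
Arguments chart R n M : clear implicits.

(* A smooth atlas of an n-manifold without boundary, with a preferred chart
   around every point.  The tangent space T_pM is 'rV[R]_n, a vector being
   identified with its components in the preferred chart at p. *)
Record smooth_structure (R : realType) (n : nat) (M : topologicalType) :=
  SmoothStructure {
    atlas : set (chart R n M);
    chart_at : M -> chart R n M;
    atlas_chart : forall c, atlas c -> is_chart c;
    chart_at_atlas : forall p, atlas (chart_at p);
    chart_at_dom : forall p, cdom (chart_at p) p;
    atlas_compat : forall c c', atlas c -> atlas c' ->
      smooth_on (c @` (cdom c `&` cdom c')) (c' \o cinv c) }.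

Section Manifold.
Context {R : realType} {n : nat} {M : topologicalType}.
Variable S : smooth_structure R n M.

Definition closed_manifold : Prop :=
  compact [set: M] /\ hausdorff_space M.

Definition smooth_map (f : M -> M) : Prop :=
  continuous f /\
  forall c c', atlas S c -> atlas S c' ->
    smooth_on [set x | cimg c x /\ cdom c' (f (cinv c x))]
      (fun x => c' (f (cinv c x))).

Definition diffeomorphism (f : M -> M) : Prop :=
  exists g : M -> M,
    [/\ cancel f g, cancel g f, smooth_map f & smooth_map g].

(* Smoothness of (t, p) |-> F t p on T x M. *)
Definition smooth_family (T : set R) (F : R -> M -> M) : Prop :=
  {within T `*` [set: M], continuous (fun z : R * M => F z.1 z.2)} /\
  forall c c', atlas S c -> atlas S c' ->
    smooth_on [set z : R * 'rV[R]_n |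
                 [/\ T z.1, cimg c z.2 & cdom c' (F z.1 (cinv c z.2))]]
      (fun z => c' (F z.1 (cinv c z.2))).

Definition smooth_curve (gamma : R -> M) : Prop :=
  continuous gamma /\
  forall c, atlas S c -> smooth_on (gamma @^-1` cdom c) (c \o gamma).

(* The differential T_pM -> T_(f p)M. *)
Definition tangent_map (f : M -> M) (p : M) : 'rV[R]_n -> 'rV[R]_n :=
  'd (chart_at S (f p) \o f \o cinv (chart_at S p)) (chart_at S p p).

(* The differential at y of the parametrization cinv c, with values in the
   tangent space at cinv c y. *)
Definition tangent_param (c : chart R n M) (y : 'rV[R]_n) :
    'rV[R]_n -> 'rV[R]_n :=
  'd (chart_at S (cinv c y) \o cinv c) y.

Definition form2 (omega : M -> 'M[R]_n) (p : M) (u v : 'rV[R]_n) : R :=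
  (u *m omega p *m v^T) 0 0.

(* The pull-back of omega to R^n by cinv c. *)
Definition form2_in (omega : M -> 'M[R]_n) (c : chart R n M)
    (u v : 'rV[R]_n) (y : 'rV[R]_n) : R :=
  form2 omega (cinv c y) (tangent_param c y u) (tangent_param c y v).

(* The last field is d omega = 0, evaluated on constant vector fields of each
   chart, whose brackets vanish. *)
Record symplectic_form (omega : M -> 'M[R]_n) : Prop := SymplecticForm {
  sform_smooth : forall c, atlas S c ->
    forall u v, smooth_on (cimg c) (form2_in omega c u v);
  sform_alternating : forall p u, form2 omega p u u = 0;
  sform_nondegenerate : forall p u,
    (forall v, form2 omega p u v = 0) -> u = 0;
  sform_closed : forall c, atlas S c -> forall y, cimg c y -> forall u v w,
    'D_u (form2_in omega c v w) y + 'D_v (form2_in omega c w u) y +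
    'D_w (form2_in omega c u v) y = 0 }.

Definition symplectic_map (omega : M -> 'M[R]_n) (f : M -> M) : Prop :=
  forall p u v,
    form2 omega (f p) (tangent_map f p u) (tangent_map f p v) =
    form2 omega p u v.

Definition symplectic_isotopy (omega : M -> 'M[R]_n) (psi : R -> M -> M) :
    Prop :=
  [/\ smooth_family `[0, 1] psi,
      forall t, 0 <= t <= 1 -> diffeomorphism (psi t),
      forall t, 0 <= t <= 1 -> symplectic_map omega (psi t)
    & psi 0 = id].

Definition smooth_hamiltonian (H : R -> M -> R) : Prop :=
  forall c, atlas S c ->
    smooth_on [set z : R * 'rV[R]_n | cimg c z.2]
      (fun z => H z.1 (cinv c z.2)).

Definition dfun (h : M -> R) (p : M) : 'rV[R]_n -> R :=
  'd (h \o cinv (chart_at S p)) (chart_at S p p).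

Definition hamiltonian_vector_field (omega : M -> 'M[R]_n) (H : R -> M -> R)
    (X : R -> M -> 'rV[R]_n) : Prop :=
  forall t p v, form2 omega p (X t p) v = - dfun (H t) p v.

Definition is_flow (X : R -> M -> 'rV[R]_n) (h : R -> M -> M) : Prop :=
  h 0 = id /\
  forall p, continuous (fun t : R => h t p) /\
    forall t : R,
      is_derive t (1 : R) (fun s : R => chart_at S (h t p) (h s p)) (X t (h t p)).

(* Time runs over the whole of R, which gives the same diffeomorphisms as time
   in [0, 1]: a path of Hamiltonians can be reparametrized so as to vanish near
   t = 0 and t = 1, and then be extended by 0. *)
Definition hamiltonian_diffeomorphism (omega : M -> 'M[R]_n) (f : M -> M) :
    Prop :=
  exists (H : R -> M -> R) (X : R -> M -> 'rV[R]_n) (h : R -> M -> M),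
    [/\ smooth_hamiltonian H, hamiltonian_vector_field omega H X,
        is_flow X h & f = h 1].

Definition hamiltonian_deformation (omega : M -> 'M[R]_n)
    (phi psi : R -> M -> M) : Prop :=
  forall t, 0 <= t <= 1 -> exists psit_inv : M -> M,
    [/\ cancel (psi t) psit_inv, cancel psit_inv (psi t)
      & hamiltonian_diffeomorphism omega (phi t \o psit_inv)].

(* Loops R/Z -> M are 1-periodic curves. *)
Definition smooth_loop (gamma : R -> M) : Prop :=
  smooth_curve gamma /\ forall t, gamma (t + 1) = gamma t.

(* Free homotopy, through loops, to a constant loop. *)
Definition contractible_loop (gamma : R -> M) : Prop :=
  exists F : R * R -> M,
    [/\ {within [set z | 0 <= z.1 <= 1], continuous F},
        forall s t, 0 <= s <= 1 -> F (s, t + 1) = F (s, t),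
        forall t, F (0, t) = gamma t
      & exists q, forall t, F (1, t) = q].

Definition one_periodic_orbit (phi : R -> M -> M) (gamma : R -> M) : Prop :=
  forall t, 0 <= t <= 1 -> gamma t = phi t (gamma 0).

(* The eigenvalues are those of the complexification of the differential at a
   fixed point p of f. *)
Definition hyperbolic_at (f : M -> M) (p : M) : Prop :=
  forall a : complex R,
    eigenvalue (map_mx (real_complex R) (lin1_mx (tangent_map f p))) a ->
    `|a| != 1.

Definition hyperbolic_orbit (phi : R -> M -> M) (gamma : R -> M) : Prop :=
  one_periodic_orbit phi gamma /\ hyperbolic_at (phi 1) (gamma 0).

End Manifold.
Arguments closed_manifold M : clear implicits.

(* Main.v *)
(** In a chart in which omega has matrix W, the Hamiltonian
    x |-> - W(a + s w)(w, x), cut off, has at time s a Hamiltonian vector field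
    equal to w at the point a + s w; hence its flow moves a to a + w, and it
    depends smoothly on a and w.  Moving the curves only while they run through
    a small window of time, and combining finitely many windows, one gets
    between any two curves with the same origin an isotopy K_t of Hamiltonian
    diffeomorphisms mapping the first one to the second one at every time.
    Applied to t |-> psi_t (gamma 0) and gamma, this makes gamma an orbit of
    K_t psi_t.

    It remains to compose with time-one maps G_t of cut off quadratic
    Hamiltonians centered at gamma t.  They fix gamma t, and at t = 1 the
    derivative at the center can be made equal to exp l on a Lagrangian L and to
    exp (- l) on a Lagrangian L'.  Let A be the derivative of K_1 psi_1 at
    gamma 1.  If L' is transverse to L and to its image by A, the derivative of
    G_1 K_1 psi_1 has no eigenvalue of modulus 1 for l large enough.

    Smoothness of flows with respect to parameters and time is that of flows of
    autonomous fields, of which parameters and time are coordinates; it follows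
    by induction from the flow of the tangent field (x, v) |-> (f x, f' x v). *)
From HB Require Import structures.
From mathcomp Require Import all_boot all_order all_algebra.
From mathcomp Require Import complex ring lra zify.
From mathcomp Require Import boolp classical_sets functions set_interval reals.
From mathcomp Require Import topology normedtype landau sequences derive realfun exp.
From mathcomp Require Import constructive_ereal ereal measure lebesgue_measure lebesgue_integral ftc.
Require Import Defs.

Set Implicit Arguments.
Unset Strict Implicit.
Unset Printing Implicit Defensive.

Import Order.TTheory GRing.Theory Num.Theory.
Import numFieldNormedType.Exports.

Local Open Scope classical_set_scope.
Local Open Scope ring_scope.

(** * Maps of class C^k *)

Section CkCalculus.
Context {R : realType}.
Implicit Types U V W X : normedModType R.

(** The deformation has to be Hamiltonian at each time separately. So [K_t] is built as the time-one
    map of an auxiliary flow whose parameters, the starting point and the displacement, depend on t;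
    smoothness of the isotopy becomes smooth dependence of that flow on its parameters. At each t a
    single point is moved, hence self-intersections and rests of the curves do no harm. The delicate
    point is that chart coordinates of a curve make sense only during a window of time: near any
    other time the map must be the identity.

    Windows are combined by comparing reparametrizations of one curve: each of the two curves is
    contracted to the common origin by shortening its reparametrization.

    Being an orbit does not constrain the differential at gamma 1, so hyperbolicity can be imposed
    afterwards by maps that fix the orbit. Let P and Q be the projections of the splitting into L
    and L'. Transversality of L' to the image of L makes P A P + Q invertible, and then an
    eigenvector v with eigenvalue of modulus 1 satisfies v = exp (- l) T v, where the norm of T has
    a bound independent of l and of the eigenvalue; this is absurd for l large. *)

Lemma near_eq_diff V W (f g : V -> W) x :
  (\near x, f x = g x) -> differentiable f x ->
  differentiable g x /\ 'd g x = 'd f x :> (V -> W).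
Proof.
move=> fg df.
have E : g \o shift x = cst (g x) + 'd f x +o_ 0 id.
  apply/eqaddoP => e e0 /=.
  move/diff_locally: df => /eqaddoP/(_ e e0) /=.
  have fg0 : \forall y \near (0 : V), f (y + x) = g (y + x).
    by move: fg; rewrite (near_shift 0 x) subr0.
  rewrite !fctE => H; near=> y; rewrite -(near fg0 y)//=.
  by rewrite -(nbhs_singleton fg); near: y; exact: H.
have dE := diff_unique (diff_continuous df) E.
by split=> //; apply/diff_locallyP; rewrite dE; split=> //; exact: diff_continuous.
Unshelve. all: by end_near. Qed.

Lemma near_id_diff V (f : V -> V) x v : (\forall y \near x, f y = y) -> 'd f x v = v.
Proof.
move=> N; have N' : \forall y \near x, id y = f y by apply: filterS N.
have di : differentiable (@id V) x.
  by apply: (@linear_differentiable R V V idfun) => z; exact: cvg_id.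
have [_ e] := near_eq_diff N' di.
by apply: etrans (congr1 (fun h : V -> V => h v) e) _; rewrite diff_val.
Qed.

Lemma near_eq_D V W (f g : V -> W) x v :
  (\near x, f x = g x) -> 'D_v f x = 'D_v g x.
Proof.
have [->|v0] := eqVneq v 0; first by rewrite !derive0.
by move=> fg; apply: near_eq_derive.
Qed.

Lemma scale_is_bilinear V : bilinear_for
    (GRing.Scale.Law.clone _ _ *:%R _) (GRing.Scale.Law.clone _ _ *:%R _)
    (fun (k : R) (v : V) => k *: v).
Proof.
split=> [u'|u] a x y /=; first by rewrite scalerDl scalerA.
by rewrite scalerDr !scalerA mulrC.
Qed.

Lemma differentiable_scale V W (k : V -> R) (f : V -> W) x :
  differentiable k x -> differentiable f x ->
  differentiable (fun y => k y *: f y) x /\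
  forall v, 'd (fun y => k y *: f y) x v = k x *: 'd f x v + 'd k x v *: f x.
Proof.
move=> dk df.
pose bM := bilinear_isBilinear.Build R R W W _ _ _ (@scale_is_bilinear W).
pose b : {bilinear R -> W -> W} := HB.pack (fun (k : R) (v : W) => k *: v) bM.
have cb : continuous (fun p : R * W => b p.1 p.2) by exact: scale_continuous.
have dp := differentiable_pair dk df.
have db := differentiable_bilin (k x, f x) cb.
split; first exact: differentiable_comp dp db.
move=> v; rewrite -[fun y => _]/((fun p => b p.1 p.2) \o (fun y => (k y, f y))).
rewrite diff_comp//= diff_pair//=.
exact: (congr1 (fun h => h ('d k x v, 'd f x v)) (diff_bilin (k x, f x) cb)).
Qed.

(** Openness of U is what lets equality pass to the directional derivatives: at each point the
    functions agree nearby. *)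
Lemma Ck_eq k V W (U : set V) (f g : V -> W) :
  open U -> (forall x, U x -> f x = g x) -> Ck_on k U f -> Ck_on k U g.
Proof.
move=> oU; have nU x : U x -> \near x, U x by move=> Ux; exact: open_nbhs_nbhs.
elim: k W f g => [|k IH] W f g fg /=.
  move=> cf x Ux; rewrite /prop_for /continuous_at -fg//.
  apply: cvg_trans (cf x Ux); apply: near_eq_cvg.
  by near=> y; apply: fg; near: y; exact: nU.
move=> [df Df]; split=> [x Ux|v].
  apply: (near_eq_diff _ (df x Ux)).1; near=> y; apply: fg; near: y; exact: nU.
apply: IH (Df v) => x Ux; apply: near_eq_D; near=> y; apply: fg; near: y; exact: nU.
Unshelve. all: by end_near. Qed.

Lemma Ck_sub k V W (U U' : set V) (f : V -> W) :
  U `<=` U' -> Ck_on k U' f -> Ck_on k U f.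
Proof.
move=> s; elim: k W f => [|k IH] W f /=; first by move=> H x /s; apply: H.
by move=> [H1 H2]; split=> [x /s|v]; [exact: H1|exact: IH].
Qed.

Lemma CkW k V W (U : set V) (f : V -> W) : Ck_on k.+1 U f -> Ck_on k U f.
Proof.
elim: k W f => [|k IH] W f /=.
  by move=> [H _] x Ux; exact: differentiable_continuous (H x Ux).
by move=> [H1 H2]; split=> // v; apply: IH; exact: H2.
Qed.

Lemma Ck_diff k V W (U : set V) (f : V -> W) x :
  Ck_on k.+1 U f -> U x -> differentiable f x.
Proof. by case=> H _ /H. Qed.

Lemma Ck_cts k V W (U : set V) (f : V -> W) x :
  Ck_on k U f -> U x -> {for x, continuous f}.
Proof. by case: k => [|k] H Ux; [exact: H|exact: differentiable_continuous (Ck_diff H Ux)]. Qed.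

Lemma Ck_cst k V W (U : set V) (a : W) : Ck_on k U (fun _ : V => a).
Proof.
elim: k a => [|k IH] a /=; first by move=> x _; exact: cst_continuous.
split=> [x _|v]; first exact: differentiable_cst.
have -> : (fun x : V => 'D_v (fun=> a) x) = fun _ => 0.
  by rewrite funeqE => x; exact: derive_cst.
exact: IH.
Qed.

Lemma Ck_lin k V W (U : set V) (l : {linear V -> W}) : open U ->
  continuous l -> Ck_on k U l.
Proof.
move=> oU cl; case: k => [|k] /=; first by move=> x _; exact: cl.
split=> [x _|v]; first exact: linear_differentiable.
apply: (Ck_eq oU (f := fun _ => l v)); last exact: Ck_cst.
by move=> x _; rewrite deriveE ?diff_lin//; exact: linear_differentiable.
Qed.

Lemma Ck_id k V (U : set V) : open U -> Ck_on k U (fun x => x).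
Proof. by move=> oU; apply: (@Ck_lin k V V U idfun) => // x; exact: cvg_id. Qed.

Lemma CkD k V W (U : set V) (f g : V -> W) : open U ->
  Ck_on k U f -> Ck_on k U g -> Ck_on k U (fun x => f x + g x).
Proof.
move=> oU; elim: k f g => [|k IH] f g /=.
  by move=> H1 H2 x Ux; exact: continuousD (H1 x Ux) (H2 x Ux).
move=> [H1 H2] [H3 H4]; split=> [x Ux|v]; first exact: differentiableD (H1 _ Ux) (H3 _ Ux).
apply: (Ck_eq oU _ (IH _ _ (H2 v) (H4 v))) => x Ux /=.
by rewrite deriveD//; apply: diff_derivable; [exact: H1|exact: H3].
Qed.

Lemma Ck_sum k V W (U : set V) (I : Type) (r : seq I) (P : pred I) (f : I -> V -> W) :
  open U -> (forall i, P i -> Ck_on k U (f i)) ->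
  Ck_on k U (fun x => \sum_(i <- r | P i) f i x).
Proof.
move=> oU H; elim: r => [|i r IH].
  by apply: (Ck_eq oU _ (@Ck_cst k V W U 0)) => x _; rewrite big_nil.
case Pi : (P i); last first.
  by apply: (Ck_eq oU _ IH) => x _; rewrite big_cons Pi.
by apply: (Ck_eq oU _ (CkD oU (H i Pi) IH)) => x _; rewrite big_cons Pi.
Qed.

Lemma Ck_scale k V W (U : set V) (a : V -> R) (f : V -> W) : open U ->
  Ck_on k U a -> Ck_on k U f -> Ck_on k U (fun x => a x *: f x).
Proof.
move=> oU; elim: k a f => [|k IH] a f.
  by move=> /= H1 H2 x Ux; apply: continuousZ; [exact: H1|exact: H2].
move=> Ha Hf; have [[H1 H2] [H3 H4]] := (Ha, Hf).
have D x : U x -> _ := fun Ux => differentiable_scale (H1 x Ux) (H3 x Ux).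
split=> [x /D[]//|v].
apply: (Ck_eq oU (f := fun x => a x *: 'D_v f x + 'D_v a x *: f x)).
  move=> x Ux; have [d e] := D x Ux.
  by rewrite (deriveE _ d) e (deriveE _ (H1 x Ux)) (deriveE _ (H3 x Ux)).
by apply: CkD => //; apply: IH; by [exact: CkW Ha|exact: CkW Hf|exact: H4|exact: H2].
Qed.

Lemma CkN k V W (U : set V) (f : V -> W) : open U ->
  Ck_on k U f -> Ck_on k U (fun x => - f x).
Proof.
move=> oU Hf; have := Ck_scale oU (@Ck_cst k V R U (-1)) Hf.
by apply: Ck_eq => // x _; rewrite scaleN1r.
Qed.

Lemma CkB k V W (U : set V) (f g : V -> W) : open U ->
  Ck_on k U f -> Ck_on k U g -> Ck_on k U (fun x => f x - g x).
Proof. by move=> oU Hf Hg; apply: CkD => //; exact: CkN. Qed.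

Lemma CkM k V (U : set V) (f g : V -> R) : open U ->
  Ck_on k U f -> Ck_on k U g -> Ck_on k U (fun x => f x * g x).
Proof. exact: (@Ck_scale k V R U f g). Qed.

Lemma Ck_prod k V (U : set V) (I : Type) (r : seq I) (P : pred I) (f : I -> V -> R) :
  open U -> (forall i, P i -> Ck_on k U (f i)) ->
  Ck_on k U (fun x => \prod_(i <- r | P i) f i x).
Proof.
move=> oU H; elim: r => [|i r IH].
  by apply: (Ck_eq oU _ (@Ck_cst k V R U 1)) => x _; rewrite big_nil.
case Pi : (P i); last first.
  by apply: (Ck_eq oU _ IH) => x _; rewrite big_cons Pi.
by apply: (Ck_eq oU _ (CkM oU (H i Pi) IH)) => x _; rewrite big_cons Pi.
Qed.

Lemma CkV k V (U : set V) (f : V -> R) : open U -> (forall x, U x -> f x != 0) ->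
  Ck_on k U f -> Ck_on k U (fun x => (f x)^-1).
Proof.
move=> oU f0; elim: k => [|k IH].
  by move=> /= H x Ux; apply: continuousV; [exact: f0|exact: H].
move=> Hf; have [H1 H2] := Hf.
split=> [x Ux|v].
  exact: differentiableV (H1 x Ux) (f0 x Ux).
apply: (Ck_eq oU (f := fun x => - (((f x)^-1 * (f x)^-1) * 'D_v f x))).
  move=> x Ux; rewrite deriveV ?f0//; last exact/diff_derivable/H1.
  by rewrite scaleNr -exprVn expr2.
have HV := IH (CkW Hf); apply: CkN => //.
exact: CkM oU (CkM oU HV HV) (H2 v).
Qed.

Lemma Ck_pair k V W X (U : set V) (f : V -> W) (g : V -> X) : open U ->
  Ck_on k U f -> Ck_on k U g -> Ck_on k U (fun x => (f x, g x)).
Proof.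
move=> oU; elim: k f g => [|k IH] f g.
  by move=> /= H1 H2 x Ux; apply: cvg_pair; [exact: H1|exact: H2].
move=> [H1 H2] [H3 H4].
have D x : U x -> _ := fun Ux => differentiable_pair (H1 x Ux) (H3 x Ux).
split=> [x /D//|v].
apply: (Ck_eq oU _ (IH _ _ (H2 v) (H4 v))) => x Ux.
rewrite (deriveE _ (D x Ux)) (deriveE _ (H1 x Ux)) (deriveE _ (H3 x Ux)).
by rewrite (diff_pair (H1 x Ux) (H3 x Ux)).
Qed.

(* [Ck_on] only controls derivatives along fixed directions, so that the chain
   rule needs a basis with continuous coordinates. *)
Definition findim V := exists m (e : 'I_m -> V) (l : 'I_m -> {linear V -> R}),
  (forall i, continuous (l i)) /\ forall x, x = \sum_i l i x *: e i.

Lemma findim_real : @findim R.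
Proof.
exists 1%N, (fun _ => 1), (fun _ => idfun); split=> [i x|x]; first exact: cvg_id.
by rewrite big_ord_recl big_ord0 addr0 /= [RHS]mulr1.
Qed.

Lemma findim_rV n : findim 'rV[R]_n.
Proof.
have lin i : linear (fun x : 'rV[R]_n => x 0 i) by move=> a x y; rewrite !mxE.
pose lM i := GRing.isLinear.Build _ _ _ _ _ (lin i).
pose l i : {linear 'rV[R]_n -> R} := HB.pack (fun x : 'rV[R]_n => x 0 i) (lM i).
exists n, (fun i => delta_mx 0 i), l; split=> [i|x]; first exact: coord_continuous.
exact: row_sum_delta.
Qed.

Lemma findim_prod V W : findim V -> findim W -> findim (V * W)%type.
Proof.
move=> [m [e [l [cl le]]]] [m' [e' [l' [cl' le']]]].
pose E (i : 'I_m + 'I_m') : V * W := match i with inl i => (e i, 0) | inr i => (0, e' i) end.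
pose L (i : 'I_m + 'I_m') : {linear (V * W)%type -> R} :=
  match i with inl i => l i \o fst | inr i => l' i \o snd end.
exists (m + m')%N, (fun i => E (fintype.split i)), (fun i => L (fintype.split i)); split.
  move=> i; case: (fintype.split i) => j x /=; apply: continuous_comp;
    by [exact: cvg_fst|exact: cvg_snd|exact: cl|exact: cl'].
move=> x; rewrite big_split_ord /=.
under eq_bigr do rewrite (unsplitK (inl _)) /=.
under [X in _ + X]eq_bigr do rewrite (unsplitK (inr _)) /=.
apply: injective_projections; rewrite /= !(raddf_sum fst, raddf_sum snd) /=.
  rewrite [X in _ + X]big1 ?addr0; first by rewrite {1}(le x.1).
  by move=> i _; rewrite scaler0.
rewrite big1 ?add0r; first by rewrite {1}(le' x.2).
by move=> i _; rewrite scaler0.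
Qed.

Lemma Ck_coord k V W m (e : 'I_m -> W) (l : 'I_m -> W -> R) (U : set V) (f : V -> W) :
  open U -> (forall x, x = \sum_i l i x *: e i) ->
  (forall i, Ck_on k U (fun x => l i (f x))) -> Ck_on k U f.
Proof.
move=> oU le H; apply: (Ck_eq oU (f := fun x => \sum_i l i (f x) *: e i)).
  by move=> x _; rewrite -le.
by apply: Ck_sum => // i _; apply: Ck_scale => //; exact: Ck_cst.
Qed.

Lemma Ck_lin_comp k V W X (U : set V) (l : {linear W -> X}) (f : V -> W) :
  open U -> continuous l -> Ck_on k U f -> Ck_on k U (fun x => l (f x)).
Proof.
move=> oU cl; elim: k f => [|k IH] f.
  by move=> H x Ux; apply: continuous_comp; [exact: H|exact: cl].
move=> [H1 H2].
have dl y : differentiable l y by exact: linear_differentiable.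
have dlf x : U x -> differentiable (l \o f) x.
  by move=> Ux; apply: differentiable_comp; [exact: H1|exact: dl].
split=> [x /dlf//|v].
apply: (Ck_eq oU _ (IH _ (H2 v))) => x Ux.
rewrite (deriveE _ (dlf x Ux)) (deriveE _ (H1 x Ux)) (diff_comp (H1 x Ux) (dl _)).
by rewrite (diff_lin _ cl).
Qed.

Lemma Ck_comp k V W X (U : set V) (U' : set W) (g : W -> X) (f : V -> W) :
  findim W -> open U -> open U' -> (forall x, U x -> U' (f x)) ->
  Ck_on k U' g -> Ck_on k U f -> Ck_on k U (fun x => g (f x)).
Proof.
move=> [m [e [l [cl le]]]] oU oU' UU'; elim: k X g f UU' => [|k IH] X g f UU'.
  by move=> Hg Hf x Ux; apply: continuous_comp; [exact: Hf|exact/Hg/UU'].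
move=> Hg Hf; have [[G1 G2] [F1 F2]] := (Hg, Hf).
have dgf x : U x -> differentiable (g \o f) x.
  by move=> Ux; exact: differentiable_comp (F1 x Ux) (G1 _ (UU' _ Ux)).
split=> [x /dgf//|v].
apply: (Ck_eq oU (f := fun x => \sum_i l i ('D_v f x) *: 'D_(e i) g (f x))).
  move=> x Ux; rewrite (deriveE _ (dgf x Ux)) (diff_comp (F1 x Ux) (G1 _ (UU' _ Ux))).
  rewrite /= -(deriveE _ (F1 x Ux)) [in RHS](le ('D_v f x)) linear_sum.
  by apply: eq_bigr => i _; rewrite linearZ (deriveE _ (G1 _ (UU' _ Ux))).
apply: Ck_sum => // i _; apply: Ck_scale => //; first exact: Ck_lin_comp (F2 v).
exact: IH (G2 _) (CkW Hf).
Qed.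

End CkCalculus.

(** * Curves and differential inequalities *)

Section CurveCalculus.
Context {R : realType}.
Implicit Types (V W : normedModType R) (t s a b c T : R).

Lemma is_deriveP V (u : R -> V) t v :
  is_derive t 1 u v <-> differentiable u t /\ 'd u t 1 = v.
Proof.
split=> [[du <-]|[du <-]].
  have := du; rewrite derivable1_diffP => d; split=> //; by rewrite deriveE.
split; last by rewrite deriveE.
by apply/derivable1_diffP.
Qed.

Lemma is_derive_cts V (u : R -> V) t v : is_derive t 1 u v -> {for t, continuous u}.
Proof. by move=> /is_deriveP[d _]; exact: differentiable_continuous. Qed.

Lemma is_derive_chain V W (g : V -> W) (u : R -> V) t v :
  is_derive t 1 u v -> differentiable g (u t) ->
  is_derive t 1 (fun s => g (u s)) ('d g (u t) v).
Proof.
move=> /is_deriveP[du <-] dg; apply/is_deriveP.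
have d := differentiable_comp du dg.
by split=> //; rewrite -[fun s => _]/(g \o u) (diff_comp du dg).
Qed.

Lemma is_derive_lin V W (l : {linear V -> W}) (u : R -> V) t v : continuous l ->
  is_derive t 1 u v -> is_derive t 1 (fun s => l (u s)) (l v).
Proof.
move=> cl du; have dl : differentiable l (u t) by exact: linear_differentiable.
by have := is_derive_chain du dl; rewrite (diff_lin _ cl).
Qed.

Lemma is_derive_congr V (u : R -> V) t v v' : is_derive t 1 u v -> v = v' -> is_derive t 1 u v'.
Proof. by move=> + <-. Qed.

Lemma is_derive_near V (u w : R -> V) t v :
  (\near t, u t = w t) -> is_derive t 1 u v -> is_derive t 1 w v.
Proof.
move=> uw /is_deriveP[du dv]; apply/is_deriveP.
by have [? ->] := near_eq_diff uw du.
Qed.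

Lemma is_derive_comp_real V (u : R -> V) (a : R -> R) t v b :
  is_derive t 1 a b -> is_derive (a t) 1 u v -> is_derive t 1 (fun s => u (a s)) (b *: v).
Proof.
move=> da /is_deriveP[du <-]; apply: is_derive_congr (is_derive_chain da du) _.
by rewrite -linearZ /= [b *: 1]mulr1.
Qed.

Lemma is_derive_opp_arg V (u : R -> V) t v :
  is_derive (- t) 1 u v -> is_derive t 1 (fun s => u (- s)) (- v).
Proof.
move=> du; have da : is_derive t 1 (fun s : R => - s) (-1) by exact: is_deriveN.
by apply: is_derive_congr (is_derive_comp_real da du) _; rewrite scaleN1r.
Qed.

Lemma is_derive_shift_arg V (u : R -> V) t c v :
  is_derive (t + c) 1 u v -> is_derive t 1 (fun s => u (s + c)) v.
Proof.
move=> du; have da : is_derive t 1 (fun s : R => s + c) 1.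
  by apply: is_derive_congr; rewrite addr0.
by apply: is_derive_congr (is_derive_comp_real da du) _; rewrite scale1r.
Qed.

Lemma near_dist_lt V (x : V) (e : R) : 0 < e -> \forall y \near x, `|y - x| < e.
Proof. by move=> e0; apply/nbhs_ballP; exists e => //= y; rewrite -ball_normE /= distrC. Qed.

Lemma derive_le0 (f df : R -> R) a b : a <= b ->
  (forall t, a <= t <= b -> is_derive t 1 f (df t)) ->
  (forall t, a <= t <= b -> df t <= 0) -> f b <= f a.
Proof.
move=> ab H1 H2.
have [||c cab E] := @MVT_segment R f df a b ab.
- by move=> x; rewrite in_itv/= => /andP[ax xb]; apply: H1; rewrite !ltW.
- apply: continuous_in_subspaceT => x; rewrite inE/= in_itv/= => /H1; exact: is_derive_cts.
rewrite -subr_le0 E mulr_le0_ge0 ?subr_ge0//; apply: H2; by move: cab; rewrite in_itv.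
Qed.

Lemma derive_eq0 (f : R -> R) a b : a <= b ->
  (forall t, a <= t <= b -> is_derive t 1 f 0) -> f b = f a.
Proof.
move=> ab H; apply/eqP; rewrite eq_le (derive_le0 ab H)//=.
rewrite -lerN2; apply: (@derive_le0 (fun t => - f t) (fun _ => - 0)) => //= t /H ?.
exact: is_deriveN.
Qed.

Lemma gronwall_real (f df : R -> R) D T : 0 <= T ->
  (forall t, 0 <= t <= T -> is_derive t 1 f (df t)) ->
  (forall t, 0 <= t <= T -> df t <= D * f t) -> f T <= f 0 * expR (D * T).
Proof.
move=> T0 H1 H2.
have dE t : is_derive t 1 (fun t => expR (- D * t)) (- D * expR (- D * t)).
  have da : is_derive t 1 (fun s : R => - D * s) (- D).
    apply: is_derive_congr (@is_deriveZ _ _ _ id (- D) t 1 1 _) _; by rewrite [LHS]mulr1.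
  have := is_derive_comp_real da (is_derive_expR _).
  by [].
have : f T * expR (- D * T) <= f 0 * expR (- D * 0).
  apply: (@derive_le0 (fun t => f t * expR (- D * t))
   (fun t => f t * (- D * expR (- D * t)) + expR (- D * t) * df t)) => // t tT.
    by apply: is_deriveM; exact: H1.
  have -> : f t * (- D * expR (- D * t)) + expR (- D * t) * df t =
    expR (- D * t) * (df t - D * f t) by ring.
  by rewrite pmulr_rle0 ?expR_gt0// subr_le0 H2.
rewrite mulr0 expR0 mulr1 mulNr expRN => H.
by rewrite -ler_pdivrMr ?expR_gt0.
Qed.

(** The integral over [[a, t]] gives a primitive only for t > a. Normalized to vanish at 0, [F a t]
    does not depend on a as long as a lies below 0 and t; the base point may thus follow t, and near
    a given time it can be replaced by the fixed [K]. *)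
Lemma antiderivative_real (h : R -> R) : continuous h ->
  exists P : R -> R, P 0 = 0 /\ forall t, is_derive t 1 P (h t).
Proof.
move=> ch.
pose I a t := (\int[@lebesgue_measure R]_(s in `[a, t]) h s)%R.
pose F a t := I a t - I a 0.
have dF a t : a < t -> is_derive t 1 (F a) (h t).
  move=> at_.
  have ih : (@lebesgue_measure R).-integrable `[a, t + 1] (EFin \o h).
    apply: continuous_compact_integrable; first exact: segment_compact.
    exact: continuous_subspaceT.
  have [d e] := @continuous_FTC1_closed R h a t (t + 1) (ltac:(by rewrite ltrDl)) ih at_ (ch t).
  have dI : is_derive t 1 (I a) (h t) by split; [exact: d|rewrite -derive1E].
  exact: is_derive_congr (is_deriveB dI (is_derive_cst (I a 0) t 1)) (subr0 _).
have FE a b t : a < 0 -> a < t -> b < 0 -> b < t -> F a t = F b t.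
  move=> a0 at_ b0 bt; apply/eqP; rewrite -subr_eq0; apply/eqP.
  have dd s : a < s -> b < s -> is_derive s 1 (fun s => F a s - F b s) 0.
    move=> sa sb; apply: is_derive_congr (is_deriveB (dF a s sa) (dF b s sb)) _.
    by rewrite subrr.
  have z : F a 0 - F b 0 = 0 by rewrite /F !subrr.
  have [t0|t0] := leP 0 t.
    rewrite -z; apply: (@derive_eq0 (fun s => F a s - F b s)) => // s /andP[s0 _].
    by apply: dd; exact: lt_le_trans s0.
  rewrite -z; apply/esym; apply: (@derive_eq0 (fun s => F a s - F b s)); first exact: ltW.
  by move=> s /andP[ts _]; apply: dd; exact: lt_le_trans ts.
exists (fun t => F (- (`|t| + 1)) t); split; first by rewrite /F subrr.
move=> t; set K := - (`|t| + 2).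
have Klt s : `|s - t| < 1 -> K < s.
  move=> H; rewrite /K ltrNl; have H' := lerB_dist s t.
  by have := ler_norm (- s); rewrite normrN; lra.
apply: (is_derive_near (u := F K)).
  near=> s; apply: FE; rewrite /K.
  - by rewrite oppr_lt0 ltr_wpDl.
  - by apply: Klt; near: s; exact: (near_dist_lt (V := R) t ltr01).
  - by rewrite oppr_lt0 ltr_wpDl.
  - rewrite ltrNl (le_lt_trans (ler_norm _))// normrN ltrDl//.
by apply: dF; apply: Klt; rewrite subrr normr0.
Unshelve. all: by end_near.
Qed.

Section FiniteDimensionalCurves.
Variable (V : normedModType R).
Hypothesis fV : findim V.

(** The norm of V need not be differentiable. The sum of squared coordinates is, and it is
    comparable with the squared norm, so Gronwall's argument is run on it. *)
Lemma sq_norm_equiv : exists (m : nat) (l : 'I_m -> {linear V -> R}) (A K : R),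
  [/\ (forall i, continuous (l i)), 0 <= A, 0 <= K,
    forall x, `|x| ^+ 2 <= A * \sum_i l i x ^+ 2
    & forall x, \sum_i l i x ^+ 2 <= K * `|x| ^+ 2].
Proof.
have [m [e [l [cl le]]]] := fV.
have [i|k Hk] := @choice _ _ (fun i k => 0 <= k /\ forall x, `|l i x| <= k * `|x|).
  by have [c c0 Hc] := linear_lipschitz (cl i); exists c; split; [exact: ltW|].
exists m, l, ((\sum_i `|e i|) ^+ 2), (\sum_i k i ^+ 2); split=> //.
- exact: sqr_ge0.
- by apply: sumr_ge0 => i _; exact: sqr_ge0.
- move=> x; set s := \sum_i l i x ^+ 2.
  have s0 : 0 <= s by apply: sumr_ge0 => i _; exact: sqr_ge0.
  have H : `|x| <= (\sum_i `|e i|) * Num.sqrt s.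
    rewrite {1}(le x) mulr_suml (le_trans (ler_norm_sum _ _ _))//.
    apply: ler_sum => i _; rewrite normrZ mulrC ler_wpM2l// -sqrtr_sqr ler_wsqrtr//.
    by rewrite /s (bigD1 i)//= lerDl; apply: sumr_ge0 => j _; exact: sqr_ge0.
  rewrite -(sqr_sqrtr s0) -exprMn lerXn2r// nnegrE ?mulr_ge0 ?sumr_ge0 ?sqrtr_ge0//.
- move=> x; rewrite mulr_suml; apply: ler_sum => i _.
  have [k0 kx] := Hk i.
  by rewrite -exprMn -[leLHS]real_normK ?num_real// lerXn2r// nnegrE mulr_ge0.
Qed.

(** Adding eps^2 to the squared length of w makes the inequality homogeneous: the function [N]
    satisfies N' <= C (1 + L^2) N. The constant depends on V only, so that eps may later be taken
    proportional to a small increment. *)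
Lemma gronwall : exists2 C : R, 0 < C & forall (w w' : R -> V) (L eps T : R),
  0 <= T -> 0 <= L -> 0 <= eps ->
  (forall t, 0 <= t <= T -> is_derive t 1 w (w' t)) ->
  (forall t, 0 <= t <= T -> `|w' t| <= eps + L * `|w t|) ->
  `|w T| ^+ 2 <= C * (`|w 0| ^+ 2 + eps ^+ 2) * expR (C * (1 + L ^+ 2) * T).
Proof.
have [m [l [A [K [cl A0 K0 HA HK]]]]] := sq_norm_equiv.
(* Large enough to dominate every coefficient met below, in front of the exponential as well as
   inside it. *)
exists (1 + A + A * K + 2 * K + 2 * K * A); first nra.
move=> w w' L eps T T0 L0 e0 dw Hw.
set C := 1 + A + A * K + 2 * K + 2 * K * A.
pose sq x := \sum_i l i x ^+ 2.
have sq0 x : 0 <= sq x by apply: sumr_ge0 => i _; exact: sqr_ge0.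
pose N t := sq (w t) + eps ^+ 2.
pose N' t := \sum_i 2 * l i (w t) * l i (w' t).
have dN t : 0 <= t <= T -> is_derive t 1 N (N' t).
  move=> tT; rewrite -[N' t]addr0; apply: is_deriveD.
  have -> : (fun t => sq (w t)) = \sum_i (fun t => l i (w t)) ^+ 2.
    by rewrite funeqE => s; rewrite fct_sumE.
  apply: is_derive_sum => i.
  apply: is_derive_congr (@is_deriveX _ _ _ 2 _ _ _ (is_derive_lin (cl i) (dw t tT))) _.
  by rewrite expr1.
have N'N t : 0 <= t <= T -> N' t <= C * (1 + L ^+ 2) * N t.
  move=> tT.
  have H1 : N' t <= sq (w t) + sq (w' t).
    rewrite -big_split /=; apply: ler_sum => i _.
    by rewrite -subr_ge0 (_ : _ - _ = (l i (w t) - l i (w' t)) ^+ 2) ?sqr_ge0//; ring.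
  have H2 : sq (w' t) <= K * `|w' t| ^+ 2 by exact: HK.
  have H3 : `|w' t| ^+ 2 <= 2 * (eps ^+ 2 + L ^+ 2 * `|w t| ^+ 2).
    have H : `|w' t| ^+ 2 <= (eps + L * `|w t|) ^+ 2.
      by rewrite lerXn2r// ?nnegrE ?Hw// addr_ge0// mulr_ge0.
    have := sqr_ge0 (eps - L * `|w t|); nra.
  have H4 := HA (w t); rewrite -/(sq _) in H4.
  have s0 := sq0 (w t); rewrite /N; move: (sq (w t)) s0 H1 H4 => s s0 H1 H4.
  have H5 : L ^+ 2 * `|w t| ^+ 2 <= L ^+ 2 * (A * s) by rewrite ler_wpM2l ?sqr_ge0.
  have H6 : K * `|w' t| ^+ 2 <= K * (2 * (eps ^+ 2 + L ^+ 2 * (A * s))).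
    by rewrite ler_wpM2l// (le_trans H3)// ler_wpM2l// lerD2l.
  have L2 := sqr_ge0 L; have E2 := sqr_ge0 eps.
  apply: (le_trans H1); apply: (@le_trans _ _ (s + K * (2 * (eps ^+ 2 + L ^+ 2 * (A * s))))); first lra.
  move: (L ^+ 2) (eps ^+ 2) L2 E2 => l2 e2 L2 E2; rewrite -subr_ge0.
  have -> : C * (1 + l2) * (s + e2) - (s + K * (2 * (e2 + l2 * (A * s)))) =
     (A + A * K + 2 * K * A) * e2 + e2 + (A + A * K + 2 * K) * s + 2 * K * A * s
     + (1 + A + A * K + 2 * K + 2 * K * A) * l2 * e2 + (1 + A + A * K + 2 * K) * l2 * s.
    by rewrite /C; ring.
  by rewrite !addr_ge0// !mulr_ge0// !addr_ge0// !mulr_ge0.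
have := gronwall_real T0 dN N'N.
set E := expR _ => H.
have E0 : 0 <= E by exact: expR_ge0.
apply: (le_trans (HA (w T))); rewrite -/(sq _).
have H1 : sq (w T) <= N T by rewrite lerDl sqr_ge0.
have H2 : N 0 <= K * `|w 0| ^+ 2 + eps ^+ 2 by rewrite lerD2r HK.
apply: (@le_trans _ _ (A * (N 0 * E))); first by rewrite ler_wpM2l// (le_trans H1).
rewrite mulrA ler_wpM2r//.
apply: (@le_trans _ _ (A * (K * `|w 0| ^+ 2 + eps ^+ 2))); first by rewrite ler_wpM2l.
have W2 := sqr_ge0 `|w 0|; have E2 := sqr_ge0 eps.
move: (`|w 0| ^+ 2) (eps ^+ 2) W2 E2 => w2 e2 W2 E2; rewrite -subr_ge0.
have -> : C * (w2 + e2) - A * (K * w2 + e2) =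
  (1 + A + 2 * K + 2 * K * A) * w2 + (1 + A * K + 2 * K + 2 * K * A) * e2.
  by rewrite /C; ring.
by rewrite !addr_ge0// !mulr_ge0// !addr_ge0// !mulr_ge0.
Qed.

(** Gronwall's inequality with eps = 0, applied to the difference of the two curves, which starts at
    0. *)
Lemma ode_unique (g : R -> V -> V) (u v : R -> V) L T : 0 <= T -> 0 <= L ->
  (forall t, 0 <= t <= T -> is_derive t 1 u (g t (u t))) ->
  (forall t, 0 <= t <= T -> is_derive t 1 v (g t (v t))) ->
  (forall t, 0 <= t <= T -> `|g t (u t) - g t (v t)| <= L * `|u t - v t|) ->
  u 0 = v 0 -> u T = v T.
Proof.
move=> T0 L0 du dv HL uv; have [C C0 HC] := gronwall.
have := HC (fun t => u t - v t) (fun t => g t (u t) - g t (v t)) L 0 T T0 L0 (lexx _).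
rewrite uv subrr normr0 !expr0n /= addr0 mulr0 mul0r => H; apply/eqP.
rewrite -subr_eq0 -normr_eq0 -sqrf_eq0 -(rwP eqP).
apply/le_anti; rewrite sqr_ge0 andbT; apply: H => t tT.
  by apply: is_deriveB; [exact: du|exact: dv].
by rewrite add0r; exact: HL.
Qed.

End FiniteDimensionalCurves.

End CurveCalculus.

(** * Existence of solutions of differential equations *)

Section Picard.
Context {R : realType}.
Implicit Types t s T : R.

Lemma geometric_limit (a : nat -> R) B : (forall k, `|a k.+1 - a k| <= B / 2 ^+ k) ->
  forall k, `|limn a - a k| <= 2 * B / 2 ^+ k.
Proof.
move=> H.
have p2 k : 0 < (2 : R) ^+ k by exact: exprn_gt0.
have B0 : 0 <= B by have := H 0%N; rewrite expr0 divr1; exact: le_trans.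
have ca : cvgn a.
  have -> : a = (fun n => a 0%N + series (telescope a) n).
    by rewrite funeqE => n; exact: eq_sum_telescope.
  apply: is_cvgD; first exact: is_cvg_cst.
  apply: normed_cvg; apply: (@series_le_cvg R _ (geometric B 2^-1)).
  - by move=> n; exact: normr_ge0.
  - by move=> n; rewrite mulr_ge0// exprn_ge0.
  - by move=> n; rewrite /= exprVn; exact: H.
  - by apply: is_cvg_geometric_series; rewrite ger0_norm// invf_lt1// ltr1n.
(* The subtracted term makes the telescoped bound inductive in j; it is dropped afterwards. *)
have D k j : `|a (k + j)%N - a k| <= 2 * B / 2 ^+ k - 2 * B / 2 ^+ (k + j).
  elim: j => [|j IH]; first by rewrite addn0 !subrr normr0.
  rewrite addnS; have h := H (k + j)%N.
  have E : 2 * B / 2 ^+ (k + j).+1 = B / 2 ^+ (k + j).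
    by rewrite exprS invfM mulrACA divff ?mul1r// pnatr_eq0.
  have := ler_normD (a (k + j).+1 - a (k + j)%N) (a (k + j)%N - a k).
  rewrite subrKA E; have := p2 (k + j)%N => q h'.
  have E2 : 2 * B / 2 ^+ (k + j) = B / 2 ^+ (k + j) + B / 2 ^+ (k + j) by lra.
  rewrite E2 in IH; lra.
move=> k.
have D' n : (k <= n)%N -> `|a n - a k| <= 2 * B / 2 ^+ k.
  move=> kn; have := D k (n - k)%N; rewrite subnKC//.
  move=> /le_trans; apply; rewrite lerBlDr lerDl.
  by rewrite mulr_ge0 ?invr_ge0 ?(ltW (p2 _))// mulr_ge0.
rewrite ler_norml; apply/andP; split.
  rewrite lerBrDl; apply: limr_ge => //; near=> n.
  have : `|a n - a k| <= 2 * B / 2 ^+ k by apply: D'; near: n; exact: nbhs_infty_ge.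
  by rewrite ler_norml => /andP[]; lra.
rewrite lerBlDr; apply: limr_le => //; near=> n.
have : `|a n - a k| <= 2 * B / 2 ^+ k by apply: D'; near: n; exact: nbhs_infty_ge.
by rewrite ler_norml => /andP[]; lra.
Unshelve. all: by end_near. Qed.

(** Comparison with K / lam exp (lam t), whose derivative is K exp (lam t). *)
Lemma exp_bound_pos (w w' : R -> R) K lam T : 0 < lam -> 0 <= K -> 0 <= T -> w 0 = 0 ->
  (forall t, 0 <= t <= T -> is_derive t 1 w (w' t)) ->
  (forall t, 0 <= t <= T -> w' t <= K * expR (lam * t)) ->
  w T <= K / lam * expR (lam * T).
Proof.
move=> l0 K0 T0 w0 dw Hw.
have dE t : is_derive t 1 (fun t => K / lam * expR (lam * t)) (K * expR (lam * t)).
  have da : is_derive t 1 (fun s : R => lam * s) lam.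
    apply: is_derive_congr (@is_deriveZ _ _ _ id lam t 1 1 _) _; by rewrite [LHS]mulr1.
  have dd := is_derive_comp_real da (is_derive_expR (lam * t)).
  apply: is_derive_congr (@is_deriveZ _ _ _ (fun t => expR (lam * t)) (K / lam) t 1 _ dd) _.
  by rewrite /GRing.scale /= mulrA divfK// gt_eqF.
have : w T - K / lam * expR (lam * T) <= w 0 - K / lam * expR (lam * 0).
  apply: (@derive_le0 R (fun t => w t - K / lam * expR (lam * t))
    (fun t => w' t - K * expR (lam * t))) => // t tT.
    by apply: is_deriveB; exact: dw.
  by rewrite subr_le0 Hw.
have : 0 <= K / lam by rewrite divr_ge0// ltW.
by rewrite mulr0 expR0 mulr1 w0; lra.
Qed.

Lemma exp_bound_real (w w' : R -> R) K lam T : 0 < lam -> 0 <= K -> w 0 = 0 ->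
  (forall t, `|t| <= T -> is_derive t 1 w (w' t)) ->
  (forall t, `|t| <= T -> `|w' t| <= K * expR (lam * `|t|)) ->
  forall t, `|t| <= T -> `|w t| <= K / lam * expR (lam * `|t|).
Proof.
move=> l0 K0 w0 dw Hw t tT.
have dwN s : `|s| <= T -> is_derive s 1 (fun s => - w s) (- w' s).
  by move=> sT; apply: is_deriveN; exact: dw.
have [t0|t0] := leP 0 t.
  have sT s : 0 <= s <= t -> `|s| <= T.
    by move=> /andP[s0 st]; rewrite ger0_norm// (le_trans st)// -(ger0_norm t0).
  have HH s : 0 <= s <= t -> `|w' s| <= K * expR (lam * s).
    by move=> st; have := Hw s (sT s st); rewrite (@ger0_norm _ s)//; case/andP: st.
  rewrite (ger0_norm t0) ler_norml lerNl; apply/andP; split.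
    apply: (@exp_bound_pos (fun s => - w s) (fun s => - w' s)) => // [|s /sT|s st].
    - by rewrite w0 oppr0.
    - exact: dwN.
    - by apply: le_trans (HH s st); rewrite -normrN ler_norm.
  apply: (@exp_bound_pos w w') => // s st; first exact: dw (sT s st).
  by apply: le_trans (HH s st); rewrite ler_norm.
have nt0 : 0 <= - t by rewrite oppr_ge0 ltW.
have sT s : 0 <= s <= - t -> `|- s| <= T.
  by move=> /andP[s0 st]; rewrite normrN ger0_norm// (le_trans st)// -(ltr0_norm t0).
have HH s : 0 <= s <= - t -> `|w' (- s)| <= K * expR (lam * s).
  by move=> st; have := Hw _ (sT s st); rewrite normrN (@ger0_norm _ s)//; case/andP: st.
rewrite (ltr0_norm t0) ler_norml lerNl; apply/andP; split.
  have := @exp_bound_pos (fun s => - w (- s)) (fun s => - - w' (- s)) K lam (- t) l0 K0 nt0.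
  rewrite opprK oppr0 w0 oppr0; apply => // s st.
    by apply: (is_derive_opp_arg (u := fun s => - w s)); exact: dwN (sT s st).
  by rewrite opprK; apply: le_trans (HH s st); rewrite ler_norm.
have := @exp_bound_pos (fun s => w (- s)) (fun s => - w' (- s)) K lam (- t) l0 K0 nt0.
rewrite opprK oppr0 w0; apply => // s st.
  by apply: is_derive_opp_arg; exact: dw (sT s st).
by apply: le_trans (HH s st); rewrite -normrN ler_norm.
Qed.

Variable V : normedModType R.
Hypothesis fV : findim V.

Lemma coord_bounds : exists m (e : 'I_m -> V) (l : 'I_m -> {linear V -> R}) (k : 'I_m -> R),
  [/\ forall i, continuous (l i), forall x, x = \sum_i l i x *: e i,
     forall i, 0 <= k i & forall i x, `|l i x| <= k i * `|x|].
Proof.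
have [m [e [l [cl le]]]] := fV.
have [i|k Hk] := @choice _ _ (fun i k => 0 <= k /\ forall x, `|l i x| <= k * `|x|).
  by have [c c0 Hc] := linear_lipschitz (cl i); exists c; split; [exact: ltW|].
by exists m, e, l, k; split=> // i; have [] := Hk i.
Qed.

(** The factor 1 / lam gained by integrating makes the Picard map a contraction on the whole of
    [-T, T] for the norm sup |u t| exp (- lam |t|), once lam is large; no subdivision of the
    interval is required. *)
Lemma exp_bound : exists2 C, 0 < C & forall (w w' : R -> V) K lam T, 0 < lam -> 0 <= K ->
  w 0 = 0 ->
  (forall t, `|t| <= T -> is_derive t 1 w (w' t)) ->
  (forall t, `|t| <= T -> `|w' t| <= K * expR (lam * `|t|)) ->
  forall t, `|t| <= T -> `|w t| <= C * K / lam * expR (lam * `|t|).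
Proof.
have [m [e [l [k [cl le k0 Hk]]]]] := coord_bounds.
have S0 : 0 <= \sum_i k i * `|e i| by apply: sumr_ge0 => i _; rewrite mulr_ge0.
exists (1 + \sum_i k i * `|e i|); first by rewrite ltr_pwDl.
move=> w w' K lam T l0 K0 w0 dw Hw t tT.
have E0 : 0 <= K / lam * expR (lam * `|t|) by rewrite mulr_ge0 ?expR_ge0// divr_ge0// ltW.
rewrite -!mulrA mulrDl mul1r; apply: ler_wpDl; first by rewrite mulrA.
rewrite {1}(le (w t)) (le_trans (ler_norm_sum _ _ _))// mulr_suml.
apply: ler_sum => i _; rewrite normrZ [leRHS]mulrAC ler_wpM2r//.
have := @exp_bound_real (fun s => l i (w s)) (fun s => l i (w' s)) (k i * K) lam T l0.
rewrite w0 linear0 mulr_ge0// !mulrA; apply => // s sT.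
  by apply: is_derive_lin (dw s sT); exact: cl.
by rewrite (le_trans (Hk _ _))// -mulrA ler_wpM2l// Hw.
Qed.

Lemma antiderivative (h : R -> V) : continuous h ->
  exists P : R -> V, P 0 = 0 /\ forall t, is_derive t 1 P (h t).
Proof.
have [m [e [l [k [cl le k0 Hk]]]]] := coord_bounds => ch.
have chl i : continuous (fun t => l i (h t)).
  by move=> t; apply: continuous_comp; [exact: ch|exact: cl].
have [P HP] := @choice _ _ (fun i (P : R -> R) => P 0 = 0 /\ forall t, is_derive t 1 P (l i (h t)))
  (fun i => antiderivative_real (chl i)).
exists (fun t => \sum_i P i t *: e i); split.
  by apply: big1 => i _; rewrite (HP i).1 scale0r.
move=> t; rewrite (le (h t)).
have -> : (fun t => \sum_i P i t *: e i) = \sum_i (fun t => P i t *: e i).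
  by rewrite funeqE => s; rewrite fct_sumE.
apply: is_derive_sum => i; have := (HP i).2 t => dP.
have lM : linear (fun c : R => c *: e i) by move=> a x y; rewrite scalerDl -scalerA.
pose mM := GRing.isLinear.Build _ _ _ _ _ lM.
pose f : {linear R -> V} := HB.pack (fun c : R => c *: e i) mM.
by apply: (is_derive_lin (l := f)) => //; exact: scalel_continuous.
Qed.

(** The Lipschitz constant may depend on the time bound T but not on the position, which is why
    solutions exist for all times of both signs. *)
Theorem picard (g : R -> V -> V) (x0 : V) :
  (forall u : R -> V, continuous u -> continuous (fun t => g t (u t))) ->
  (forall T, exists2 L, 0 <= L & forall t x y, `|t| <= T -> `|g t x - g t y| <= L * `|x - y|) ->
  exists u : R -> V, u 0 = x0 /\ forall t, is_derive t 1 u (g t (u t)).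
Proof.
move=> Hc HL; have [C C0 HC] := exp_bound.
have st (u : R -> V) : exists v : R -> V, continuous u ->
    v 0 = x0 /\ forall t, is_derive t 1 v (g t (u t)).
  have [cu|ncu] := pselect (continuous u); last by exists u.
  have [P [P0 dP]] := antiderivative (Hc u cu).
  exists (fun t => x0 + P t) => _; split; first by rewrite P0 addr0.
  by move=> t; rewrite -[g t _]add0r; apply: is_deriveD; exact: dP.
have [step Hstep] := choice st.
pose u := fix u (k : nat) : R -> V := if k is k'.+1 then step (u k') else (fun _ => x0).
have cu k : continuous (u k).
  elim: k => [|k IH]; first by move=> t; exact: cst_continuous.
  by move=> t; exact: is_derive_cts ((Hstep _ IH).2 t).
have u0 k : u k 0 = x0 by case: k => // k; exact: (Hstep _ (cu k)).1.
have du k t : is_derive t 1 (u k.+1) (g t (u k t)) by exact: (Hstep _ (cu k)).2.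
have est T : exists2 B, 0 <= B & forall k t, `|t| <= T -> `|u k.+1 t - u k t| <= B / 2 ^+ k.
  have [L L0 HLT] := HL T.
  (* Chosen so that C L / lam <= 1 / 2: each iteration halves the weighted distance. *)
  pose lam := 2 * C * (L + 1).
  have l0 : 0 < lam by rewrite !mulr_gt0// ltr_wpDl.
  have bd : exists2 M, 0 <= M & forall t, `|t| <= T -> `|u 1%N t - u 0%N t| <= M.
    have [T0|T0] := leP 0 T; last first.
      by exists 0 => // t; move=> tT; have := le_lt_trans (le_trans (normr_ge0 t) tT) T0; rewrite ltxx.
    have cd : continuous (fun t => `|u 1%N t - u 0%N t|).
      by move=> t; apply: cvg_norm; apply: cvgB; exact: cu.
    have NT : - T <= T by rewrite ge0_cp.
    have [c _ Hm] := EVT_max NT (continuous_subspaceT cd).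
    exists `|u 1%N c - u 0%N c| => // t tT; apply: Hm.
    by rewrite in_itv/= -ler_norml.
  have [M M0 HM] := bd.
  have D k : forall t, `|t| <= T -> `|u k.+1 t - u k t| <= M / 2 ^+ k * expR (lam * `|t|).
    elim: k => [|k IH] t tT.
      rewrite expr0 divr1 (le_trans (HM t tT))// ler_peMr// -expR0 ler_expR mulr_ge0// ltW//.
    have := HC (fun t => u k.+2 t - u k.+1 t) (fun t => g t (u k.+1 t) - g t (u k t))
      (L * (M / 2 ^+ k)) lam T l0.
    rewrite mulr_ge0 ?divr_ge0 ?exprn_ge0// !u0 subrr => /(_ isT erefl) H.
    apply: (@le_trans _ _ (C * (L * (M / 2 ^+ k)) / lam * expR (lam * `|t|))).
      have dd s : `|s| <= T -> is_derive s 1 (fun s => u k.+2 s - u k.+1 s)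
        (g s (u k.+1 s) - g s (u k s)) by move=> _; apply: is_deriveB; exact: du.
      apply: (H (fun s sT => dd s sT)) => // s sT.
      by rewrite -mulrA (le_trans (HLT _ _ _ sT))// ler_wpM2l// IH.
    rewrite ler_wpM2r ?expR_ge0// ler_pdivrMr// /lam exprS.
    have p2 : 0 < (2 : R) ^+ k by exact: exprn_gt0.
    rewrite invfM.
    have -> : M * (2^-1 * (2 ^+ k)^-1) * (2 * C * (L + 1)) = C * ((L + 1) * (M / 2 ^+ k)).
      by field; rewrite gt_eqF.
    by rewrite ler_pM2l// mulrDl mul1r lerDl divr_ge0// ltW.
  exists (M * expR (lam * T)); first by rewrite mulr_ge0// expR_ge0.
  move=> k t tT; rewrite (le_trans (D k t tT))// -mulrAC ler_wpM2r ?invr_ge0 ?exprn_ge0//.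
  by rewrite ler_wpM2l// ler_expR ler_pM2l.
have [m [e [l [k [cl le k0 Hk]]]]] := coord_bounds.
(* The limit is taken coordinate by coordinate, so that only the completeness of the reals is called
   upon. *)
pose U t := \sum_i limn (fun n => l i (u n t)) *: e i.
have Uest T : exists2 B, 0 <= B & forall k t, `|t| <= T -> `|U t - u k t| <= B / 2 ^+ k.
  have [B B0 HB] := est T.
  exists (\sum_i 2 * (k i * B) * `|e i|).
    by apply: sumr_ge0 => i _; rewrite !mulr_ge0.
  move=> n t tT; rewrite {1}(le (u n t)) /U -sumrB (le_trans (ler_norm_sum _ _ _))//.
  rewrite mulr_suml; apply: ler_sum => i _.
  rewrite -scalerBl normrZ mulrAC ler_wpM2r//.
  apply: (@geometric_limit (fun n => l i (u n t))) => j.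
  by rewrite -linearB (le_trans (Hk _ _))// -mulrA ler_wpM2l// HB.
have pow_small (B e1 : R) : 0 <= B -> 0 < e1 -> exists j : nat, B / 2 ^+ j < e1.
  move=> B0 e10; have : geometric B 2^-1 @ \oo --> (0 : R).
    by apply: cvg_geometric; rewrite ger0_norm// invf_lt1// ltr1n.
  move=> /cvgrPdist_lt/(_ e1 e10)[N _ HN]; exists N.
  have := HN N (leqnn _); rewrite /= sub0r normrN exprVn ger0_norm//.
  by rewrite divr_ge0// exprn_ge0.
have cU : continuous U.
  move=> t; apply/cvgrPdist_lt => eps eps0.
  have [B B0 HB] := Uest (`|t| + 1).
  have [j Hj] := pow_small B (eps / 3) B0 (ltac:(by rewrite divr_gt0)).
  have := cu j t => /cvgrPdist_lt/(_ (eps / 3) (ltac:(by rewrite divr_gt0))) Hcu.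
  near=> s.
  have st1 : `|s - t| < 1 by near: s; exact: (near_dist_lt (V := R) t ltr01).
  have sT : `|s| <= `|t| + 1.
    by have := ler_normD (s - t) t; rewrite subrK; lra.
  have H1 := HB j t (ltac:(by rewrite lerDl)); have H2 := HB j s sT.
  have H3 : `|u j t - u j s| < eps / 3 by near: s.
  have -> : U t - U s = (U t - u j t) + (u j t - u j s) - (U s - u j s).
    by rewrite subrKA opprB addrA subrK.
  have := ler_normB (U t - u j t + (u j t - u j s)) (U s - u j s).
  have := ler_normD (U t - u j t) (u j t - u j s); lra.
have [v0 dv] := Hstep U cU.
(* [step U] has derivative [g t (U t)] by construction. Once it is identified with [U], both being
   limits of the iterates, no derivative has to be passed to the limit. *)
suff E : step U = U by exists U; rewrite -{1 2}E.
apply/funext => t; apply/eqP; rewrite -subr_eq0 -normr_eq0 eq_le normr_ge0 andbT.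
apply/ler_addgt0Pr => eps eps0; rewrite add0r.
have [L L0 HLT] := HL `|t|; have [B B0 HB] := Uest `|t|.
pose A := C * L * B * expR `|t| + B.
have A0 : 0 <= A by rewrite addr_ge0// !mulr_ge0// ?expR_ge0// ltW.
have [j Hj] := pow_small A eps A0 eps0.
have P0 : 0 <= B / 2 ^+ j by rewrite divr_ge0// exprn_ge0.
have H1 := HC (fun t => step U t - u j.+1 t) (fun t => g t (U t) - g t (u j t))
    (L * (B / 2 ^+ j)) 1 `|t| ltr01.
rewrite mulr_ge0// v0 u0 subrr in H1.
have H2 : `|step U t - u j.+1 t| <= C * (L * (B / 2 ^+ j)) / 1 * expR (1 * `|t|).
  have dd s : `|s| <= `|t| -> is_derive s 1 (fun s => step U s - u j.+1 s)
    (g s (U s) - g s (u j s)) by move=> _; exact: is_deriveB (dv s) (du j s).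
  apply: (H1 isT erefl (fun s sT => dd s sT)) => // s sT.
  rewrite mul1r (le_trans (HLT _ _ _ sT))//.
  apply: (@le_trans _ _ (L * (B / 2 ^+ j))); first by rewrite ler_wpM2l// HB.
  by rewrite ler_peMr ?mulr_ge0// -expR0 ler_expR.
have H3 := HB j.+1 t (lexx _).
have H4 : B / 2 ^+ j.+1 <= B / 2 ^+ j.
  by rewrite ler_wpM2l// lef_pV2 ?posrE ?exprn_gt0// ler_eXn2l ?ltr1n.
have -> : step U t - U t = (step U t - u j.+1 t) - (U t - u j.+1 t) by rewrite opprB addrA subrK.
rewrite (le_trans (ler_normB _ _))// (le_trans _ (ltW Hj))//.
rewrite divr1 mul1r in H2.
have -> : A / 2 ^+ j = C * (L * (B / 2 ^+ j)) * expR `|t| + B / 2 ^+ j by rewrite /A; ring.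
by rewrite lerD// (le_trans H3).
Unshelve. all: by end_near. Qed.

End Picard.

(** * Smooth dependence on initial conditions *)

Section SmoothDependence.
Context {R : realType}.
Implicit Types (V W X : normedModType R) (t s T : R).

Lemma cvg_sumr V (I Y : Type) (r : seq I) (F : set_system Y) (f : I -> Y -> V) (a : I -> V)
  {FF : Filter F} :
  (forall i, f i @ F --> a i) ->
  (fun x => \sum_(i <- r) f i x) @ F --> \sum_(i <- r) a i.
Proof.
move=> H; elim: r => [|i r IH].
  by rewrite big_nil; under eq_fun do rewrite big_nil; exact: cvg_cst.
by rewrite big_cons; under eq_fun do rewrite big_cons; exact: cvgD.
Qed.

Lemma is_derive_scalel V (h : V) s : is_derive s 1 (fun s => s *: h) h.
Proof.
have [d e] := is_diff_scalel s h; apply/is_deriveP; split=> //.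
by rewrite e scale1r.
Qed.

Lemma open_prod V W (A : set V) (B : set W) : open A -> open B -> open (A `*` B).
Proof.
move=> oA oB; have -> : A `*` B = (fst @^-1` A) `&` (snd @^-1` B) by [].
by apply: openI; apply: open_comp => // z _; [exact: cvg_fst|exact: cvg_snd].
Qed.

Lemma Ck_fst k V W (U : set (V * W)%type) : open U -> Ck_on k U fst.
Proof.
move=> oU; apply: (@Ck_lin R k _ _ U (fst : {linear (V * W)%type -> V})) => // z.
exact: cvg_fst.
Qed.

Lemma Ck_snd k V W (U : set (V * W)%type) : open U -> Ck_on k U snd.
Proof.
move=> oU; apply: (@Ck_lin R k _ _ U (snd : {linear (V * W)%type -> W})) => // z.
exact: cvg_snd.
Qed.

Lemma Ck_fst_comp k V W X (U : set V) (f : V -> W * X) : open U ->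
  Ck_on k U f -> Ck_on k U (fun x => (f x).1).
Proof.
move=> oU; apply: (@Ck_lin_comp R k V _ W U (fst : {linear (W * X)%type -> W})) => // z.
exact: cvg_fst.
Qed.

Lemma Ck_snd_comp k V W X (U : set V) (f : V -> W * X) : open U ->
  Ck_on k U f -> Ck_on k U (fun x => (f x).2).
Proof.
move=> oU; apply: (@Ck_lin_comp R k V _ X U (snd : {linear (W * X)%type -> X})) => // z.
exact: cvg_snd.
Qed.

Definition smoothT V W (f : V -> W) := forall k, Ck_on k setT f.

Lemma smoothT_diff V W (f : V -> W) x : smoothT f -> differentiable f x.
Proof. by move=> sf; exact: (Ck_diff (sf 1%N) I). Qed.

Lemma smoothT_cts V W (f : V -> W) : smoothT f -> continuous f.
Proof. by move=> sf x; exact: (Ck_cts (sf 0%N) I). Qed.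

Lemma smoothT_D V W (f : V -> W) v : smoothT f -> smoothT ('D_v f).
Proof. by move=> sf k; exact: (sf k.+1).2 v. Qed.

Lemma Ck_tangent k V W (U : set V) (f : V -> W) : findim V -> open U ->
  Ck_on k.+1 U f -> Ck_on k (U `*` setT) (fun z : V * V => 'd f (z.1 : V) (z.2 : V)).
Proof.
move=> fV oU cf; have [m [e [l [cl le]]]] := fV.
have oU' : open (U `*` [set: V]) by exact: open_prod openT.
apply: (Ck_eq oU' (f := fun z => \sum_i l i z.2 *: 'D_(e i) f z.1)).
  move=> [x v] [/= Ux _]; rewrite [in RHS](le v) linear_sum; apply: eq_bigr => i _.
  by rewrite linearZ deriveE//; exact: Ck_diff cf Ux.
apply: Ck_sum => // i _; apply: Ck_scale => //.
  by apply: (Ck_lin_comp (l := l i)) => //; exact: Ck_snd.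
apply: (Ck_comp (U' := U) (g := 'D_(e i) f)) => //; first by move=> z [].
  exact: (cf.2 (e i)).
exact: Ck_fst.
Qed.

Lemma smoothT_tangent V W (f : V -> W) : findim V -> smoothT f ->
  smoothT (fun z : V * V => 'd f (z.1 : V) (z.2 : V)).
Proof. by move=> fV sf k; rewrite -setXTT; exact: Ck_tangent openT (sf k.+1). Qed.

Lemma mvt_ineq V : findim V -> exists2 C : R, 0 < C & forall (w w' : R -> V) (K : R),
  (forall s, 0 <= s <= 1 -> is_derive s 1 w (w' s)) ->
  (forall s, 0 <= s <= 1 -> `|w' s| <= K) -> `|w 1 - w 0| <= C * K.
Proof.
move=> fV; have [m [e [l [k [cl le k0 Hk]]]]] := coord_bounds fV.
have S0 : 0 <= \sum_i k i * `|e i| by apply: sumr_ge0 => i _; rewrite mulr_ge0.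
exists (1 + \sum_i k i * `|e i|); first by rewrite ltr_pwDl.
move=> w w' K dw Hw.
have K0 : 0 <= K by apply: le_trans (Hw 0 _); rewrite ?normr_ge0// lexx ler01.
rewrite mulrDl mul1r; apply: ler_wpDl => //.
rewrite {1}(le (w 1 - w 0)) (le_trans (ler_norm_sum _ _ _))// mulr_suml.
apply: ler_sum => i _; rewrite normrZ [leRHS]mulrAC ler_wpM2r//.
have [||c c01 E] := @MVT_segment R (fun s => l i (w s)) (fun s => l i (w' s)) 0 1 ler01.
- move=> s; rewrite in_itv /= => /andP[s0 s1]; apply: is_derive_lin (dw s _); first exact: cl.
  by rewrite !ltW.
- apply: continuous_in_subspaceT => s; rewrite inE/= in_itv/= => /dw ds.
  by apply: is_derive_cts (is_derive_lin _ ds); exact: cl.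
rewrite raddfB E subr0 mulr1 (le_trans (Hk _ _))// ler_wpM2l// Hw//.
Qed.

(** Bootstrap: at the first time c where g reaches B, one has g <= B on [0, c], and the hypothesis
    gives g c < B, a contradiction. The first time exists because the level set in [0, s] is
    compact. *)
Lemma continuation (g : R -> R) B T : continuous g -> g 0 < B ->
  (forall s, 0 <= s <= T -> (forall r, 0 <= r <= s -> g r <= B) -> g s < B) ->
  forall s, 0 <= s <= T -> g s < B.
Proof.
move=> cg g0 H s /andP[s0 sT]; rewrite ltNge; apply/negP => gs.
have hit r : 0 <= r -> B <= g r -> exists2 r', 0 <= r' <= r & g r' = B.
  move=> r0 gr; have [|c] := IVT r0 (continuous_subspaceT cg) (v := B).
    by rewrite ge_min le_max (ltW g0)/= gr orbT.
  by rewrite in_itv /= => cr gc; exists c.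
pose E := `[0, s] `&` [set r | g r = B].
have cE : compact E.
  apply: (subclosed_compact _ (@segment_compact R 0 s)); last exact: subIsetl.
  apply: closedI; first exact: itv_closed.
  by apply: (@closed_comp _ _ g [set B]) => [r _|]; [exact: cg|exact: closed_eq].
have E0 : E !=set0.
  by have [c cs gc] := hit s s0 gs; exists c; split=> //=; rewrite in_itv.
have [c] := compact_EVT_min E0 cE (@continuous_subspaceT _ _ E id (fun x => @cvg_id _ _)).
rewrite inE /E /= in_itv /= => -[/andP[c0 cs] gc] Hmin.
have := H c; rewrite c0 (le_trans cs sT) => /(_ isT) Hc.
suff : g c < B by rewrite gc ltxx.
apply: Hc => r /andP[r0 rc]; rewrite leNgt; apply/negP => gr.
have [r' /andP[r'0 r'r] gr'] := hit r r0 (ltW gr).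
have : c <= r'.
  by apply: Hmin; rewrite inE /E /= in_itv /= r'0 (le_trans r'r (le_trans rc cs)).
by move=> cr'; move: gr; rewrite (_ : r = c) ?gc ?ltxx//; apply/le_anti; rewrite rc (le_trans cr').
Qed.

Section Flow.
Variables (V : normedModType R) (f : V -> V).
Hypotheses (fV : findim V) (sf : smoothT f).
Lemma diff_bounded_along (c : R -> V) a b : a <= b -> continuous c ->
  exists2 L, 0 <= L & forall t v, a <= t <= b -> `|'d f (c t) v| <= L * `|v|.
Proof.
move=> ab cc; have [m [e [l [k [cl le k0 Hk]]]]] := coord_bounds fV.
pose q t := \sum_i k i * `|'D_(e i) f (c t)|.
have cq : continuous q.
  move=> t; rewrite /q; apply: cvg_sumr => i; apply: cvgMr; apply: cvg_norm.
  apply: (@cvg_comp _ _ _ c ('D_(e i) f)); [exact: cc|exact: (smoothT_cts (smoothT_D (e i) sf))].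
have [d _ Hd] := EVT_max ab (continuous_subspaceT cq).
exists (q d); first by apply: sumr_ge0 => i _; rewrite mulr_ge0.
move=> t v tab; have := Hd t; rewrite in_itv/= tab => /(_ isT) qd.
apply: le_trans (ler_wpM2r (normr_ge0 v) qd).
rewrite {1}(le v) linear_sum (le_trans (ler_norm_sum _ _ _))// /q mulr_suml.
apply: ler_sum => i _; rewrite linearZ normrZ deriveE; last exact: smoothT_diff.
by rewrite mulrAC ler_wpM2r.
Qed.

Lemma diff_equicont_along (c : R -> V) a b eps : continuous c -> 0 < eps ->
  exists2 d, 0 < d & forall t h v, a <= t <= b -> `|h| < d ->
    `|'d f (c t + h) v - 'd f (c t) v| <= eps * `|v|.
Proof.
move=> cc e0; have [m [e [l [k [cl le k0 Hk]]]]] := coord_bounds fV.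
pose q (h : V) t := \sum_i k i * `|'D_(e i) f (c t + h) - 'D_(e i) f (c t)|.
have cD i : continuous ('D_(e i) f) by move=> x; exact: (smoothT_cts (smoothT_D (e i) sf)).
have H : \forall h \near (0 : V), `[a, b] `<=` (fun t => q h t < eps).
  have /compact_near_coveringP := @segment_compact R a b; apply => t _.
  have cq : (fun z : R * V => q z.2 z.1) @ (nbhs t, nbhs (0 : V)) --> q 0 t.
    rewrite /q; apply: cvg_sumr => i; apply: cvgMr; apply: cvg_norm; apply: cvgB.
      apply: (@cvg_comp _ _ _ (fun z : R * V => c z.1 + z.2) ('D_(e i) f)); last exact: cD.
      apply: cvgD; last exact: cvg_snd.
      by apply: (@cvg_comp _ _ _ fst c); [exact: cvg_fst|exact: cc].
    apply: (@cvg_comp _ _ _ (fun z : R * V => c z.1) ('D_(e i) f)); last exact: cD.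
    by apply: (@cvg_comp _ _ _ fst c); [exact: cvg_fst|exact: cc].
  have q0 : q 0 t < eps.
    by rewrite /q big1 => [//|i _]; rewrite addr0 subrr normr0 mulr0.
  exact: (cvgr_lt _ cq _ q0).
move: H => /nbhs_ballP[d /= d0 Hd]; exists d => // t h v tab hd.
have qe : q h t < eps by apply: (Hd h); rewrite -?ball_normE /= ?sub0r ?normrN// in_itv.
apply: le_trans (ler_wpM2r (normr_ge0 v) (ltW qe)).
have E u : 'd f u v = \sum_i l i v *: 'D_(e i) f u.
  rewrite {1}(le v) linear_sum; apply: eq_bigr => i _.
  by rewrite linearZ deriveE//; exact: smoothT_diff.
rewrite !E -sumrB (le_trans (ler_norm_sum _ _ _))// /q mulr_suml.
apply: ler_sum => i _; rewrite -scalerBr normrZ.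
by rewrite mulrAC ler_wpM2r.
Qed.

(** Mean value inequality for the curve sending s to f (c t + s h) - s df h, with df taken at c t.
    The radius d is uniform in t by compactness of [a, b]. *)
Lemma taylor_along (c : R -> V) a b eps : continuous c -> 0 < eps ->
  exists2 d, 0 < d & forall t h, a <= t <= b -> `|h| < d ->
    `|f (c t + h) - f (c t) - 'd f (c t) h| <= eps * `|h|.
Proof.
move=> cc e0; have [C C0 HC] := mvt_ineq fV.
have [d d0 Hd] := @diff_equicont_along c a b (eps / C) cc (divr_gt0 e0 C0).
exists d => // t h tab hd.
have dl s : is_derive s 1 (fun s : R => c t + s *: h) h.
  rewrite -[X in is_derive _ _ _ X]add0r; apply: is_deriveD.
  exact: is_derive_scalel.
have dw s : is_derive s 1 (fun s => f (c t + s *: h) - s *: 'd f (c t) h)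
    ('d f (c t + s *: h) h - 'd f (c t) h).
  apply: is_deriveB; first exact: is_derive_chain (dl s) (smoothT_diff _ sf).
  exact: is_derive_scalel.
have := HC _ _ (eps / C * `|h|) (fun s _ => dw s).
rewrite !scale1r !scale0r subr0 addr0.
have -> : f (c t + h) - 'd f (c t) h - f (c t) = f (c t + h) - f (c t) - 'd f (c t) h.
  by rewrite addrAC.
rewrite mulrA (mulrC C) divfK ?gt_eqF//; apply=> s /andP[s0 s1].
apply: Hd => //; rewrite normrZ ger0_norm// (le_lt_trans _ hd)//.
by rewrite ler_piMl.
Qed.

Variable phi : R -> V -> V.
Hypothesis phi0 : forall x, phi 0 x = x.
Hypothesis dphi : forall x t, is_derive t 1 (phi ^~ x) (f (phi t x)).

Let cphi x : continuous (phi ^~ x).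
Proof. by move=> t; exact: is_derive_cts (dphi x t). Qed.

(** No global Lipschitz constant is available for f. Gronwall's estimate is valid as long as the
    perturbed orbit stays within [B] of the original one; for small h it then yields a strictly
    better bound, and [continuation] concludes that the orbit stays there up to time T. *)
Lemma flow_lipschitz x0 T eps : 0 <= T -> 0 < eps ->
  exists d C, [/\ 0 < d, 0 < C & forall h t, `|h| < d -> 0 <= t <= T ->
   `|phi t (x0 + h) - phi t x0| <= C * `|h| /\ `|phi t (x0 + h) - phi t x0| < eps].
Proof.
move=> T0 e0.
have [L L0 HL] := diff_bounded_along T0 (cphi (x := x0)).
have [d1 d10 Hd1] := taylor_along 0 T (cphi (x := x0)) ltr01.
have [G G0 HG] := gronwall fV.
pose K := G * expR (G * (1 + (1 + L) ^+ 2) * T).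
have K0 : 0 < K by rewrite mulr_gt0 ?expR_gt0.
pose B := Num.min (d1 / 2) eps.
have B0 : 0 < B by rewrite lt_min e0 divr_gt0.
have Bd1 : B < d1 by rewrite gt_min; apply/orP; left; lra.
pose C := Num.sqrt K + 1.
have C0 : 0 < C by rewrite ltr_wpDl ?sqrtr_ge0.
(* The first bound puts the perturbation below [B] at time 0, the second keeps the Gronwall estimate
   below [B] afterwards. *)
exists (Num.min B (B / C)), C; split=> //; first by rewrite lt_min B0 divr_gt0.
move=> h t; rewrite lt_min => /andP[hB hBC] tT.
pose w s := phi s (x0 + h) - phi s x0.
have dw s : is_derive s 1 w (f (phi s (x0 + h)) - f (phi s x0)).
  exact: is_deriveB (dphi _ _) (dphi _ _).
have est s : 0 <= s <= T -> (forall r, 0 <= r <= s -> `|w r| <= B) -> `|w s| <= Num.sqrt K * `|h|.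
  move=> /andP[s0 sT] Hr.
  have := HG w (fun r => f (phi r (x0 + h)) - f (phi r x0)) (1 + L) 0 s s0.
  rewrite addr_ge0// lexx => /(_ isT isT) H.
  have Hs : `|w s| ^+ 2 <= G * (`|w 0| ^+ 2 + 0 ^+ 2) * expR (G * (1 + (1 + L) ^+ 2) * s).
    apply: (H (fun r _ => dw r)) => r rs; rewrite add0r.
    have rT : 0 <= r <= T by case/andP: rs => -> /le_trans ->.
    have wd : `|w r| < d1 by apply: le_lt_trans (Hr r rs) Bd1.
    have E : phi r x0 + w r = phi r (x0 + h) by rewrite /w addrC subrK.
    have := Hd1 r (w r) rT wd; rewrite E mul1r => H1.
    have := HL r (w r) rT.
    have := ler_normD (f (phi r (x0 + h)) - f (phi r x0) - 'd f (phi r x0) (w r)) ('d f (phi r x0) (w r)).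
    rewrite subrK; lra.
  have w0 : `|w 0| = `|h| by rewrite /w !phi0 addrC addKr.
  rewrite w0 expr0n /= addr0 in Hs.
  have H2 : `|w s| ^+ 2 <= K * `|h| ^+ 2.
    apply: le_trans Hs _; rewrite /K mulrAC ler_wpM2r ?sqr_ge0// ler_wpM2l ?(ltW G0)//.
    by rewrite ler_expR ler_wpM2l// mulr_ge0 ?(ltW G0)// addr_ge0// sqr_ge0.
  rewrite -(ler_sqr (x := `|w s|)) ?nnegrE ?mulr_ge0 ?sqrtr_ge0//.
  by rewrite exprMn sqr_sqrtr ?(ltW K0).
have sh : Num.sqrt K * `|h| < B.
  apply: (@le_lt_trans _ _ (C * `|h|)); first by rewrite ler_wpM2r// lerDl.
  by rewrite mulrC -ltr_pdivlMr.
have cw : continuous (fun s => `|w s|).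
  by move=> s; apply: cvg_norm; exact: is_derive_cts (dw s).
have w0 : `|w 0| < B by rewrite /w !phi0 addrC addKr.
have HB := continuation cw w0 (fun s sT Hr => le_lt_trans (est s sT Hr) sh).
have tB := HB t tT; split.
  apply: (@le_trans _ _ (Num.sqrt K * `|h|)); last by rewrite ler_wpM2r// lerDl.
  apply: est => // r /andP[r0 rt]; apply: ltW; apply: HB; rewrite r0.
  by case/andP: tT => _; exact: le_trans.
by apply: lt_le_trans tB _; rewrite ge_min lexx orbT.
Qed.

(** The remainder phi t (x0 + h) - phi t x0 - xi h t satisfies the linearized equation up to an
    error e1 C |h|, by [taylor_along] and [flow_lipschitz]; Gronwall turns this into o(h). Linearity
    of xi in v is uniqueness for the linearized equation. *)
Lemma flow_diff_pos x0 T (xi : V -> R -> V) : 0 <= T ->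
  (forall v, xi v 0 = v) ->
  (forall v t, is_derive t 1 (xi v) ('d f (phi t x0) (xi v t))) ->
  differentiable (phi T) x0 /\ forall v, 'd (phi T) x0 v = xi v T.
Proof.
move=> T0 xi0 dxi.
have [L L0 HL] := diff_bounded_along T0 (cphi (x := x0)).
have lin : linear (fun v => xi v T).
  move=> a u v; apply: (@ode_unique R V fV (fun t => 'd f (phi t x0)) (xi (a *: u + v))
    (fun t => a *: xi u t + xi v t) L T) => // [t tT|t tT|].
  - by rewrite linearP; apply: is_deriveD.
  - by rewrite -linearB HL.
  - by rewrite !xi0.
pose lM := GRing.isLinear.Build _ _ _ _ _ lin.
pose A : {linear V -> V} := HB.pack (fun v => xi v T) lM.
have cA : continuous A.
  have [m [e [l [cl le]]]] := fV.
  have -> : (A : V -> V) = (fun v => \sum_i l i v *: A (e i)).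
    by rewrite funeqE => v; rewrite {1}(le v) linear_sum; apply: eq_bigr => i _; rewrite linearZ.
  move=> v; apply: cvg_sumr => i; apply: cvgZl; exact: cl.
have E : phi T \o shift x0 = cst (phi T x0) + A +o_ 0 id.
  apply/eqaddoP => eps e0 /=.
  have [G G0 HG] := gronwall fV.
  have [d0 [C [d00 C0 Hd0]]] := flow_lipschitz x0 T0 ltr01.
  pose K := G * expR (G * (1 + L ^+ 2) * T).
  have K0 : 0 < K by rewrite mulr_gt0 ?expR_gt0.
  (* This tolerance makes the final factor sqrt K C e1 at most eps. *)
  pose e1 := eps / (Num.sqrt K * C + 1).
  have SK : 0 < Num.sqrt K * C + 1 by rewrite ltr_wpDl// mulr_ge0 ?sqrtr_ge0// ltW.
  have e10 : 0 < e1 by rewrite divr_gt0.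
  have [d1 d10 Hd1] := taylor_along 0 T (cphi (x := x0)) e10.
  have [d2 [C2 [d20 C20 Hd2]]] := flow_lipschitz x0 T0 d10.
  near=> h.
  have hd0 : `|h| < d0 by near: h; apply: filterS (near_dist_lt 0 d00) => h; rewrite subr0.
  have hd2 : `|h| < d2 by near: h; apply: filterS (near_dist_lt 0 d20) => h; rewrite subr0.
  rewrite !fctE /=.
  pose w t := phi t (x0 + h) - phi t x0 - xi h t.
  pose w' t := f (phi t (x0 + h)) - f (phi t x0) - 'd f (phi t x0) (xi h t).
  have dw t : is_derive t 1 w (w' t) by exact: is_deriveB (is_deriveB (dphi _ _) (dphi _ _)) (dxi h t).
  have ee0 : 0 <= e1 * (C * `|h|) by exact: mulr_ge0 (ltW e10) (mulr_ge0 (ltW C0) (normr_ge0 h)).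
  have := HG w w' L (e1 * (C * `|h|)) T T0 L0 ee0 (fun t _ => dw t).
  have Hw t : 0 <= t <= T -> `|w' t| <= e1 * (C * `|h|) + L * `|w t|.
    move=> tT; have [H1 _] := Hd0 h t hd0 tT; have [_ H2] := Hd2 h t hd2 tT.
    have E : phi t x0 + (phi t (x0 + h) - phi t x0) = phi t (x0 + h) by rewrite addrC subrK.
    have := Hd1 t _ tT H2; rewrite E => H3.
    have -> : w' t = (f (phi t (x0 + h)) - f (phi t x0) - 'd f (phi t x0) (phi t (x0 + h) - phi t x0))
      + 'd f (phi t x0) (w t).
      have := raddfB ('d f (phi t x0)) (phi t (x0 + h) - phi t x0) (xi h t).
      by rewrite /w' /w => ->; rewrite addrA subrK.
    rewrite (le_trans (ler_normD _ _))// lerD ?HL//.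
    by rewrite (le_trans H3)// ler_wpM2l// ltW.
  move=> /(_ Hw).
  have -> : `|w 0| = 0 by rewrite /w !phi0 xi0 [x0 + h]addrC addrK subrr normr0.
  rewrite expr0n /= add0r => H.
  have HT : `|w T| <= Num.sqrt K * (e1 * (C * `|h|)).
    have nn : 0 <= Num.sqrt K * (e1 * (C * `|h|)) by exact: mulr_ge0 (sqrtr_ge0 _) ee0.
    rewrite -(ler_sqr (x := `|w T|)) ?nnegrE//.
    by rewrite [leRHS]exprMn sqr_sqrtr ?(ltW K0)// /K mulrAC.
  have -> : phi T (h + x0) - (phi T x0 + A h) = w T by rewrite /w [h + x0]addrC opprD addrA.
  apply: (le_trans HT).
  have -> : Num.sqrt K * (e1 * (C * `|h|)) = (Num.sqrt K * C) * e1 * `|h| by ring.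
  rewrite ler_wpM2r// /e1 mulrCA -ler_pdivlMl// mulVf ?gt_eqF//.
  by rewrite ler_pdivrMr// mul1r lerDl.
have dE := diff_unique cA E.
split; first by apply/diff_locallyP; rewrite dE.
by move=> v; rewrite dE.
Unshelve. all: by end_near. Qed.

End Flow.

Lemma linearized_flow V (f : V -> V) (phi : R -> V -> V) x0 : findim V -> smoothT f ->
  (forall x, phi 0 x = x) -> (forall x t, is_derive t 1 (phi ^~ x) (f (phi t x))) ->
  forall t, differentiable (phi t) x0 /\
   forall v, is_derive t 1 (fun s => 'd (phi s) x0 v) ('d f (phi t x0) ('d (phi t) x0 v)).
Proof.
move=> fV sf phi0 dphi.
have cphi : continuous (phi ^~ x0) by move=> t; exact: is_derive_cts (dphi x0 t).
have ex v : exists u : R -> V, u 0 = v /\ forall t, is_derive t 1 u ('d f (phi t x0) (u t)).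
  apply: (@picard R V fV (fun t => 'd f (phi t x0)) v).
    move=> u cu t; have := smoothT_cts (smoothT_tangent fV sf) => ct.
    apply: (@continuous_comp _ _ _ (fun t => (phi t x0, u t)) (fun z : V * V => 'd f (z.1 : V) (z.2 : V))).
      by apply: cvg_pair; [exact: cphi|exact: cu].
    exact: ct.
  move=> T.
  have [T0|T0] := leP 0 T; last first.
    by exists 0 => // t x y tT; have := le_lt_trans (le_trans (normr_ge0 t) tT) T0; rewrite ltxx.
  have NT : - T <= T by rewrite ge0_cp.
  have [L L0 HL] := diff_bounded_along fV sf NT cphi.
  by exists L => // t x y tT; rewrite -linearB HL// -ler_norml.
have [xi Hxi] := choice ex.
have all t : differentiable (phi t) x0 /\ forall v, 'd (phi t) x0 v = xi v t.
  have [t0|t0] := leP 0 t.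
    by apply: (flow_diff_pos fV sf phi0 dphi t0) => v; [exact: (Hxi v).1|exact: (Hxi v).2].
  (* Negative times are positive times of the flow of - f. *)
  have sNf : smoothT (fun x => - f x) by move=> k; apply: CkN (sf k); exact: openT.
  have dfN x v : 'd (fun x => - f x) x v = - 'd f x v by rewrite diffN//; exact: smoothT_diff.
  have := @flow_diff_pos V (fun x => - f x) fV sNf (fun t => phi (- t)) _ _ x0 (- t)
    (fun v t => xi v (- t)).
  rewrite opprK; apply.
  - by move=> x; rewrite oppr0.
  - by move=> x s; exact: is_derive_opp_arg (dphi x (- s)).
  - by rewrite oppr_ge0 ltW.
  - by move=> v; rewrite oppr0; exact: (Hxi v).1.
  - by move=> v s; rewrite dfN; exact: is_derive_opp_arg ((Hxi v).2 (- s)).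
move=> t; split; first by have [] := all t.
move=> v; have -> : (fun s => 'd (phi s) x0 v) = xi v by apply/funext => s; exact: (all s).2.
by rewrite (all t).2; exact: (Hxi v).2.
Qed.

Theorem flow_smooth V (f : V -> V) (phi : R -> V -> V) : findim V -> smoothT f ->
  (forall x, phi 0 x = x) -> (forall x t, is_derive t 1 (phi ^~ x) (f (phi t x))) ->
  forall t, smoothT (phi t).
Proof.
move=> fV sf phi0 dphi t k.
(* The space is generalized too: the inductive hypothesis is applied to [Phi], the flow of the
   tangent field [F] on V * V, whose second component holds the derivatives of [phi t]. *)
elim: k V f phi fV sf phi0 dphi => [|k IH] V f phi fV sf phi0 dphi.
  move=> x _; exact: differentiable_continuous (linearized_flow x fV sf phi0 dphi t).1.
have Lf x := linearized_flow x fV sf phi0 dphi.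
split=> [x _|v]; first by have [] := Lf x t.
pose F (z : V * V) : V * V := (f z.1, 'd f (z.1 : V) (z.2 : V)).
pose Phi s (z : V * V) : V * V := (phi s z.1, 'd (phi s) (z.1 : V) (z.2 : V)).
have fVV := findim_prod fV fV.
have sF : smoothT F.
  move=> j; apply: Ck_pair; first exact: openT.
    apply: (Ck_comp (U' := setT) (g := f)) => //; try exact: openT.
    by apply: Ck_fst; exact: openT.
  exact: smoothT_tangent.
have Phi0 z : Phi 0 z = z.
  have e : phi 0 = id by apply/funext => x; exact: phi0.
  by case: z => x u; rewrite /Phi /= phi0 e diff_val.
have dPhi z s : is_derive s 1 (Phi ^~ z) (F (Phi s z)).
  have /is_deriveP[d1 e1] := dphi z.1 s.
  have /is_deriveP[d2 e2] := (Lf z.1 s).2 z.2.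
  apply/is_deriveP; split; first exact: differentiable_pair d1 d2.
  by rewrite (diff_pair d1 d2) /= e1 e2.
have sPhi := IH _ F Phi fVV sF Phi0 dPhi.
have -> : (fun x => 'D_v (phi t) x) = (fun x => (Phi t (x, v)).2).
  by apply/funext => x; rewrite deriveE//; have [] := Lf x t.
apply: Ck_snd_comp; first exact: openT.
apply: (Ck_comp (U' := setT) (g := Phi t) (f := fun x => (x, v))) => //; try exact: openT.
apply: Ck_pair; [exact: openT|apply: Ck_id; exact: openT|exact: Ck_cst].
Qed.

End SmoothDependence.

(** * Smooth functions and cutoffs *)

Section SmoothFunctions.
Context {R : realType}.
Implicit Types (V W X : normedModType R) (s t : R).

Lemma smoothT_id V : smoothT (@id V).
Proof. by move=> k; apply: Ck_id; exact: openT. Qed.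

Lemma smoothT_cst V W (w : W) : smoothT (fun _ : V => w).
Proof. by move=> k; exact: Ck_cst. Qed.

Lemma smoothTD V W (f g : V -> W) : smoothT f -> smoothT g -> smoothT (fun x => f x + g x).
Proof. by move=> sf sg k; apply: CkD (sf k) (sg k); exact: openT. Qed.

Lemma smoothTB V W (f g : V -> W) : smoothT f -> smoothT g -> smoothT (fun x => f x - g x).
Proof. by move=> sf sg k; apply: CkB (sf k) (sg k); exact: openT. Qed.

Lemma smoothTN V W (f : V -> W) : smoothT f -> smoothT (fun x => - f x).
Proof. by move=> sf k; apply: CkN (sf k); exact: openT. Qed.

Lemma smoothTZ V W (f : V -> R) (g : V -> W) : smoothT f -> smoothT g -> smoothT (fun x => f x *: g x).
Proof. by move=> sf sg k; apply: Ck_scale (sf k) (sg k); exact: openT. Qed.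

Lemma smoothTM V (f g : V -> R) : smoothT f -> smoothT g -> smoothT (fun x => f x * g x).
Proof. exact: smoothTZ. Qed.

Lemma smoothT_sum V W (I : Type) (r : seq I) (f : I -> V -> W) :
  (forall i, smoothT (f i)) -> smoothT (fun x => \sum_(i <- r) f i x).
Proof. by move=> sf k; apply: Ck_sum => [|i _]; [exact: openT|exact: sf]. Qed.

Lemma smoothT_pair V W X (f : V -> W) (g : V -> X) : smoothT f -> smoothT g -> smoothT (fun x => (f x, g x)).
Proof. by move=> sf sg k; apply: Ck_pair (sf k) (sg k); exact: openT. Qed.

Lemma smoothT_fst V W X (f : V -> W * X) : smoothT f -> smoothT (fun x => (f x).1).
Proof. by move=> sf k; apply: Ck_fst_comp (sf k); exact: openT. Qed.

Lemma smoothT_snd V W X (f : V -> W * X) : smoothT f -> smoothT (fun x => (f x).2).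
Proof. by move=> sf k; apply: Ck_snd_comp (sf k); exact: openT. Qed.

Lemma smoothT_lin V W (l : {linear V -> W}) : continuous l -> smoothT l.
Proof. by move=> cl k; apply: Ck_lin cl; exact: openT. Qed.

Lemma smoothT_comp V W X (g : W -> X) (f : V -> W) : findim W ->
  smoothT g -> smoothT f -> smoothT (fun x => g (f x)).
Proof. by move=> fW sg sf k; apply: (Ck_comp (U' := setT)) (sg k) (sf k) => //; exact: openT. Qed.

Lemma mvt_unit (f df : R -> R) : (forall t, 0 <= t <= 1 -> is_derive t 1 f (df t)) ->
  exists2 t, 0 <= t <= 1 & f 1 - f 0 = df t.
Proof.
move=> H; have [||t t01 E] := @MVT_segment R f df 0 1 ler01.
- by move=> t; rewrite in_itv /= => /andP[t0 t1]; apply: H; rewrite !ltW.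
- by apply: continuous_in_subspaceT => t; rewrite inE/= in_itv/= => /H; exact: is_derive_cts.
by exists t; rewrite ?E ?subr0 ?mulr1//; move: t01; rewrite in_itv.
Qed.

(** The symmetry of second derivatives is what eliminates the Hessian of the Hamiltonian in
    [lie_derivative_hamiltonian]. *)
Lemma schwarz V (U : set V) (f : V -> R) x u v : open U -> U x -> Ck_on 2 U f ->
  'D_u (fun y => 'D_v f y) x = 'D_v (fun y => 'D_u f y) x.
Proof.
move=> oU Ux cf; apply/eqP; rewrite -subr_eq0 -normr_eq0 eq_le normr_ge0 andbT.
apply/ler_addgt0Pr => e e0; rewrite add0r.
have [cf1 cf2] := cf.
pose duv a b y := 'D_a (fun y => 'D_b f y) y.
have cD a b : {for x, continuous (duv a b)}.
  exact: (cf2 b).2 a x Ux.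
have near_sq a b : \forall h \near (0 : R), forall s t, 0 <= s <= 1 -> 0 <= t <= 1 ->
   U (x + (h * s) *: u + (h * t) *: v) /\
   `|duv a b (x + (h * s) *: u + (h * t) *: v) - duv a b x| < e / 2.
  have N : \forall y \near x, U y /\ `|duv a b y - duv a b x| < e / 2.
    near=> y; split; first by near: y; exact: open_nbhs_nbhs.
    near: y; have /cvgrPdistC_lt H := cD a b; apply: H; by rewrite divr_gt0.
  have /nbhs_ballP[d /= d0 Hd] := N.
  have K0 : 0 < `|u| + `|v| + 1 by rewrite ltr_wpDl// addr_ge0.
  near=> h => s t /andP[s0 s1] /andP[t0 t1]; apply: Hd.
  rewrite -ball_normE /= -addrA opprD addrA subrr add0r normrN.
  have hd : `|h| < d / (`|u| + `|v| + 1).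
    near: h; apply: filterS (near_dist_lt (V := R) 0 (divr_gt0 d0 K0)) => h; by rewrite subr0.
  have nm (y : R) (w : V) : 0 <= y -> `|(h * y) *: w| = `|h| * y * `|w|.
    by move=> y0; rewrite normrZ normrM (ger0_norm y0).
  apply: (le_lt_trans (ler_normD _ _)); rewrite (nm _ _ s0) (nm _ _ t0).
  apply: (@le_lt_trans _ _ (`|h| * (`|u| + `|v| + 1))); last by rewrite -ltr_pdivlMr.
  rewrite !mulrDr mulr1 -addrA lerD//; first by rewrite ler_wpM2r// ler_piMr.
  by rewrite ler_wpDr// ler_wpM2r// ler_piMr.
(* The second difference of f along u and v, divided by h^2, is a value of either mixed derivative. *)
have sd a b (h : R) : 0 < h ->
  (forall s t, 0 <= s <= 1 -> 0 <= t <= 1 -> U (x + (h * s) *: a + (h * t) *: b)) ->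
  exists s t, [/\ 0 <= s <= 1, 0 <= t <= 1 &
    f (x + h *: a + h *: b) - f (x + h *: a) - (f (x + h *: b) - f x) =
    h * (h * duv b a (x + (h * s) *: a + (h * t) *: b))].
  move=> h0 HU.
  have dl (c d : V) s : is_derive s 1 (fun s : R => c + (h * s) *: d) (h *: d).
    apply: is_derive_congr (is_deriveD (is_derive_cst c s 1) _) (add0r _).
    have -> : (fun s : R => (h * s) *: d) = (fun s => s *: (h *: d)).
      by apply/funext => r; rewrite scalerA mulrC.
    exact: is_derive_scalel.
  have chain (g : V -> R) c d s : differentiable g (c + (h * s) *: d) ->
      is_derive s 1 (fun s => g (c + (h * s) *: d)) (h * 'D_d g (c + (h * s) *: d)).
    move=> dg; apply: is_derive_congr (is_derive_chain (dl c d s) dg) _.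
    by rewrite linearZ /= deriveE.
  have i0 : 0 <= (0 : R) <= 1 by rewrite lexx ler01.
  have i1 : 0 <= (1 : R) <= 1 by rewrite lexx ler01.
  pose g s := f (x + (h * s) *: a + h *: b) - f (x + (h * s) *: a).
  have dg s : 0 <= s <= 1 -> is_derive s 1 g (h * 'D_a f (x + (h * s) *: a + h *: b) - h * 'D_a f (x + (h * s) *: a)).
    move=> s01; apply: is_deriveB.
      have := HU s 1 s01 i1; rewrite mulr1 addrAC => H.
      by have := chain f (x + h *: b) a s (cf1 _ H); under eq_fun do rewrite addrAC; rewrite addrAC.
    have := HU s 0 s01 i0; rewrite mulr0 scale0r addr0 => H; exact: chain (cf1 _ H).
  have [s s01 Es] := mvt_unit dg.
  pose k t := 'D_a f (x + (h * s) *: a + (h * t) *: b).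
  have dk t : 0 <= t <= 1 -> is_derive t 1 k (h * duv b a (x + (h * s) *: a + (h * t) *: b)).
    move=> t01; apply: (chain (fun y => 'D_a f y) (x + (h * s) *: a) b t).
    by apply: (cf2 a).1; exact: HU.
  have [t t01 Et] := mvt_unit dk.
  exists s, t; split=> //.
  move: Es Et; rewrite /g /k !mulr1 !mulr0 !scale0r !addr0 => -> <-.
  by rewrite mulrBr.
have [h [h0 [H1 H2]]] : exists h : R, 0 < h /\
  ((forall s t, 0 <= s <= 1 -> 0 <= t <= 1 -> U (x + (h * s) *: u + (h * t) *: v) /\
   `|duv v u (x + (h * s) *: u + (h * t) *: v) - duv v u x| < e / 2) /\
  (forall s t, 0 <= s <= 1 -> 0 <= t <= 1 -> U (x + (h * s) *: u + (h * t) *: v) /\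
   `|duv u v (x + (h * s) *: u + (h * t) *: v) - duv u v x| < e / 2)).
  have /nbhs_ballP[d1 /= d10 Hd1] := near_sq v u.
  have /nbhs_ballP[d2 /= d20 Hd2] := near_sq u v.
  pose d := Num.min d1 d2; have d0 : 0 < d by rewrite lt_min d10.
  exists (d / 2); split; first by rewrite divr_gt0.
  have db : `|0 - d / 2| < d by rewrite sub0r normrN gtr0_norm ?divr_gt0//; lra.
  split; [apply: Hd1|apply: Hd2]; rewrite -ball_normE /=; apply: (lt_le_trans db).
    by rewrite ge_min lexx.
  by rewrite ge_min lexx orbT.
have [s1 [t1 [s1i t1i E1]]] := sd u v h h0 (fun s t si ti => (H1 s t si ti).1).
have HU2 s t : 0 <= s <= 1 -> 0 <= t <= 1 -> U (x + (h * s) *: v + (h * t) *: u).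
  by move=> si ti; rewrite addrAC; exact: (H1 t s ti si).1.
have [s2 [t2 [s2i t2i E2]]] := sd v u h h0 HU2.
(* The second difference is symmetric in u and v, so a value of one mixed derivative close to x
   equals a value of the other. *)
have E : duv v u (x + (h * s1) *: u + (h * t1) *: v) = duv u v (x + (h * t2) *: u + (h * s2) *: v).
  have hn0 : h != 0 by rewrite gt_eqF.
  apply: (mulfI hn0); apply: (mulfI hn0).
  rewrite -E1 [in RHS]addrAC -E2 [x + h *: v + _]addrAC; ring.
have := (H1 s1 t1 s1i t1i).2; have := (H2 t2 s2 t2i s2i).2; rewrite E.
rewrite -!/(duv _ _ _); move: (duv u v (_ + _)) => z K1 K2.
have -> : duv u v x - duv v u x = (z - duv v u x) - (z - duv u v x).
  by rewrite opprB [RHS]addrC addrA subrK.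
rewrite [leRHS]splitr.
have := lerD (ltW K2) (ltW K1).
exact: le_trans (ler_normB _ _).
Unshelve. all: by end_near. Qed.

End SmoothFunctions.

Section BumpFunctions.
Context {R : realType}.
Implicit Types (V W X : normedModType R) (x t : R).

(** exp (- 1 / x) extended by 0, together with its multiples by powers of 1 / x, so that derivatives
    are combinations of members of the family. *)
Definition flat (n : nat) x : R := if 0 < x then x^-1 ^+ n * expR (- x^-1) else 0.

(** With u = 1 / x this is u^(n+2) <= (n+2)! exp u. A quadratic bound gives differentiability at 0
    with derivative 0. *)
Lemma flat_bound n x : `|flat n x| <= (n.+2)`!%:R * x ^+ 2.
Proof.
rewrite /flat; case: ifPn => [x0|_]; last by rewrite normr0 mulr_ge0// sqr_ge0.
have u0 : 0 < x^-1 by rewrite invr_gt0.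
rewrite ger0_norm; last by rewrite mulr_ge0 ?expR_ge0// exprn_ge0// ltW.
have := expR_ge1Dxn n.+1 (ltW u0); set u := x^-1 => H.
have F : 0 < (n.+2)`!%:R :> R by rewrite ltr0n fact_gt0.
have H1 : u ^+ n.+2 <= (n.+2)`!%:R * expR u.
  by rewrite mulrC -ler_pdivrMr//; apply: le_trans H; rewrite lerDr.
rewrite expRN -ler_pdivlMr ?invr_gt0 ?expR_gt0// invrK.
have -> : u ^+ n = u ^+ n.+2 * x ^+ 2.
  rewrite -addn2 exprD -mulrA -exprMn /u mulVf ?expr1n ?mulr1//.
  by rewrite gt_eqF.
by rewrite [leRHS]mulrAC ler_wpM2r// sqr_ge0.
Qed.

Lemma flat_derive n x : is_derive x 1 (flat n) (flat n.+2 x - n%:R * flat n.+1 x).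
Proof.
have [x0|x0|x0] := ltgtP 0 x; last first.
- rewrite -x0 /flat ltxx mulr0 subr0; apply/is_deriveP.
  have E : flat n \o shift 0 = cst (flat n 0) + (\0 : {linear R -> R}) +o_ 0 id.
    apply/eqaddoP => e e0 /=; near=> h; rewrite !fctE /= addr0 {2}/flat ltxx.
    rewrite !addr0 subr0 (le_trans (flat_bound _ _))//.
    rewrite -[h ^+ 2]real_normK ?num_real// expr2 mulrA ler_wpM2r//.
    rewrite -ler_pdivlMl ?ltr0n ?fact_gt0// ltW//; near: h.
    apply: filterS (near_dist_lt (V := R) 0 (e := (n.+2)`!%:R^-1 * e) _).
      by move=> h; rewrite subr0.
    by rewrite mulr_gt0// invr_gt0 ltr0n fact_gt0.
  have c0 : continuous (\0 : {linear R -> R}) by move=> y; exact: cst_continuous.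
  have dE := diff_unique c0 E.
  rewrite -[fun _ => _]/(flat n); split; last by rewrite dE.
  by apply/diff_locallyP; rewrite dE.
- apply: (is_derive_near (u := fun _ => 0)).
    near=> y; rewrite /flat ltNge (_ : y <= 0)//.
    by apply: ltW; near: y; exact: lt_nbhsl.
  by rewrite /flat !(ltNge 0) (ltW x0) /= mulr0 subr0; exact: is_derive_cst.
apply: (is_derive_near (u := fun y => y^-1 ^+ n * expR (- y^-1))).
  near=> y; rewrite /flat ifT//; near: y; exact: lt_nbhsr.
have xn0 : x != 0 by rewrite gt_eqF.
have di : is_derive x 1 (fun y : R => y^-1) (- x^-1 ^+ 2).
  apply: is_derive_congr (@is_deriveV R id x 1 1 xn0 _) _.
  by rewrite /GRing.scale /= mulr1 exprVn.
have dX := @is_deriveX R R _ n x 1 _ di.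
have dN : is_derive x 1 (fun y : R => - y^-1) (- - x^-1 ^+ 2) by exact: is_deriveN.
have dexp := is_derive_comp_real dN (is_derive_expR _).
rewrite exprfctE in dX; apply: is_derive_congr (is_deriveM dX dexp) _.
rewrite /flat x0 /GRing.scale /= opprK.
case: n {dX} => [|n]; first by rewrite expr0 !mul0r !mulr0 subr0 addr0; ring.
by rewrite /= !exprS; ring.
Unshelve. all: by end_near. Qed.

Lemma flat_smooth n : smoothT (flat n).
Proof.
move=> k; elim: k n => [|k IH] n; first by move=> x _; exact: is_derive_cts (flat_derive n x).
split=> [x _|v]; first by have /is_deriveP[] := flat_derive n x.
have E : (fun x => 'D_v (flat n) x) = (fun x => v * (flat n.+2 x - n%:R * flat n.+1 x)).
  apply/funext => x; have /is_deriveP[d e] := flat_derive n x.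
  by rewrite deriveE// -[v in LHS]mulr1 -[v * 1]/(v *: 1) linearZ e.
rewrite E; apply: CkM; [exact: openT|exact: Ck_cst|apply: CkB; [exact: openT|exact: IH|]].
by apply: CkM; [exact: openT|exact: Ck_cst|exact: IH].
Qed.

Definition smooth_step x : R := flat 0 x / (flat 0 x + flat 0 (1 - x)).

Lemma flat_ge0 x : 0 <= flat 0 x.
Proof. by rewrite /flat; case: ifP => // _; rewrite expr0 mul1r expR_ge0. Qed.

Lemma flat_gt0 x : 0 < x -> 0 < flat 0 x.
Proof. by move=> x0; rewrite /flat x0 expr0 mul1r expR_gt0. Qed.

Lemma flat_le0 x : x <= 0 -> flat 0 x = 0.
Proof. by rewrite /flat ltNge => ->. Qed.

Lemma smooth_step_denom x : 0 < flat 0 x + flat 0 (1 - x).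
Proof.
have [x0|x0] := ltP 0 x; first by rewrite ltr_pwDl ?flat_gt0 ?flat_ge0.
by rewrite ltr_wpDl ?flat_ge0 ?flat_gt0//; lra.
Qed.

Lemma smooth_step_smooth : smoothT smooth_step.
Proof.
have f1 : smoothT (fun x => flat 0 (1 - x)).
  apply: smoothT_comp; [exact: findim_real|exact: flat_smooth|].
  by apply: smoothTB; [exact: smoothT_cst|exact: smoothT_id].
apply: smoothTM; first exact: flat_smooth.
move=> k; apply: CkV; first exact: openT.
  by move=> x _; rewrite gt_eqF// smooth_step_denom.
by apply: smoothTD => //; exact: flat_smooth.
Qed.

Lemma smooth_step0 x : x <= 0 -> smooth_step x = 0.
Proof. by move=> x0; rewrite /smooth_step (flat_le0 x0) mul0r. Qed.

Lemma smooth_step1 x : 1 <= x -> smooth_step x = 1.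
Proof.
move=> x1; rewrite /smooth_step (@flat_le0 (1 - x)) ?subr_le0// addr0 divff//.
by rewrite gt_eqF// flat_gt0// (lt_le_trans ltr01).
Qed.

Lemma smooth_step_itv x : 0 <= smooth_step x <= 1.
Proof.
rewrite /smooth_step divr_ge0 ?flat_ge0 ?(ltW (smooth_step_denom x))//=.
by rewrite ler_pdivrMr ?smooth_step_denom// mul1r lerDl flat_ge0.
Qed.

Definition step_between a b x : R := smooth_step ((x - a) / (b - a)).

Lemma step_between_smooth a b : smoothT (step_between a b).
Proof.
apply: smoothT_comp; [exact: findim_real|exact: smooth_step_smooth|].
by apply: smoothTM; [apply: smoothTB; [exact: smoothT_id|]|]; exact: smoothT_cst.
Qed.

Lemma step_between0 a b x : a < b -> x <= a -> step_between a b x = 0.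
Proof.
by move=> ab xa; apply: smooth_step0; rewrite pmulr_lle0 ?invr_gt0 ?subr_gt0// subr_le0.
Qed.

Lemma step_between1 a b x : a < b -> b <= x -> step_between a b x = 1.
Proof.
by move=> ab xa; apply: smooth_step1; rewrite ler_pdivlMr ?subr_gt0// mul1r lerD2r.
Qed.

Lemma step_between_itv a b x : 0 <= step_between a b x <= 1.
Proof. exact: smooth_step_itv. Qed.

(** The norm of row vectors is the sup norm, so a product of one-variable steps, two per coordinate,
    is a bump adapted to its balls. *)
Definition bump_rV n (y : 'rV[R]_n) r1 r2 (x : 'rV[R]_n) : R :=
  \prod_i (step_between (- r2) (- r1) (x 0 i - y 0 i) * step_between (- r2) (- r1) (y 0 i - x 0 i)).

Lemma smoothT_coord n (i : 'I_n) : smoothT (fun x : 'rV[R]_n => x 0 i).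
Proof.
have lin : linear (fun x : 'rV[R]_n => x 0 i) by move=> a x y; rewrite !mxE.
pose lM := GRing.isLinear.Build _ _ _ _ _ lin.
pose l : {linear 'rV[R]_n -> R} := HB.pack (fun x : 'rV[R]_n => x 0 i) lM.
by apply: (@smoothT_lin R _ _ l); exact: coord_continuous.
Qed.

Lemma bump_rV_smooth n (y : 'rV[R]_n) r1 r2 : smoothT (bump_rV y r1 r2).
Proof.
move=> k; apply: Ck_prod => [|i _]; first exact: openT.
move: k; apply: smoothTM; apply: smoothT_comp; try exact: findim_real; try exact: step_between_smooth.
  by apply: smoothTB; [exact: smoothT_coord|exact: smoothT_cst].
by apply: smoothTB; [exact: smoothT_cst|exact: smoothT_coord].
Qed.

Lemma coord_le_norm n (x : 'rV[R]_n) i : `|x 0 i| <= `|x|.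
Proof.
rewrite [leRHS]mx_normrE.
exact: (le_bigmax _ (fun ij : 'I_1 * 'I_n => `|x ij.1 ij.2|) (0, i)).
Qed.

Lemma rV_norm_lt n (x : 'rV[R]_n) e : 0 < e -> (forall i, `|x 0 i| < e) -> `|x| < e.
Proof.
move=> e0 H; rewrite [ltLHS]mx_normrE; apply: bigmax_lt => // -[i j] _ /=.
by rewrite (ord1 i).
Qed.

Lemma bump_rV1 n (y : 'rV[R]_n) r1 r2 (x : 'rV[R]_n) : r1 < r2 -> `|x - y| <= r1 -> bump_rV y r1 r2 x = 1.
Proof.
move=> r12 xy; apply: big1 => i _.
have h : `|x 0 i - y 0 i| <= r1 by apply: le_trans xy; have := coord_le_norm (x - y) i; rewrite !mxE.
rewrite !step_between1 ?mulr1 ?ltrN2//.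
  by rewrite lerNl opprB; apply: le_trans h; exact: ler_norm.
by rewrite lerNl; apply: le_trans h; rewrite -normrN; exact: ler_norm.
Qed.

Lemma bump_rV0 n (y : 'rV[R]_n) r1 r2 (x : 'rV[R]_n) : r1 < r2 -> 0 < r2 -> r2 <= `|x - y| -> bump_rV y r1 r2 x = 0.
Proof.
move=> r12 r20 xy.
have [i hi] : exists i, r2 <= `|x 0 i - y 0 i|.
  apply: contrapT => H; suff : `|x - y| < r2 by rewrite ltNge xy.
  apply: rV_norm_lt => // i; rewrite !mxE ltNge; apply/negP => h; apply: H; by exists i.
rewrite /bump_rV (bigD1 i)//=; move: hi; rewrite ler_normr => /orP[h|h].
  by rewrite [X in _ * X * _]step_between0 ?ltrN2 ?mulr0 ?mul0r// lerNr opprB.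
by rewrite [X in X * _ * _]step_between0 ?ltrN2 ?mul0r// lerNr.
Qed.

End BumpFunctions.

(** * Smooth maps and families on manifolds *)

Section SmoothAt.
Context {R : realType}.
Implicit Types (V W X : normedModType R).

(** [smooth_on A f] unfolds to [smooth_at A f x] for all x in A. The pointwise form allows A and f
    to be changed near x, see [smooth_at_germ]. *)
Definition smooth_at V W (A : set V) (f : V -> W) (x : V) : Prop :=
  exists (U : set V) (g : V -> W),
    [/\ open U, U x, forall k, Ck_on k U g & forall y, U y -> A y -> f y = g y].

Lemma near_open (T : topologicalType) (P : set T) (x : T) : (\near x, P x) ->
  exists N, [/\ open N, N x & forall y, N y -> P y].
Proof.
by move=> H; have : nbhs x P by []; rewrite nbhsE => -[N [oN Nx] NP]; exists N.
Qed.

Lemma smooth_at_germ V W (A B : set V) (f f' : V -> W) x :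
  (\near x, B x -> A x /\ f x = f' x) -> smooth_at A f x -> smooth_at B f' x.
Proof.
move=> /near_open[N [oN Nx HN]] [U [g [oU Ux sg fg]]].
exists (N `&` U), g; split=> //; first exact: openI.
  by move=> k; apply: Ck_sub (sg k) => y [].
by move=> y [Ny Uy] By; have [Ay <-] := HN y Ny By; exact: fg.
Qed.

Lemma smooth_at_comp V W X (A : set V) (B : set W) (g : W -> X) (f : V -> W) x :
  findim W -> A x -> (\near x, A x -> B (f x)) ->
  smooth_at A f x -> smooth_at B g (f x) -> smooth_at A (fun y => g (f y)) x.
Proof.
move=> fW Ax /near_open[N [oN Nx HN]] [U [f1 [oU Ux sf ff]]] [U' [g1 [oU' Ux' sg gg]]].
have cf1 y : U y -> {for y, continuous f1} by move=> Uy; exact: Ck_cts (sf 0%N) Uy.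
have oP : open (U `&` f1 @^-1` U').
  rewrite openE => y [Uy U'y]; apply: filterI; first exact: open_nbhs_nbhs.
  by apply: (cf1 y Uy); exact: open_nbhs_nbhs.
exists (N `&` (U `&` f1 @^-1` U')), (fun y => g1 (f1 y)); split.
- exact: openI.
- by split=> //; split=> //=; rewrite -ff.
- move=> k; apply: (Ck_comp fW _ oU') => [| |//|]; first exact: openI.
  + by move=> y [_ []].
  + by apply: Ck_sub (sf k) => y [_ []].
- by move=> y [Ny [Uy U'y]] Ay; rewrite ff// gg -?ff//; [rewrite ff|exact: HN].
Qed.

Lemma smoothT_at V W (A : set V) (f : V -> W) x : smoothT f -> smooth_at A f x.
Proof. by move=> sf; exists setT, f; split=> //; exact: openT. Qed.

Lemma Ck_smooth_at V W (A U : set V) (f : V -> W) x :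
  open U -> U x -> (forall k, Ck_on k U f) -> smooth_at A f x.
Proof. by move=> oU Ux sf; exists U, f. Qed.

Lemma smooth_at_compT V W X (A : set V) (g : W -> X) (f : V -> W) x : findim W -> A x ->
  smoothT g -> smooth_at A f x -> smooth_at A (fun y => g (f y)) x.
Proof.
move=> fW Ax sg sf; apply: (smooth_at_comp (B := setT)) sf _ => //.
  exact: filterE.
exact: smoothT_at.
Qed.

Lemma smooth_at_pair V W X (A : set V) (f : V -> W) (g : V -> X) x :
  smooth_at A f x -> smooth_at A g x -> smooth_at A (fun y => (f y, g y)) x.
Proof.
move=> [U [f1 [oU Ux sf ff]]] [U' [g1 [oU' Ux' sg gg]]].
exists (U `&` U'), (fun y => (f1 y, g1 y)); split=> //; first exact: openI.
  move=> k; apply: Ck_pair; first exact: openI.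
    by apply: Ck_sub (sf k) => y [].
  by apply: Ck_sub (sg k) => y [].
by move=> y [Uy U'y] Ay; rewrite ff// gg.
Qed.

Lemma smooth_at_open V W (A : set V) (f : V -> W) x : nbhs x A -> smooth_at A f x ->
  exists U, [/\ open U, U x, U `<=` A & forall k, Ck_on k U f].
Proof.
rewrite nbhsE => -[N [oN Nx] NA] [U [g [oU Ux sg fg]]].
have oI : open (N `&` U) by exact: openI.
exists (N `&` U); split=> //; first by move=> y [Ny _]; exact: NA.
move=> k; apply: (Ck_eq oI (f := g)) => [y [Ny Uy]|]; first by rewrite fg//; exact: NA.
by apply: Ck_sub (sg k) => y [].
Qed.

Lemma smooth_at_diff V W (A : set V) (f : V -> W) x : nbhs x A -> smooth_at A f x ->
  differentiable f x.
Proof.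
by move=> nA /(smooth_at_open nA)[U [oU Ux _ sf]]; exact: Ck_diff (sf 1%N) Ux.
Qed.

Lemma Ck_local k V W (U : set V) (f : V -> W) :
  (forall x, U x -> exists N : set V, N x /\ Ck_on k N f) -> Ck_on k U f.
Proof.
elim: k W f => [|k IH] W f H /=.
  by move=> x Ux; have [N [Nx cf]] := H x Ux; exact: cf.
split=> [x Ux|v]; first by have [N [Nx [df _]]] := H x Ux; exact: df.
by apply: IH => x Ux; have [N [Nx [_ Df]]] := H x Ux; exists N; split=> //; exact: Df.
Qed.

Lemma smoothT_local V W (f : V -> W) : (forall x, smooth_at setT f x) -> smoothT f.
Proof.
move=> H k; apply: Ck_local => x _.
by have [U [oU Ux _ sf]] := smooth_at_open filterT (H x); exists U.
Qed.

End SmoothAt.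

Section ManifoldBasics.
Context {R : realType} {n : nat} {M : topologicalType}.
Variable S : smooth_structure R n M.
Local Notation E := 'rV[R]_n.
Implicit Types (c : chart R n M) (p q : M).

Let fE : findim E := findim_rV n.

Lemma chart_cmapK c p : atlas S c -> cdom c p -> cinv c (c p) = p.
Proof. by move=> /atlas_chart[_ _ H _ _]; exact: H. Qed.

Lemma chart_img c p : cdom c p -> cimg c (c p).
Proof. by exists p. Qed.

Lemma chart_cinvK c y : atlas S c -> cimg c y -> c (cinv c y) = y.
Proof. by move=> ac [p dp <-]; rewrite chart_cmapK. Qed.

Lemma chart_cinv_dom c y : atlas S c -> cimg c y -> cdom c (cinv c y).
Proof. by move=> ac [p dp <-]; rewrite chart_cmapK. Qed.

Lemma chart_open_dom c p : atlas S c -> cdom c p -> nbhs p (cdom c).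
Proof. by move=> /atlas_chart[oc _ _ _ _] dp; exact: open_nbhs_nbhs. Qed.

Lemma chart_open_img c y : atlas S c -> cimg c y -> nbhs y (cimg c).
Proof. by move=> /atlas_chart[_ oc _ _ _] dp; exact: open_nbhs_nbhs. Qed.

Lemma chart_cts c p : atlas S c -> cdom c p -> {for p, continuous c}.
Proof.
move=> /atlas_chart[oc _ _ + _] dp; rewrite continuous_open_subspace// => H.
by apply: H; rewrite inE.
Qed.

Lemma chart_cinv_cts c y : atlas S c -> cimg c y -> {for y, continuous (cinv c)}.
Proof.
move=> /atlas_chart[_ oc _ _ +] dp; rewrite continuous_open_subspace// => H.
by apply: H; rewrite inE.
Qed.

Lemma near_cinv_dom c c' y : atlas S c -> atlas S c' -> cimg c y -> cdom c' (cinv c y) ->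
  \forall y \near y, cimg c y /\ cdom c' (cinv c y).
Proof.
move=> ac ac' cy cy'; apply: filterI; first exact: chart_open_img.
by apply: (chart_cinv_cts ac cy); exact: chart_open_dom.
Qed.

Lemma transition_smooth (A : set E) c c' y : atlas S c -> atlas S c' ->
  cimg c y -> cdom c' (cinv c y) -> smooth_at A (fun x => c' (cinv c x)) y.
Proof.
move=> ac ac' cy cy'.
have [|U [g [oU Uy sg fg]]] := @atlas_compat _ _ _ S c c' ac ac' y.
  by exists (cinv c y); [split=> //; exact: chart_cinv_dom|exact: chart_cinvK].
apply: (smooth_at_germ (A := setT) (f := g)); last exact: (Ck_smooth_at _ oU Uy).
near=> x => _; split=> //.
have [cx cx'] : cimg c x /\ cdom c' (cinv c x) by near: x; exact: near_cinv_dom.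
rewrite -fg//; first by near: x; exact: open_nbhs_nbhs.
by exists (cinv c x); [split=> //; exact: chart_cinv_dom|exact: chart_cinvK].
Unshelve. all: by end_near. Qed.

Lemma transition_diff c c' y : atlas S c -> atlas S c' ->
  cimg c y -> cdom c' (cinv c y) -> differentiable (fun x => c' (cinv c x)) y.
Proof.
move=> ac ac' cy cy'; apply: (smooth_at_diff (A := setT)); first exact: filterT.
exact: transition_smooth.
Qed.

Lemma near_fst (T U : topologicalType) (x : T) (y : U) (N : set T) :
  nbhs x N -> \forall z \near ((x, y) : T * U), N z.1.
Proof.
by move=> nN; exists (N, setT) => /=; [split=> //; exact: filterT|move=> z []].
Qed.

Lemma near_snd (T U : topologicalType) (x : T) (y : U) (N : set U) :
  nbhs y N -> \forall z \near ((x, y) : T * U), N z.2.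
Proof.
by move=> nN; exists (setT, N) => /=; [split=> //; exact: filterT|move=> z []].
Qed.

Lemma cvg_param c (t : R) (x : E) : atlas S c -> cimg c x ->
  (fun z : R * E => (z.1, cinv c z.2)) @ ((t, x) : R * E) --> ((t, cinv c x) : R * M).
Proof.
move=> ac cx P [/= [P1 P2] /= [nP1 nP2] HP].
exists (P1, cinv c @^-1` P2) => /=; first by split=> //; exact: (chart_cinv_cts ac cx nP2).
by move=> z [z1 z2]; exact: (HP (z.1, cinv c z.2) (conj z1 z2)).
Qed.

Lemma cvg_param_at c (t : R) (p : M) : atlas S c -> cdom c p ->
  (fun z : R * E => (z.1, cinv c z.2)) @ ((t, c p) : R * E) --> ((t, p) : R * M).
Proof.
by move=> ac dp; have := cvg_param (t := t) ac (chart_img dp); rewrite (chart_cmapK ac dp).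
Qed.

(* Smoothness near (t0, p0), for t in T, of (t, p) |-> F t p, tested in one pair of charts. *)
Definition family_smooth_at (T : set R) (F : R -> M -> M) (t0 : R) (p0 : M) : Prop :=
  (forall N, nbhs (F t0 p0) N -> \forall z \near ((t0, p0) : R * M), T z.1 -> N (F z.1 z.2)) /\
  exists c c', [/\ atlas S c, atlas S c', cdom c p0, cdom c' (F t0 p0)
    & smooth_at [set z : R * E | T z.1 /\ cimg c z.2]
        (fun z => c' (F z.1 (cinv c z.2))) (t0, c p0)].

(** One pair of charts around each point is enough, since any other pair differs from it by
    transition maps on both sides. *)
Lemma smooth_familyP T (F : R -> M -> M) :
  smooth_family S T F <-> forall t p, T t -> family_smooth_at T F t p.
Proof.
split=> [[cF sF] t p Tt|H].
  split.
    move=> N nN; have /subspace_continuousP/(_ (t, p)) H := cF.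
    have K : \forall z \near ((t, p) : R * M), (T `*` setT) z -> N (F z.1 z.2) := H (conj Tt I) N nN.
    by apply: filterS K => -[s q] /= K Ts; exact: K.
  have ac := chart_at_atlas S p; have ac' := chart_at_atlas S (F t p).
  have dp := chart_at_dom S p; have dp' := chart_at_dom S (F t p).
  exists (chart_at S p), (chart_at S (F t p)); split=> //.
  have := sF _ _ ac ac' (t, chart_at S p p); rewrite /= (chart_cmapK ac dp) => K.
  apply: smooth_at_germ (K _); last by split=> //; exact: chart_img.
  have N1 : \forall z \near ((t, p) : R * M), T z.1 -> cdom (chart_at S (F t p)) (F z.1 z.2).
    have /subspace_continuousP/(_ (t, p)) H := cF.
    have K1 : \forall z \near ((t, p) : R * M), (T `*` setT) z ->
      cdom (chart_at S (F t p)) (F z.1 z.2) := H (conj Tt I) _ (chart_open_dom ac' dp').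
    by apply: filterS K1 => -[s q] /= K' Ts; exact: K'.
  have N2 : \forall z \near (t, chart_at S p p), T z.1 -> cimg (chart_at S p) z.2 ->
      cdom (chart_at S (F t p)) (F z.1 (cinv (chart_at S p) z.2)).
    have C := cvg_param_at ac dp (t := t).
    have H : \forall z \near ((t, chart_at S p p) : R * E), T z.1 ->
      cdom (chart_at S (F t p)) (F z.1 (cinv (chart_at S p) z.2)) := C _ N1.
    by apply: filterS H => -[s x] /= K' Ts _; exact: K'.
  by apply: filterS N2 => -[s x] /= K' [Ts cx]; split=> //; split=> //; exact: K'.
split.
  apply/subspace_continuousP => -[t p] [/= Tt _] N nN.
  have [K _] := H t p Tt; have := K N nN; rewrite /within /=.
  by apply: filterS => -[s q] /= K' [Ts _]; exact: K'.
move=> c1 c1' a1 a1' [t x] [/= Tt cx dx].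
have [cont [c [c' [ac ac' dp dp' sm]]]] := H t (cinv c1 x) Tt.
pose A := [set z : R * E | [/\ T z.1, cimg c1 z.2 & cdom c1' (F z.1 (cinv c1 z.2))]].
have Atx : A (t, x) by [].
have C := cvg_param a1 cx (t := t).
have N0 : \forall z \near (t, x), cdom c (cinv c1 z.2).
  by have := C _ (near_snd t (chart_open_dom ac dp)).
have N1 : \forall z \near (t, x), T z.1 -> cdom c' (F z.1 (cinv c1 z.2)).
  exact: C _ (cont _ (chart_open_dom ac' dp')).
have step1 : smooth_at A (fun z => (z.1, c (cinv c1 z.2))) (t, x).
  apply: smooth_at_pair; first by apply: smoothT_at; apply: smoothT_fst; exact: smoothT_id.
  apply: (smooth_at_comp (B := setT) (g := fun y => c (cinv c1 y)) (f := snd)) => //.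
  - exact: filterE.
  - by apply: smoothT_at; apply: smoothT_snd; exact: smoothT_id.
  - exact: transition_smooth.
have fRE : findim (R * E)%type by exact: findim_prod (findim_real) fE.
have step2 : smooth_at A (fun z => c' (F z.1 (cinv c (c (cinv c1 z.2))))) (t, x).
  apply: (smooth_at_comp (f := fun z => (z.1, c (cinv c1 z.2)))
    (g := fun z => c' (F z.1 (cinv c z.2)))) step1 sm => //.
  by apply: filterS N0 => -[s y] /= d [Ts _ _]; split=> //; exact: chart_img.
apply: (smooth_at_germ (A := A) (f := fun z => c1' (cinv c' (c' (F z.1 (cinv c (c (cinv c1 z.2)))))))).
  apply: filterS2 N0 N1 => -[s y] /= d K [Ts cy dy]; split=> //.
  by rewrite (chart_cmapK ac)// (chart_cmapK ac') //; exact: K.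
apply: (smooth_at_comp (B := setT) (g := fun y => c1' (cinv c' y))) step2 _ => //.
  exact: filterE.
rewrite /= (chart_cmapK ac dp); apply: transition_smooth => //; first exact: chart_img.
by rewrite (chart_cmapK ac').
Qed.

Lemma family_smooth_at_near T (F F' : R -> M -> M) t0 p0 : T t0 ->
  (\forall z \near ((t0, p0) : R * M), T z.1 -> F z.1 z.2 = F' z.1 z.2) ->
  family_smooth_at T F t0 p0 -> family_smooth_at T F' t0 p0.
Proof.
move=> Tt N [cont [c [c' [ac ac' dp dp' sm]]]].
have e0 : F t0 p0 = F' t0 p0 by exact: (nbhs_singleton N).
split.
  move=> P; rewrite -e0 => /cont nP; apply: filterS2 N nP => -[t p] /= e H Tt'.
  by rewrite -e//; exact: H.
exists c, c'; rewrite -e0; split=> //; apply: smooth_at_germ sm.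
have C := cvg_param_at ac dp (t := t0).
have H : \forall z \near ((t0, c p0) : R * E), T z.1 ->
  F z.1 (cinv c z.2) = F' z.1 (cinv c z.2) := C _ N.
by apply: filterS H => -[t y] /= e [Tt' cy]; rewrite e.
Qed.

Lemma family_smooth_at_id T t0 p0 : T t0 -> family_smooth_at T (fun _ => id) t0 p0.
Proof.
move=> Tt; split.
  by move=> N nN; apply: filterS (near_snd t0 nN) => z Nz _.
have ac := chart_at_atlas S p0; have dp := chart_at_dom S p0.
exists (chart_at S p0), (chart_at S p0); split=> //.
apply: (smooth_at_germ (A := setT) (f := snd)); last first.
  by apply: smoothT_at; apply: smoothT_snd; exact: smoothT_id.
by apply: filterE => -[t y] /= [_ cy]; rewrite chart_cinvK.
Qed.

(** Continuity at (t0, p0) is recovered from smoothness in charts, as soon as nearby points are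
    known to land in the domain of c'. *)
Lemma family_smooth_atI (T : set R) (F : R -> M -> M) t0 p0 c c' : T t0 ->
  atlas S c -> atlas S c' -> cdom c p0 -> cdom c' (F t0 p0) ->
  (\forall z \near ((t0, p0) : R * M), T z.1 -> cdom c' (F z.1 z.2)) ->
  smooth_at [set z : R * E | T z.1 /\ cimg c z.2]
    (fun z => c' (F z.1 (cinv c z.2))) (t0, c p0) ->
  family_smooth_at T F t0 p0.
Proof.
move=> Tt ac ac' dp dp' N sm; split; last by exists c, c'.
move=> P nP; have [U [g [oU Ut sg fg]]] := sm.
have cc : (fun z : R * M => (z.1, c z.2)) @ ((t0, p0) : R * M) --> ((t0, c p0) : R * E).
  move=> Q [/= [Q1 Q2] /= [nQ1 nQ2] HQ].
  exists (Q1, c @^-1` Q2) => /=; first by split=> //; exact: (chart_cts ac dp nQ2).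
  by move=> z [z1 z2]; exact: (HQ (z.1, c z.2) (conj z1 z2)).
have e0 : g (t0, c p0) = c' (F t0 p0).
  by rewrite -fg//= ?(chart_cmapK ac)//; split=> //; exact: chart_img.
have C : (cinv c' \o g) @ ((t0, c p0) : R * E) --> F t0 p0.
  rewrite -[X in _ --> X](chart_cmapK ac' dp') -e0.
  apply: continuous_comp; first exact: Ck_cts (sg 0%N) Ut.
  by apply: chart_cinv_cts ac' _; rewrite e0; exact: chart_img.
have N1 : \forall z \near ((t0, c p0) : R * E), U z /\ P (cinv c' (g z)).
  by apply: filterI; [exact: open_nbhs_nbhs|exact: (C _ nP)].
have N2 : \forall z \near ((t0, p0) : R * M), U (z.1, c z.2) /\ P (cinv c' (g (z.1, c z.2))) := cc _ N1.
have N3 : \forall z \near ((t0, p0) : R * M), cdom c z.2 by exact: near_snd (chart_open_dom ac dp).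
apply: filterS3 N2 N3 N => -[t p] /= [Uz Pz] dz Fz Tt'.
have := fg _ Uz (conj Tt' (chart_img dz)); rewrite /= (chart_cmapK ac dz) => gE.
by move: Pz; rewrite -gE (chart_cmapK ac' (Fz Tt')).
Qed.

Lemma smooth_family_comp T (F G : R -> M -> M) :
  smooth_family S T F -> smooth_family S T G -> smooth_family S T (fun t p => F t (G t p)).
Proof.
move=> sF sG; apply/smooth_familyP => t p Tt.
have [contF [c [c' [ac ac' dp dp' smF]]]] := (smooth_familyP _ _).1 sF t (G t p) Tt.
have [contG _] := (smooth_familyP _ _).1 sG t p Tt.
split.
  move=> N /contF [[/= N1 N2] [nN1 nN2] HN]; have := contG N2 nN2.
  apply: filterS2 (near_fst p nN1) => -[s q] /= K1 K2 Ts.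
  by apply: (HN (s, G s q)) => //; split=> //; exact: K2.
have ac1 := chart_at_atlas S p; have dp1 := chart_at_dom S p.
exists (chart_at S p), c'; split=> //.
pose c1 := chart_at S p; rewrite -/c1.
have C := cvg_param_at ac1 dp1 (t := t).
have N0 : \forall z \near (t, c1 p), T z.1 -> cdom c (G z.1 (cinv c1 z.2)).
  exact: C _ (contG _ (chart_open_dom ac dp)).
pose A := [set z : R * E | T z.1 /\ cimg c1 z.2].
have At : A (t, c1 p) by split=> //; exact: chart_img.
have smG : smooth_at A (fun z => c (G z.1 (cinv c1 z.2))) (t, c1 p).
  apply: smooth_at_germ (sG.2 _ _ ac1 ac (t, c1 p) _).
    by apply: filterS N0 => -[s y] /= K [Ts cy]; split=> //; split=> //; exact: K.
  by split=> //=; [exact: chart_img|rewrite (chart_cmapK ac1)].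
have sm1 : smooth_at A (fun z => (z.1, c (G z.1 (cinv c1 z.2)))) (t, c1 p).
  by apply: smooth_at_pair => //; apply: smoothT_at; apply: smoothT_fst; exact: smoothT_id.
apply: (smooth_at_germ (A := A) (f := fun z => c' (F z.1 (cinv c (c (G z.1 (cinv c1 z.2))))))).
  by apply: filterS N0 => -[s y] /= K [Ts cy]; split=> //; rewrite (chart_cmapK ac)//; exact: K.
apply: (smooth_at_comp (f := fun z => (z.1, c (G z.1 (cinv c1 z.2))))
    (g := fun z => c' (F z.1 (cinv c z.2))) (B := [set z | T z.1 /\ cimg c z.2])) sm1 _ => //.
- exact: findim_prod (findim_real) fE.
- by apply: filterS N0 => -[s y] /= K [Ts cy]; split=> //; apply: chart_img; exact: K.
- by rewrite /= (chart_cmapK ac1).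
Qed.

Lemma smooth_family_map T (F : R -> M -> M) t : T t ->
  smooth_family S T F -> smooth_map S (F t).
Proof.
move=> Tt sF; have := (smooth_familyP _ _).1 sF t; split.
  move=> p N nN; have [contF _] := H p Tt.
  have [[/= N1 N2] [nN1 nN2] HN] := contF N nN.
  rewrite nbhs_filterE; apply: filterS nN2 => q N2q; apply: (HN (t, q)) => //.
  by split=> //=; exact: nbhs_singleton.
move=> c c' ac ac' x [cx dx].
have fRE : findim (R * E)%type by exact: findim_prod (findim_real) fE.
apply: (smooth_at_comp (f := fun x => (t, x)) (g := fun z => c' (F z.1 (cinv c z.2)))
   (B := [set z : R * E | [/\ T z.1, cimg c z.2 & cdom c' (F z.1 (cinv c z.2))]])) => //.
- by apply: filterE => y [].
- by apply: smoothT_at; apply: smoothT_pair; [exact: smoothT_cst|exact: smoothT_id].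
- exact: (sF.2 c c' ac ac' (t, x)).
Qed.

Lemma smooth_map_comp (f g : M -> M) : smooth_map S f -> smooth_map S g ->
  smooth_map S (fun p => f (g p)).
Proof.
have K (h : M -> M) : smooth_map S h -> smooth_family S setT (fun _ => h).
  move=> [ch sh]; split.
    apply/subspace_continuousP => -[t p] _; apply: cvg_within_filter.
    by apply: (@cvg_comp _ _ _ snd h); [exact: cvg_snd|exact: ch].
  move=> c c' ac ac' [t x] [/= _ cx dx].
  apply: (smooth_at_comp (f := snd) (g := fun x => c' (h (cinv c x)))
    (B := [set x | cimg c x /\ cdom c' (h (cinv c x))])) => //.
  - by apply: filterE => -[s y] [].
  - by apply: smoothT_at; apply: smoothT_snd; exact: smoothT_id.
  - exact: (sh c c' ac ac' x).
move=> /K sf /K sg; exact: (@smooth_family_map setT _ 0 I (smooth_family_comp sf sg)).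
Qed.

Lemma diffeomorphism_comp (f g : M -> M) : diffeomorphism S f -> diffeomorphism S g ->
  diffeomorphism S (fun p => f (g p)).
Proof.
move=> [f' [fK f'K sf sf']] [g' [gK g'K sg sg']]; exists (fun p => g' (f' p)); split.
- by move=> p; rewrite fK gK.
- by move=> p; rewrite g'K f'K.
- exact: smooth_map_comp.
- exact: smooth_map_comp.
Qed.

Lemma smooth_map_diff (f : M -> M) c c' p : smooth_map S f -> atlas S c -> atlas S c' ->
  cdom c p -> cdom c' (f p) -> differentiable (fun x => c' (f (cinv c x))) (c p).
Proof.
move=> [cf sf] ac ac' dp dp'.
apply: (smooth_at_diff (A := [set x | cimg c x /\ cdom c' (f (cinv c x))])); last first.
  by apply: (sf c c' ac ac'); split; [exact: chart_img|rewrite (chart_cmapK ac)].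
apply: filterI; first exact: chart_open_img ac (chart_img dp).
have := chart_cinv_cts ac (chart_img dp).
rewrite /prop_for /continuous_at (chart_cmapK ac dp) => C.
by apply: (C (f @^-1` cdom c')); apply: cf; exact: chart_open_dom.
Qed.

Lemma diff_comp_near (V W X : normedModType R) (f : V -> W) (g : W -> X) (h : V -> X) x y v :
  f x = y -> differentiable f x -> differentiable g y -> (\near x, h x = g (f x)) ->
  differentiable h x /\ 'd h x v = 'd g y ('d f x v).
Proof.
move=> <- df dg e; have d := differentiable_comp df dg.
have e' : \near x, (g \o f) x = h x by apply: filterS e => z ->.
have [dh ->] := near_eq_diff e' d; split=> //.
by rewrite diff_comp.
Qed.

Lemma tangent_map_near_id (f : M -> M) p v : (\forall q \near p, f q = q) -> tangent_map S f p v = v.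
Proof.
move=> N; rewrite /tangent_map (nbhs_singleton N); apply: near_id_diff.
have ap := chart_at_atlas S p; have dp := chart_at_dom S p.
have C : cinv (chart_at S p) @ (chart_at S p p) --> p.
  by rewrite -[X in _ --> X](chart_cmapK ap dp); exact: (chart_cinv_cts ap (chart_img dp)).
have N1 : \forall x \near chart_at S p p, f (cinv (chart_at S p) x) = cinv (chart_at S p) x := C _ N.
by apply: filterS2 N1 (chart_open_img ap (chart_img dp)) => x h cx /=; rewrite h (chart_cinvK ap).
Qed.

Lemma tangent_map_comp (f g : M -> M) p v : smooth_map S f -> smooth_map S g ->
  tangent_map S (f \o g) p v = tangent_map S f (g p) (tangent_map S g p v).
Proof.
move=> sf sg; rewrite /tangent_map.
have a1 := chart_at_atlas S p; have d1 := chart_at_dom S p.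
have a2 := chart_at_atlas S (g p); have d2 := chart_at_dom S (g p).
have a3 := chart_at_atlas S (f (g p)); have d3 := chart_at_dom S (f (g p)).
have D1 := smooth_map_diff sg a1 a2 d1 d2.
have D2 := smooth_map_diff sf a2 a3 d2 d3.
have e0 : chart_at S (g p) (g (cinv (chart_at S p) (chart_at S p p))) = chart_at S (g p) (g p).
  by rewrite (chart_cmapK a1 d1).
have [|_ e1] := @diff_comp_near _ _ _ (fun x => chart_at S (g p) (g (cinv (chart_at S p) x)))
   (fun x => chart_at S (f (g p)) (f (cinv (chart_at S (g p)) x)))
   (chart_at S ((f \o g) p) \o (f \o g) \o cinv (chart_at S p)) (chart_at S p p) _ v e0 D1 D2.
  have N : \forall x \near chart_at S p p, cdom (chart_at S (g p)) (g (cinv (chart_at S p) x)).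
    have := chart_cinv_cts a1 (chart_img d1).
    rewrite /prop_for /continuous_at (chart_cmapK a1 d1) => C.
    by apply: (C (g @^-1` cdom (chart_at S (g p)))); apply: sg.1; exact: chart_open_dom.
  by apply: filterS N => x dx; rewrite /= (chart_cmapK a2).
exact: e1.
Qed.

End ManifoldBasics.

(** * Flows of compactly supported fields *)

Section FiberTangent.
Context {R : realType}.
Variables (Z E : normedModType R) (X : Z * E -> E) (zeta : Z).
Implicit Types s t : R.

Lemma partial_diff (W : normedModType R) (F : Z * E -> W) z x v : smoothT F ->
  'd (fun x => F (z, x)) x v = 'd F (z, x) (0, v).
Proof.
move=> sF.
have dp : is_diff x (fun x : E => (z, x)) (fun v => (0, v)) by apply: is_diff_pair.
have [d e] := dp; have dF : differentiable F (z, x) by exact: smoothT_diff.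
have [_ ->] := @diff_comp_near R _ _ _ (fun x => (z, x)) F (fun x => F (z, x)) x (z, x) v erefl d dF (filterE _ (fun _ => erefl)).
by rewrite e.
Qed.

Lemma is_derive_snd (D : R -> Z * E) t a : is_derive t 1 D a -> is_derive t 1 (fun s => (D s).2) a.2.
Proof.
have csnd : continuous (snd : Z * E -> E) by move=> p; exact: cvg_snd.
exact: (@is_derive_lin R _ _ (snd : {linear (Z * E)%type -> E})).
Qed.

(** On Z the map [phi s] is a translation, so its differential sends (0, v) to (0, dg v). The second
    component of the variational equation of the autonomous field is therefore that of the fiber. *)
Lemma fiber_tangent (phi : R -> Z * E -> Z * E) (g : R -> Z * E -> E) z x v t :
  (forall s, phi s = fun p => (p.1 + s *: zeta, g s p)) -> smoothT X -> (forall s, smoothT (g s)) ->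
  (forall s, differentiable (phi s) (z, x) /\
    forall v, is_derive s 1 (fun s => 'd (phi s) (z, x) v)
      ('d (fun p => (zeta, X p)) (phi s (z, x)) ('d (phi s) (z, x) v))) ->
  is_derive t 1 (fun s => 'd (fun x => g s (z, x)) x v)
    ('d (fun y => X (z + t *: zeta, y)) (g t (z, x)) ('d (fun x => g t (z, x)) x v)).
Proof.
move=> Ephi sX sg L.
have dg s : differentiable (g s) (z, x) by exact: smoothT_diff (sg s).
have dz s : differentiable (fun p : Z * E => p.1 + s *: zeta) (z, x).
  apply: smoothT_diff; apply: smoothTD; last exact: smoothT_cst.
  by apply: smoothT_fst; exact: smoothT_id.
have pd s : 'd (fun x => g s (z, x)) x v = 'd (g s) (z, x) (0, v) by exact: partial_diff.
have E1 s : 'd (phi s) (z, x) (0, v) = (0, 'd (fun x => g s (z, x)) x v).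
  rewrite Ephi (diff_pair (dz s) (dg s)) pd; congr pair.
  have dp : is_diff x (fun x : E => (z, x)) (fun v => (0, v)) by apply: is_diff_pair.
  have [d e] := dp.
  have [_] := @diff_comp_near R _ _ _ (fun x => (z, x)) (fun p : Z * E => p.1 + s *: zeta)
    (fun _ => z + s *: zeta) x (z, x) v erefl d (dz s) (filterE _ (fun _ => erefl)).
  by rewrite e diff_cst.
have E2 : (fun s => 'd (fun x => g s (z, x)) x v) = (fun s => ('d (phi s) (z, x) (0, v)).2).
  by apply/funext => s; rewrite E1.
have H := is_derive_snd ((L t).2 (0, v)).
rewrite E2; apply: is_derive_congr H _; rewrite E1 Ephi (partial_diff (z + t *: zeta) (g t (z, x)) _ sX).
set p := (_, _); set a := (0, _).
have dc : differentiable (fun _ : Z * E => zeta) p by exact: differentiable_cst.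
have dX : differentiable X p by exact: smoothT_diff.
exact: (congr1 (fun h : Z * E -> Z * E => (h a).2) (diff_pair dc dX)).
Qed.

End FiberTangent.

Section CompactFlow.
Context {R : realType} {n : nat} {Z : normedModType R}.
Local Notation E := 'rV[R]_n.
Implicit Types (s t : R).
Variables (X : Z * E -> E) (zeta : Z) (y0 : E) (rho : R).
Hypotheses (fZ : findim Z) (sX : smoothT X).
Hypothesis X0 : forall z x, rho < `|x - y0| -> X (z, x) = 0.

Let fE : findim E := findim_rV n.
Let fZE : findim (Z * E)%type := findim_prod fZ fE.

Lemma dist_continuous : continuous (fun y : E => `|y - y0|).
Proof.
have sm : smoothT (fun y : E => y - y0) by apply: smoothTB; [exact: smoothT_id|exact: smoothT_cst].
have C := smoothT_cts sm; move=> y.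
by apply: (@continuous_comp _ _ _ (fun y : E => y - y0) (@Num.norm _ E)); [exact: C|exact: norm_continuous].
Qed.

Lemma outside_open (x : E) : rho < `|x - y0| -> \forall y \near x, rho < `|y - y0|.
Proof.
by move=> h; exact: (cvgr_gt _ (dist_continuous (x := x)) _ h).
Qed.

Lemma ball_compact : compact [set x : E | `|x - y0| <= rho].
Proof.
apply: bounded_closed_compact.
  exists (rho + `|y0|); split; first exact: num_real.
  move=> m Hm x /= xr; apply: le_trans (ltW Hm).
  by have := ler_normD (x - y0) y0; rewrite subrK => /le_trans; apply; rewrite lerD2r.
by apply: (closed_comp (f := fun y : E => `|y - y0|) (D := [set r | r <= rho])) => [y _|]; [exact: dist_continuous|exact: closed_le].
Qed.

Let Xz_smooth z : smoothT (fun x => X (z, x)).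
Proof.
by apply: smoothT_comp => //; apply: smoothT_pair; [exact: smoothT_cst|exact: smoothT_id].
Qed.

(** Provides the position-independent constant that [picard] asks for: the derivative in x is
    bounded on the ball by compactness, and vanishes outside, where X is locally zero. *)
Lemma field_lipschitz z T : exists2 L, 0 <= L & forall t x y, `|t| <= T ->
  `|X (z + t *: zeta, x) - X (z + t *: zeta, y)| <= L * `|x - y|.
Proof.
have [m [e [l [k [cl le k0 Hk]]]]] := coord_bounds fE.
have [C C0 HC] := mvt_ineq fE.
pose q (p : R * E) := \sum_i k i * `|'D_(0, e i) X (z + p.1 *: zeta, p.2)|.
have cq : continuous q.
  move=> p; apply: cvg_sumr => i; apply: cvgMr; apply: cvg_norm.
  apply: (@cvg_comp _ _ _ (fun p : R * E => (z + p.1 *: zeta, p.2)) ('D_(0, e i) X)).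
    apply: (smoothT_cts (f := fun p : R * E => (z + p.1 *: zeta, p.2))); apply: smoothT_pair.
      apply: smoothTD; first exact: smoothT_cst.
      by apply: smoothTZ; [apply: smoothT_fst; exact: smoothT_id|exact: smoothT_cst].
    by apply: smoothT_snd; exact: smoothT_id.
  exact: (smoothT_cts (smoothT_D (0, e i) sX)).
have /compact_bounded[M0 [_ HM0]] : compact (q @` (`[- T, T] `*` [set x : E | `|x - y0| <= rho])).
  apply: continuous_compact; first exact: continuous_subspaceT.
  by apply: compact_setX; [exact: segment_compact|exact: ball_compact].
pose M := `|M0| + 1.
have MM0 : M0 < M by rewrite (le_lt_trans (ler_norm _))// ltrDl.
have q0 p : 0 <= q p by apply: sumr_ge0 => i _; rewrite mulr_ge0.
have HM t x : `|t| <= T -> forall v, `|'d (fun x => X (z + t *: zeta, x)) x v| <= M * `|v|.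
  move=> tT v; have [xr|xr] := leP `|x - y0| rho; last first.
    have N : \near x, 0 = X (z + t *: zeta, x).
      by apply: filterS (outside_open xr) => y yr; rewrite X0.
    have [_ ->] := near_eq_diff N (differentiable_cst 0 x).
    by rewrite diff_cst normr0 mulr_ge0// addr_ge0.
  have qM : q (t, x) <= M.
    have := HM0 _ MM0 (q (t, x)); rewrite /= ger0_norm//; apply; exists (t, x) => //.
    by split=> //=; rewrite in_itv/= -ler_norml.
  apply: le_trans (ler_wpM2r (normr_ge0 v) qM).
  rewrite partial_diff// {1}(le v).
  have -> : ((0, \sum_i l i v *: e i) : Z * E) = \sum_i l i v *: (0, e i).
    apply: injective_projections; rewrite /= !(raddf_sum fst, raddf_sum snd) //=.
    by rewrite big1// => i _; rewrite scaler0.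
  rewrite linear_sum (le_trans (ler_norm_sum _ _ _))// /q mulr_suml.
  apply: ler_sum => i _; rewrite linearZ normrZ deriveE; last exact: smoothT_diff.
  by rewrite mulrAC ler_wpM2r.
exists (C * M); first by rewrite mulr_ge0 ?(ltW C0)// addr_ge0.
move=> t x y tT.
pose f x := X (z + t *: zeta, x).
have dl s : is_derive s 1 (fun s : R => y + s *: (x - y)) (x - y).
  rewrite -[X in is_derive _ _ _ X]add0r; apply: is_deriveD; exact: is_derive_scalel.
have := HC (fun s => f (y + s *: (x - y))) (fun s => 'd f (y + s *: (x - y)) (x - y)) (M * `|x - y|).
have E1 : y + (x - y) = x by rewrite addrC subrK.
rewrite scale1r scale0r addr0 E1 mulrA; apply.
  by move=> s _; apply: (is_derive_chain (g := f)) (dl s) _; exact: smoothT_diff (Xz_smooth _).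
by move=> s _; exact: HM.
Qed.

Lemma compact_flow_exists (z : Z) (x : E) : exists u : R -> E, u 0 = x /\
  forall t, is_derive t 1 u (X (z + t *: zeta, u t)).
Proof.
apply: (@picard R E fE (fun t x => X (z + t *: zeta, x))).
  have c1 : continuous (fun t : R => z + t *: zeta).
    apply: smoothT_cts; apply: smoothTD; first exact: smoothT_cst.
    by apply: smoothTZ; [exact: smoothT_id|exact: smoothT_cst].
  move=> u cu t.
  have C : continuous (fun t : R => (z + t *: zeta, u t)) by move=> s; exact: cvg_pair (c1 s) (cu s).
  apply: (@continuous_comp _ _ _ (fun t : R => (z + t *: zeta, u t)) X); first exact: C.
  exact: smoothT_cts.
exact: field_lipschitz.
Qed.

(* The parameter z drifts with constant velocity zeta: time-dependent fields are
   obtained by letting time be a coordinate of z. *)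
Definition gflow (t : R) (p : Z * E) : E :=
  projT1 (cid (compact_flow_exists p.1 p.2)) t.

Lemma gflow0 z x : gflow 0 (z, x) = x.
Proof. by rewrite /gflow; case: cid => u [? ?]. Qed.

Lemma gflow_derive z x t : is_derive t 1 (fun s => gflow s (z, x)) (X (z + t *: zeta, gflow t (z, x))).
Proof. by rewrite /gflow /=; case: cid => u [? ?]. Qed.

Lemma gflow_unique z (u : R -> E) T : 0 <= T ->
  (forall t, 0 <= t <= T -> is_derive t 1 u (X (z + t *: zeta, u t))) ->
  u T = gflow T (z, u 0).
Proof.
move=> T0 du; have [L L0 HL] := field_lipschitz z T.
apply: (@ode_unique R E fE (fun t x => X (z + t *: zeta, x)) u (fun s => gflow s (z, u 0)) L T T0 L0 du).
- by move=> t _; exact: gflow_derive.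
- by move=> t /andP[t0 tT]; apply: HL; rewrite ger0_norm.
- by rewrite gflow0.
Qed.

(** [ode_unique] runs forward from time 0. Shifting time by a is absorbed by the parameter, and for
    b < a the curves are reversed as well. *)
Lemma solution_unique z (u v : R -> E) a b :
  (forall t, is_derive t 1 u (X (z + t *: zeta, u t))) ->
  (forall t, is_derive t 1 v (X (z + t *: zeta, v t))) -> u a = v a -> u b = v b.
Proof.
move=> du dv uv.
have [ab|ab] := leP a b.
  have [L L0 HL] := field_lipschitz (z + a *: zeta) (b - a).
  have e : b = (b - a) + a by rewrite subrK.
  rewrite e; apply: (@ode_unique R E fE (fun t x => X (z + a *: zeta + t *: zeta, x))
    (fun s => u (s + a)) (fun s => v (s + a)) L) => //; rewrite ?subr_ge0// ?add0r//.
  - by move=> t _; rewrite -addrA -scalerDl (addrC a); exact: is_derive_shift_arg.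
  - by move=> t _; rewrite -addrA -scalerDl (addrC a); exact: is_derive_shift_arg.
  - by move=> t /andP[t0 tT]; apply: HL; rewrite ger0_norm.
have [L L0 HL] := field_lipschitz (z + a *: zeta) (a - b).
have e : b = - (a - b) + a by rewrite opprB subrK.
have D w : (forall t, is_derive t 1 w (X (z + t *: zeta, w t))) -> forall t,
    is_derive t 1 (fun s => w (- s + a)) (- X (z + a *: zeta + (- t) *: zeta, w (- t + a))).
  move=> dw t; apply: (is_derive_opp_arg (u := fun s => w (s + a))).
  by rewrite -addrA -scalerDl (addrC a); exact: is_derive_shift_arg.
rewrite e; apply: (@ode_unique R E fE (fun t x => - X (z + a *: zeta + (- t) *: zeta, x))
    (fun s => u (- s + a)) (fun s => v (- s + a)) L (a - b)) => //.
- by rewrite subr_ge0 ltW.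
- move=> t /andP[t0 tT]; rewrite -opprD normrN; apply: HL.
  by rewrite normrN ger0_norm.
- by rewrite oppr0 add0r.
Qed.

Lemma gflow_outside z x t : rho < `|x - y0| -> gflow t (z, x) = x.
Proof.
move=> xr; apply: (@solution_unique z (fun s => gflow s (z, x)) (fun _ => x) 0 t).
- exact: gflow_derive.
- by move=> s; rewrite X0//; exact: is_derive_cst.
- by rewrite gflow0.
Qed.

(** If the orbit were outside at time t, the curve resting there would be the same solution, and x
    itself would lie outside. *)
Lemma gflow_inside z x t : `|x - y0| <= rho -> `|gflow t (z, x) - y0| <= rho.
Proof.
move=> xr; rewrite leNgt; apply/negP => h.
have H : gflow 0 (z, x) = gflow t (z, x).
  apply: (@solution_unique z (fun s => gflow s (z, x)) (fun _ => gflow t (z, x)) t 0 (gflow_derive z x)) => //.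
  by move=> s; rewrite X0//; exact: is_derive_cst.
by move: h; rewrite -H gflow0 ltNge xr.
Qed.

(** The form that the group law takes for time-dependent fields. As functions of t both sides solve
    the equation with the drifted parameter, and they agree at t = 0; inverses follow with a drifted
    parameter too. *)
Lemma gflow_shift z x a t : gflow (t + a) (z, x) = gflow t (z + a *: zeta, gflow a (z, x)).
Proof.
apply: (@solution_unique (z + a *: zeta) (fun s => gflow (s + a) (z, x))
   (fun s => gflow s (z + a *: zeta, gflow a (z, x))) 0 t).
- move=> s; rewrite -addrA -scalerDl (addrC a).
  by apply: (is_derive_shift_arg (u := fun s => gflow s (z, x))); exact: gflow_derive.
- exact: gflow_derive.
- by rewrite add0r gflow0.
Qed.

Lemma gflowK z x a : gflow (- a) (z + a *: zeta, gflow a (z, x)) = x.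
Proof. by rewrite -gflow_shift addrC subrr gflow0. Qed.

Let field (p : Z * E) : Z * E := (zeta, X p).
Let phi t (p : Z * E) : Z * E := (p.1 + t *: zeta, gflow t p).

Let sfield : smoothT field.
Proof. by apply: smoothT_pair => //; exact: smoothT_cst. Qed.

Let phi0 p : phi 0 p = p.
Proof. by case: p => z x; rewrite /phi /= scale0r addr0 gflow0. Qed.

Let dphi p t : is_derive t 1 (phi ^~ p) (field (phi t p)).
Proof.
case: p => z x.
have dz : is_derive t 1 (fun s : R => z + s *: zeta) zeta.
  by rewrite -[X in is_derive _ _ _ X]add0r; apply: is_deriveD; exact: is_derive_scalel.
have /is_deriveP[d1 e1] := dz; have /is_deriveP[d2 e2] := gflow_derive z x t.
apply/is_deriveP; split; first exact: (differentiable_pair d1 d2).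
by rewrite (diff_pair d1 d2) /= e1 e2.
Qed.

Lemma gflow_smooth t : smoothT (gflow t).
Proof.
exact: smoothT_snd (flow_smooth fZE sfield phi0 dphi t).
Qed.

Lemma gflow_tangent0 z x v : 'd (fun x => gflow 0 (z, x)) x v = v.
Proof.
have -> : (fun x => gflow 0 (z, x)) = id by apply/funext => y; rewrite gflow0.
by rewrite diff_val.
Qed.

Lemma gflow_tangent z x v t : is_derive t 1 (fun s => 'd (fun x => gflow s (z, x)) x v)
  ('d (fun y => X (z + t *: zeta, y)) (gflow t (z, x)) ('d (fun x => gflow t (z, x)) x v)).
Proof.
apply: (@fiber_tangent R Z E X zeta phi gflow) => //; first exact: gflow_smooth.
exact: linearized_flow (z, x) fZE sfield phi0 dphi.
Qed.

End CompactFlow.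

(** * Bilinear forms along curves and their invariance under Hamiltonian fields *)

Section FormAlongCurve.
Context {R : realType} {n : nat}.
Local Notation E := 'rV[R]_n.
Implicit Types (s t : R).
Variable w : E -> 'M[R]_n.

Definition wform (u v y : E) : R := (u *m w y *m v^T) 0 0.

Lemma wform_sum u v y : wform u v y = \sum_i \sum_j u 0 i * w y i j * v 0 j.
Proof.
rewrite /wform mxE exchange_big /=; apply: eq_bigr => j _.
by rewrite !mxE mulr_suml.
Qed.

Lemma is_derive_coord (u : R -> E) t v i : is_derive t 1 u v -> is_derive t 1 (fun s => u s 0 i) (v 0 i).
Proof.
move=> du; have dc : differentiable (fun x : E => x 0 i) (u t) by exact: differentiable_coord.
apply: is_derive_congr (is_derive_chain du dc) _.
have lin : linear (fun x : E => x 0 i) by move=> a x y; rewrite !mxE.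
pose lM := GRing.isLinear.Build _ _ _ _ _ lin.
pose l : {linear E -> R} := HB.pack (fun x : E => x 0 i) lM.
by rewrite (diff_lin (f := l))//; exact: coord_continuous.
Qed.

Lemma is_derive_sumf (I : finType) (f : I -> R -> R) (df : I -> R) t :
  (forall i, is_derive t 1 (f i) (df i)) -> is_derive t 1 (fun s => \sum_i f i s) (\sum_i df i).
Proof.
move=> H; rewrite /index_enum; elim: (Finite.enum I) => [|i r IH].
  rewrite big_nil; under eq_fun do rewrite big_nil; exact: is_derive_cst.
by rewrite big_cons; under eq_fun do rewrite big_cons; apply: is_deriveD.
Qed.

Lemma is_derive_form (u v c : R -> E) t u' v' c' :
  (forall i j, differentiable (fun y => w y i j) (c t)) ->
  is_derive t 1 u u' -> is_derive t 1 v v' -> is_derive t 1 c c' ->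
  is_derive t 1 (fun s => wform (u s) (v s) (c s))
    (wform u' (v t) (c t) + wform (u t) v' (c t) + 'D_c' (wform (u t) (v t)) (c t)).
Proof.
move=> dw du dv dc.
have dwc i j : is_derive t 1 (fun s => w (c s) i j) ('d (fun y => w y i j) (c t) c').
  exact: (is_derive_chain (g := fun y => w y i j)).
have dform a b : differentiable (wform a b) (c t) /\
    'd (wform a b) (c t) c' = \sum_i \sum_j a 0 i * 'd (fun y => w y i j) (c t) c' * b 0 j.
  have lE s : is_derive s 1 (fun s : R => c t + s *: c') c'.
    by rewrite -[X in is_derive _ _ _ X]add0r; apply: is_deriveD; exact: is_derive_scalel.
  have dd : differentiable (wform a b) (c t).
    have -> : wform a b = \sum_i \sum_j (fun y => a 0 i * w y i j * b 0 j).
      apply/funext => y; rewrite wform_sum fct_sumE; apply: eq_bigr => i _.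
      by rewrite fct_sumE.
    apply: differentiable_sum => i; apply: differentiable_sum => j.
    apply: differentiableM; last exact: differentiable_cst.
    by apply: differentiableM; [exact: differentiable_cst|exact: dw].
  split=> //.
  have := is_derive_chain dc dd; rewrite is_deriveP => -[_ <-].
  have H : is_derive t 1 (fun s => wform a b (c s))
     (\sum_i \sum_j a 0 i * 'd (fun y => w y i j) (c t) c' * b 0 j).
    under eq_fun do rewrite wform_sum.
    apply: is_derive_sumf => i; apply: is_derive_sumf => j.
    have H1 := is_deriveM (is_derive_cst (a 0 i) t 1) (dwc i j).
    have H2 := is_deriveM H1 (is_derive_cst (b 0 j) t 1).
    apply: is_derive_congr H2 _; rewrite /GRing.scale /=; ring.
  by move/is_deriveP: H => [_ <-].
have [d e] := dform (u t) (v t); rewrite deriveE// e !wform_sum -!big_split /=.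
under eq_fun do rewrite wform_sum.
apply: is_derive_sumf => i; rewrite -!big_split /=; apply: is_derive_sumf => j.
have H1 := is_deriveM (is_derive_coord i du) (dwc i j).
have H2 := is_deriveM H1 (is_derive_coord j dv).
apply: is_derive_congr H2 _; rewrite !fctE /GRing.scale /=; ring.
Qed.

(* Cartan's formula in coordinates: if the form is closed and i_X w = - dh, then L_X w = 0. *)
Lemma lie_derivative_hamiltonian (X : E -> E) (h : E -> R) (y u v : E) (N : set E) :
  open N -> N y -> Ck_on 2 N h -> differentiable X y ->
  (forall i j, differentiable (fun y => w y i j) y) ->
  (forall x a b, N x -> wform a b x = - wform b a x) ->
  (forall x a, N x -> wform (X x) a x = - 'D_a h x) ->
  (forall a b c, 'D_a (wform b c) y + 'D_b (wform c a) y + 'D_c (wform a b) y = 0) ->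
  wform ('d X y u) v y + wform u ('d X y v) y + 'D_(X y) (wform u v) y = 0.
Proof.
move=> oN Ny sh dX dw anti ham closed.
(* The equation i_X w = - dh, paired with b, is differentiated along the line through y directed by
   a. In the second term [X y] is frozen: only the coefficients of the form are differentiated. *)
have key a b : wform ('d X y a) b y + 'D_a (wform (X y) b) y = - 'D_a (fun x => 'D_b h x) y.
  have lE s : is_derive s 1 (fun s : R => y + s *: a) a.
    by rewrite -[X in is_derive _ _ _ X]add0r; apply: is_deriveD; exact: is_derive_scalel.
  have e0 : y + (0 : R) *: a = y by rewrite scale0r addr0.
  have dXa : is_derive (0 : R) 1 (fun s : R => X (y + s *: a)) ('d X y a).
    have := @is_derive_chain R _ _ X (fun s : R => y + s *: a) 0 a (lE 0).
    by rewrite e0; exact.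
  have := @is_derive_form (fun s : R => X (y + s *: a)) (fun _ => b) (fun s : R => y + s *: a) 0 _ _ _ _ dXa (is_derive_cst b (0 : R) 1) (lE 0).
  rewrite e0 => /(_ dw) H1.
  have z0 : wform (X y) 0 y = 0 by rewrite /wform trmx0 mulmx0 mxE.
  rewrite z0 addr0 in H1.
  have dDh : differentiable (fun x => - 'D_b h x) y.
    by apply: differentiableN; exact: (sh.2 b).1.
  have H2 : is_derive (0 : R) 1 (fun s : R => - 'D_b h (y + s *: a)) (- 'D_a (fun x => 'D_b h x) y).
    have := @is_derive_chain R _ _ (fun x => - 'D_b h x) (fun s : R => y + s *: a) 0 a (lE 0).
    rewrite e0 => /(_ dDh) H; apply: is_derive_congr H _.
    have d1 : differentiable (fun x => 'D_b h x) y by exact: (sh.2 b).1.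
    by rewrite (deriveE _ d1) (diffN d1).
  have near_eq : \forall s \near (0 : R), - 'D_b h (y + s *: a) = wform (X (y + s *: a)) b (y + s *: a).
    have C : (fun s : R => y + s *: a) @ (0 : R) --> y.
      by have := is_derive_cts (lE 0); rewrite /prop_for /continuous_at e0.
    have nN : nbhs y N by exact: open_nbhs_nbhs.
    have nN' : \forall s \near (0 : R), N (y + s *: a) := C _ nN.
    by apply: filterS nN' => s Ns; rewrite ham.
  have H3 := is_derive_near near_eq H2.
  by move/is_deriveP: H1 => [_ <-]; move/is_deriveP: H3 => [_ <-].
(* [key u v] minus [key v u]: the Hessians S1 and S2 cancel, and closedness trades the coefficient
   derivatives along u and v for the one along [X y]. *)
have arith (A1 B1 S1 A2 B2 S2 Q D : R) : A1 + B1 = - S1 -> A2 + B2 = - S2 ->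
    Q + D + B2 = 0 -> D = - B1 -> S1 = S2 -> A1 - A2 + Q = 0.
  by clear; lra.
have k1 := key u v; have k2 := key v u.
have a1 : wform u ('d X y v) y = - wform ('d X y v) u y by exact: anti.
have cl := closed (X y) u v.
have a2 : 'D_u (wform v (X y)) y = - 'D_u (wform (X y) v) y.
  have nN : nbhs y N by exact: open_nbhs_nbhs.
  have dd : differentiable (wform (X y) v) y.
    have -> : wform (X y) v = \sum_i \sum_j (fun x => (X y) 0 i * w x i j * v 0 j).
      apply/funext => x; rewrite wform_sum fct_sumE; apply: eq_bigr => i _.
      by rewrite fct_sumE.
    apply: differentiable_sum => i; apply: differentiable_sum => j.
    apply: differentiableM; last exact: differentiable_cst.
    by apply: differentiableM; [exact: differentiable_cst|exact: dw].
  rewrite (near_eq_D (g := fun x => - wform (X y) v x)); last by apply: filterS nN => x Nx; exact: anti.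
  by rewrite deriveN//; exact: diff_derivable.
have sw := schwarz u v oN Ny sh.
by rewrite a1; exact: arith k1 k2 cl a2 sw.
Qed.

End FormAlongCurve.

(** * Differential forms in charts *)

Section MatrixSmoothness.
Context {R : realType}.
Implicit Types (V W : normedModType R).

Lemma Ck_rV k V (U : set V) n (f : V -> 'rV[R]_n) : open U ->
  (forall j, Ck_on k U (fun x => f x 0 j)) -> Ck_on k U f.
Proof.
move=> oU H; apply: (@Ck_coord R k V _ n (fun i => delta_mx 0 i) (fun i (x : 'rV[R]_n) => x 0 i)) => //.
by move=> x; exact: row_sum_delta.
Qed.

Lemma smoothT_rV V n (f : V -> 'rV[R]_n) : (forall j, smoothT (fun x => f x 0 j)) -> smoothT f.
Proof. by move=> H k; apply: Ck_rV => [|j]; [exact: openT|exact: H]. Qed.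

Lemma Ck_det k V (U : set V) n (A : V -> 'M[R]_n) : open U ->
  (forall i j, Ck_on k U (fun x => A x i j)) -> Ck_on k U (fun x => \det (A x)).
Proof.
move=> oU H; apply: Ck_sum => // s _; apply: CkM => //; first exact: Ck_cst.
exact: Ck_prod.
Qed.

(** Cramer's formula expresses the entries of the inverse through determinants. *)
Lemma Ck_invmx k V (U : set V) n (A : V -> 'M[R]_n) : open U ->
  (forall x, U x -> A x \in unitmx) ->
  (forall i j, Ck_on k U (fun x => A x i j)) -> forall i j, Ck_on k U (fun x => invmx (A x) i j).
Proof.
move=> oU uA H i j.
apply: (Ck_eq oU (f := fun x => (\det (A x))^-1 * cofactor (A x) j i)).
  by move=> x Ux; rewrite /invmx uA// !mxE.
apply: CkM => //.
  by apply: CkV => // [x /uA|]; [rewrite unitmxE unitfE|exact: Ck_det].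
apply: CkM => //; first exact: Ck_cst.
by apply: Ck_det => // a b; apply: (Ck_eq oU _ (H _ _)) => x _; rewrite !mxE.
Qed.

End MatrixSmoothness.

Section FormsInCharts.
Context {R : realType} {n : nat} {M : topologicalType}.
Variables (S : smooth_structure R n M) (omega : M -> 'M[R]_n).
Hypothesis somega : symplectic_form S omega.
Local Notation E := 'rV[R]_n.
Implicit Types (c : chart R n M) (p q : M).

Definition chart_form c (y : E) : 'M[R]_n :=
  \matrix_(i, j) form2_in S omega c (delta_mx 0 i) (delta_mx 0 j) y.

Lemma form2D1 p (u u' v : E) a : form2 omega p (a *: u + u') v = a * form2 omega p u v + form2 omega p u' v.
Proof. by rewrite /form2 mulmxDl mulmxDl -scalemxAl -scalemxAl !mxE. Qed.

Lemma form2D2 p (u v v' : E) a : form2 omega p u (a *: v + v') = a * form2 omega p u v + form2 omega p u v'.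
Proof. by rewrite /form2 linearP /= mulmxDr -scalemxAr !mxE. Qed.

Lemma form2_anti p u v : form2 omega p u v = - form2 omega p v u.
Proof.
have := sform_alternating somega p (1 *: u + v).
rewrite form2D1 !form2D2 !(sform_alternating somega) !mul1r addr0 add0r.
by move=> /eqP; rewrite addr_eq0 => /eqP.
Qed.

Lemma form2_inE c u v y : form2_in S omega c u v y = wform (chart_form c) u v y.
Proof.
rewrite wform_sum /form2_in.
have T (a : E) : tangent_param S c y a = \sum_i a 0 i *: tangent_param S c y (delta_mx 0 i).
  by rewrite /tangent_param {1}(row_sum_delta a) linear_sum; apply: eq_bigr => i _; rewrite linearZ.
have L (w : E) (a : 'I_n -> R) (b : 'I_n -> E) : form2 omega (cinv c y) (\sum_i a i *: b i) w =
    \sum_i a i * form2 omega (cinv c y) (b i) w.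
  rewrite /index_enum; elim: (Finite.enum _) => [|i r IH].
    by rewrite !big_nil /form2 !mul0mx mxE.
  by rewrite !big_cons form2D1 IH.
have L' (w : E) (a : 'I_n -> R) (b : 'I_n -> E) : form2 omega (cinv c y) w (\sum_i a i *: b i) =
    \sum_i a i * form2 omega (cinv c y) w (b i).
  rewrite /index_enum; elim: (Finite.enum _) => [|i r IH].
    by rewrite !big_nil /form2 trmx0 !mulmx0 mxE.
  by rewrite !big_cons form2D2 IH.
rewrite (T u) L; apply: eq_bigr => i _; rewrite (T v) L' mulr_sumr.
by apply: eq_bigr => j _; rewrite mxE /form2_in -mulrA; congr (_ * _); exact: mulrC.
Qed.

Lemma chart_form_anti c u v y : wform (chart_form c) u v y = - wform (chart_form c) v u y.
Proof. by rewrite -!form2_inE; exact: form2_anti. Qed.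

Lemma chart_form_smooth c k i j : atlas S c -> Ck_on k (cimg c) (fun y => chart_form c y i j).
Proof.
move=> ac; apply: Ck_local => y cy.
have := sform_smooth somega ac (delta_mx 0 i) (delta_mx 0 j) cy.
move=> /(smooth_at_open (chart_open_img ac cy))[U [oU Uy UA sU]]; exists U; split=> //.
by apply: (Ck_eq oU _ (sU k)) => x Ux; rewrite mxE.
Qed.

Lemma chart_form_closed c y u v w : atlas S c -> cimg c y ->
  'D_u (wform (chart_form c) v w) y + 'D_v (wform (chart_form c) w u) y +
  'D_w (wform (chart_form c) u v) y = 0.
Proof.
move=> ac cy; have := sform_closed somega ac cy u v w.
have E1 a b : form2_in S omega c a b = wform (chart_form c) a b.
  by apply/funext => x; rewrite form2_inE.
by rewrite !E1.
Qed.

Lemma transition_diffK c c' p u : atlas S c -> atlas S c' -> cdom c p -> cdom c' p ->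
  'd (c' \o cinv c) (c p) ('d (c \o cinv c') (c' p) u) = u.
Proof.
move=> ac ac' dp dp'.
have D1 : differentiable (c \o cinv c') (c' p).
  by apply: (transition_diff ac' ac (chart_img dp')); rewrite (chart_cmapK ac').
have D2 : differentiable (c' \o cinv c) (c p).
  by apply: (transition_diff ac ac' (chart_img dp)); rewrite (chart_cmapK ac).
have e0 : (c \o cinv c') (c' p) = c p by rewrite /= (chart_cmapK ac').
have N : \forall x \near c' p, id x = (c' \o cinv c) ((c \o cinv c') x).
  have := near_cinv_dom ac' ac (chart_img dp').
  rewrite (chart_cmapK ac' dp') => /(_ dp); apply: filterS => x [cx cx'] /=.
  by rewrite (chart_cmapK ac cx') (chart_cinvK ac' cx).
have [_ <-] := diff_comp_near u e0 D1 D2 N.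
by rewrite diff_val.
Qed.

Definition tangent_chart c p : E -> E := 'd (c \o cinv (chart_at S p)) (chart_at S p p).

Lemma tangent_paramK c p u : atlas S c -> cdom c p -> tangent_param S c (c p) (tangent_chart c p u) = u.
Proof.
move=> ac dp; rewrite /tangent_param (chart_cmapK ac dp).
exact: transition_diffK ac (chart_at_atlas S p) dp (chart_at_dom S p).
Qed.

Lemma tangent_chartK c p u : atlas S c -> cdom c p -> tangent_chart c p (tangent_param S c (c p) u) = u.
Proof.
move=> ac dp; rewrite /tangent_param (chart_cmapK ac dp).
exact: transition_diffK (chart_at_atlas S p) ac (chart_at_dom S p) dp.
Qed.

Lemma form2_chart c p u v : atlas S c -> cdom c p ->
  form2 omega p (tangent_param S c (c p) u) (tangent_param S c (c p) v) =
  wform (chart_form c) u v (c p).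
Proof. by move=> ac dp; rewrite -form2_inE /form2_in (chart_cmapK ac dp). Qed.

Lemma unitmx_of_kernel (A : 'M[R]_n) : (forall u : E, u *m A = 0 -> u = 0) -> A \in unitmx.
Proof.
move=> H; rewrite -row_free_unit -kermx_eq0; apply/eqP/row_matrixP => i.
by rewrite row0; apply: H; apply/sub_kermxP; exact: row_sub.
Qed.

Lemma omega_unit p : omega p \in unitmx.
Proof.
apply: unitmx_of_kernel => u u0; apply: (sform_nondegenerate somega (p := p)) => v.
by rewrite /form2 u0 mul0mx mxE.
Qed.

Lemma chart_form_unit c y : atlas S c -> cimg c y -> chart_form c y \in unitmx.
Proof.
move=> ac [p dp <-]; apply: unitmx_of_kernel => u u0.
rewrite -(tangent_chartK u ac dp) (_ : tangent_param S c (c p) u = 0).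
  by rewrite /tangent_chart linear0.
apply: (sform_nondegenerate somega (p := p)) => v.
rewrite -(tangent_paramK v ac dp) form2_chart//.
by rewrite /wform u0 mul0mx mxE.
Qed.

(** Tangent vectors carry components in preferred charts, and [tangent_param] translates from c to
    these. The chain rule through the transition maps turns the tangent map of f into the
    differential of g, the expression of f in c. *)
Lemma tangent_map_chart (f : M -> M) (g : E -> E) c p v : atlas S c -> cdom c p -> cdom c (f p) ->
  differentiable g (c p) ->
  (\forall x \near c p, [/\ cimg c x, f (cinv c x) = cinv c (g x) & cimg c (g x)]) ->
  tangent_map S f p (tangent_param S c (c p) v) = tangent_param S c (c (f p)) ('d g (c p) v).
Proof.
move=> ac dp dfp dg N.
have ap := chart_at_atlas S p; have dp' := chart_at_dom S p.
have aq := chart_at_atlas S (f p); have dq' := chart_at_dom S (f p).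
have [cx fg cg] := nbhs_singleton N; rewrite (chart_cmapK ac dp) in fg.
have gE : g (c p) = c (f p) by rewrite fg (chart_cinvK ac cg).
have D1 : differentiable (c \o cinv (chart_at S p)) (chart_at S p p).
  by apply: (transition_diff ap ac (chart_img dp')); rewrite (chart_cmapK ap).
have e1 : (c \o cinv (chart_at S p)) (chart_at S p p) = c p by rewrite /= (chart_cmapK ap).
have [D2 E2] := @diff_comp_near R _ _ _ (c \o cinv (chart_at S p)) g (g \o (c \o cinv (chart_at S p)))
  _ _ (tangent_param S c (c p) v) e1 D1 dg (filterE _ (fun _ => erefl)).
have D3 : differentiable (chart_at S (f p) \o cinv c) (c (f p)).
  by apply: (transition_diff ac aq (chart_img dfp)); rewrite (chart_cmapK ac).
have e3 : (g \o (c \o cinv (chart_at S p))) (chart_at S p p) = c (f p).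
  by rewrite /= (chart_cmapK ap dp').
have N3 : \forall x \near chart_at S p p, (chart_at S (f p) \o f \o cinv (chart_at S p)) x =
    (chart_at S (f p) \o cinv c) ((g \o (c \o cinv (chart_at S p))) x).
  have K1 := near_cinv_dom ap ac (chart_img dp').
  rewrite (chart_cmapK ap dp') in K1; have {}K1 := K1 dp.
  have C : (c \o cinv (chart_at S p)) @ (chart_at S p p) --> c p.
    by rewrite -[X in _ --> X]e1; exact: differentiable_continuous D1.
  have K2 : \forall x \near chart_at S p p, [/\ cimg c (c (cinv (chart_at S p) x)),
    f (cinv c (c (cinv (chart_at S p) x))) = cinv c (g (c (cinv (chart_at S p) x)))
    & cimg c (g (c (cinv (chart_at S p) x)))] := C _ N.
  apply: filterS2 K1 K2 => x [cx1 dx] /= [_ fE _].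
  by rewrite -fE (chart_cmapK ac dx).
have [_ E3] := diff_comp_near (tangent_param S c (c p) v) e3 D2 D3 N3.
have E4 := tangent_chartK v ac dp.
apply: etrans E3 _; apply: etrans (congr1 _ (etrans E2 (congr1 _ E4))) _.
by rewrite /tangent_param (chart_cmapK ac dfp).
Qed.

End FormsInCharts.

(** * Hamiltonians supported in a chart *)

Section ChartHamiltonian.
Context {R : realType} {n : nat} {M : topologicalType}.
Local Notation E := 'rV[R]_n.
Variables (S : smooth_structure R n M) (omega : M -> 'M[R]_n).
Hypotheses (somega : symplectic_form S omega) (hM : hausdorff_space M).
Variables (c : chart R n M) (y0 : E) (rho rho' : R).
Hypotheses (ac : atlas S c) (lt_rho : rho < rho').
Hypothesis ball_img : forall x, `|x - y0| < rho' -> cimg c x.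
Variables (Z : normedModType R) (H : Z * E -> R) (zeta : Z).
Hypotheses (fZ : findim Z) (sH : smoothT H).
Hypothesis H0 : forall z x, rho <= `|x - y0| -> H (z, x) = 0.
Implicit Types (s t : R).

Let fE : findim E := findim_rV n.
Let fZE : findim (Z * E)%type := findim_prod fZ fE.
Local Notation W := (chart_form S omega c).

Let grad (p : Z * E) : E := \row_i 'D_(0, delta_mx 0 i) H p.

(** In the chart, i_X omega = - dH reads X W = - grad H. The inverse of W is meaningful only in the
    image of the chart, whence the value 0 beyond rho'; smoothness survives because the gradient
    vanishes beyond rho < rho', so that the two descriptions overlap. *)
Definition chart_field (p : Z * E) : E :=
  if `|p.2 - y0| < rho' then - (grad p *m invmx (W p.2)) else 0.

Let smooth_grad i : smoothT (fun p : Z * E => grad p 0 i).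
Proof.
have E1 : (fun p : Z * E => grad p 0 i) = 'D_(0, delta_mx 0 i) H.
  by apply/funext => p; rewrite mxE.
by rewrite E1; exact: smoothT_D.
Qed.

Lemma hamiltonian_partial z x u : 'D_u (fun x => H (z, x)) x = (grad (z, x) *m u^T) 0 0.
Proof.
have sHz : smoothT (fun x : E => H (z, x)).
  by apply: smoothT_comp => //; apply: smoothT_pair; [exact: smoothT_cst|exact: smoothT_id].
rewrite deriveE; last exact: smoothT_diff.
rewrite {1}(row_sum_delta u) linear_sum mxE; apply: eq_bigr => i _.
by rewrite linearZ /= partial_diff// !mxE deriveE 1?mulrC//; exact: smoothT_diff.
Qed.

Let grad_outside z x : rho < `|x - y0| -> grad (z, x) = 0.
Proof.
move=> xr; apply/rowP => i; rewrite !mxE.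
have N : \forall q \near ((z, x) : Z * E), H q = 0.
  have N1 : \forall q \near ((z, x) : Z * E), rho < `|q.2 - y0|.
    by exact: (near_snd z (outside_open xr)).
  by apply: filterS N1 => -[z' x'] /= h; rewrite H0// ltW.
rewrite (near_eq_D _ (g := fun _ => 0))//; exact: derive_cst.
Qed.

Lemma chart_field_outside z x : rho < `|x - y0| -> chart_field (z, x) = 0.
Proof. by move=> xr; rewrite /chart_field; case: ifP => //= _; rewrite grad_outside// mul0mx oppr0. Qed.

Let inner_open : open [set p : Z * E | `|p.2 - y0| < rho'].
Proof.
have C : continuous (fun p : Z * E => `|p.2 - y0|).
  move=> p; apply: (@continuous_comp _ _ _ snd (fun y : E => `|y - y0|)); first exact: cvg_snd.
  exact: dist_continuous.
rewrite openE => p /= pr; exact: (cvgr_lt _ (C p) _ pr).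
Qed.

Lemma chart_field_smooth : smoothT chart_field.
Proof.
apply: smoothT_rV => j; apply: smoothT_local => -[z x].
have [xr|xr] := ltP `|x - y0| rho'; last first.
  have N1 : \forall q \near ((z, x) : Z * E), rho < `|q.2 - y0|.
    by exact: (near_snd z (outside_open (lt_le_trans lt_rho xr))).
  apply: (smooth_at_germ (A := setT) (f := fun _ => 0)); last by apply: smoothT_at; exact: smoothT_cst.
  by apply: filterS N1 => -[z' x'] /= h _; split=> //; rewrite chart_field_outside// mxE.
have sW : forall k a b, Ck_on k [set p : Z * E | `|p.2 - y0| < rho'] (fun p : Z * E => invmx (W p.2) a b).
  move=> k; apply: Ck_invmx => // [p pr|a b].
    by apply: chart_form_unit => //; exact: ball_img.
  apply: (Ck_comp (U' := cimg c) (g := fun y => W y a b) (f := snd)) => //.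
  - by case: (atlas_chart ac).
  - by move=> p; exact: ball_img.
  - exact: chart_form_smooth.
  - exact: Ck_snd.
apply: (@Ck_smooth_at R _ _ setT [set p : Z * E | `|p.2 - y0| < rho'] (fun p : Z * E => chart_field p 0 j)) => // k.
apply: (Ck_eq inner_open (f := fun p : Z * E => - \sum_i grad p 0 i * invmx (W p.2) i j)).
  by move=> p /= pr; rewrite /chart_field pr mxE mxE.
apply: CkN => //; apply: Ck_sum => // i _; apply: CkM => //.
by apply: Ck_sub (smooth_grad i k).
Qed.

Local Notation g := (gflow zeta fZ chart_field_smooth chart_field_outside).

Lemma chart_field_hamiltonian z x u : `|x - y0| < rho' ->
  wform W (chart_field (z, x)) u x = - 'D_u (fun x => H (z, x)) x.
Proof.
move=> xr; rewrite /wform /chart_field xr mulNmx mulmxKV; last first.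
  by apply: chart_form_unit => //; exact: ball_img.
by rewrite mulNmx mxE hamiltonian_partial.
Qed.

(** The pulled-back form is constant along the orbit: its time derivative is the Lie derivative
    computed in [lie_derivative_hamiltonian]. The orbit stays in the ball of radius rho, where W is
    the form of the chart. *)
Lemma gflow_symplectic t z x u v : `|x - y0| <= rho ->
  wform W ('d (fun x => g t (z, x)) x u) ('d (fun x => g t (z, x)) x v) (g t (z, x)) = wform W u v x.
Proof.
move=> xr.
pose F s := wform W ('d (fun x => g s (z, x)) x u) ('d (fun x => g s (z, x)) x v) (g s (z, x)).
have dF s : is_derive s 1 F 0.
  have gr := gflow_inside zeta fZ chart_field_smooth chart_field_outside z s xr.
  have gr' : `|g s (z, x) - y0| < rho' by exact: le_lt_trans gr lt_rho.
  set y := g s (z, x) in gr gr' *.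
  have cy := ball_img gr'.
  have dW i j : differentiable (fun y => W y i j) y.
    exact: Ck_diff (chart_form_smooth somega 1 i j ac) cy.
  have D := is_derive_form dW (gflow_tangent zeta fZ chart_field_smooth chart_field_outside z x u s)
    (gflow_tangent zeta fZ chart_field_smooth chart_field_outside z x v s)
    (gflow_derive zeta fZ chart_field_smooth chart_field_outside z x s).
  apply: is_derive_congr D _.
  pose N := [set y : E | `|y - y0| < rho'].
  have oN : open N.
    rewrite openE => q qr.
    have C : (fun y : E => `|y - y0|) @ q --> `|q - y0| by exact: dist_continuous.
    exact: (cvgr_lt _ C _ qr).
  set z' := z + s *: zeta.
  have sX : smoothT (fun x => chart_field (z', x)).
    apply: smoothT_comp => //; first exact: chart_field_smooth.
    by apply: smoothT_pair; [exact: smoothT_cst|exact: smoothT_id].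
  have sHz : smoothT (fun x : E => H (z', x)).
    by apply: smoothT_comp => //; apply: smoothT_pair; [exact: smoothT_cst|exact: smoothT_id].
  apply: (@lie_derivative_hamiltonian R n W (fun x => chart_field (z', x)) (fun x => H (z', x)) y _ _ N) => //.
  - exact: Ck_sub (sHz 2%N).
  - exact: smoothT_diff.
  - by move=> q a b _; exact: chart_form_anti.
  - by move=> q a qr; exact: chart_field_hamiltonian.
  - by move=> a b d; exact: chart_form_closed.
have := is_derive_0_is_cst t 0 dF; rewrite /F => ->.
by rewrite !gflow_tangent0 gflow0.
Qed.

Definition chart_flow (t : R) (z : Z) (p : M) : M :=
  if pselect (cdom c p) then cinv c (g t (z, c p)) else p.

Definition chart_ham (z : Z) (p : M) : R :=
  if pselect (cdom c p) then H (z, c p) else 0.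

Lemma gflow_img t z x : cimg c x -> cimg c (g t (z, x)).
Proof.
move=> cx; have [xr|xr] := leP `|x - y0| rho; last by rewrite gflow_outside.
by apply: ball_img; apply: le_lt_trans lt_rho; exact: gflow_inside.
Qed.

Lemma chart_flowE t z p : cdom c p -> chart_flow t z p = cinv c (g t (z, c p)).
Proof. by rewrite /chart_flow; case: pselect. Qed.

Lemma chart_flow_out t z p : ~ cdom c p -> chart_flow t z p = p.
Proof. by rewrite /chart_flow; case: pselect. Qed.

Lemma chart_flow_dom t z p : cdom c p -> cdom c (chart_flow t z p).
Proof. by move=> dp; rewrite chart_flowE//; apply: (chart_cinv_dom ac); apply: gflow_img; exact: chart_img. Qed.

Lemma chart_flow_chart t z p : cdom c p -> c (chart_flow t z p) = g t (z, c p).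
Proof. by move=> dp; rewrite chart_flowE// (chart_cinvK ac)//; apply: gflow_img; exact: chart_img. Qed.

(** The image of the closed ball under [cinv c] is compact, hence closed as M is Hausdorff, and a
    point outside the domain has a neighbourhood missing it. This makes the extensions by the
    identity and by 0 smooth across the boundary of the domain. *)
Lemma near_outside p : ~ cdom c p -> \forall q \near p, cdom c q -> rho < `|c q - y0|.
Proof.
move=> ndp; pose K := cinv c @` [set x : E | `|x - y0| <= rho].
have cK : closed K.
  apply: (compact_closed hM); apply: continuous_compact; last exact: ball_compact.
  apply/subspace_continuousP => x xr.
  have cx : cimg c x by apply: ball_img; exact: le_lt_trans xr lt_rho.
  apply: cvg_trans (chart_cinv_cts ac cx); exact: cvg_app (cvg_within _).
have : nbhs p (~` K).
  apply: open_nbhs_nbhs; split; first exact: closed_openC.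
  move=> [x xr xp]; apply: ndp; rewrite -xp; apply: (chart_cinv_dom ac).
  by apply: ball_img; exact: le_lt_trans xr lt_rho.
apply: filterS => q nKq dq; rewrite ltNge; apply/negP => qr; apply: nKq.
by exists (c q) => //; exact: chart_cmapK ac dq.
Qed.

Lemma chart_flow_near_out p : ~ cdom c p -> \forall q \near p, forall t z, chart_flow t z q = q.
Proof.
move=> ndp; apply: filterS (near_outside ndp) => q qr t z.
have [dq|ndq] := pselect (cdom c q); last exact: chart_flow_out.
by rewrite chart_flowE// gflow_outside ?(chart_cmapK ac)//; exact: qr.
Qed.

Lemma chart_ham_near_out p : ~ cdom c p -> \forall q \near p, forall z, chart_ham z q = 0.
Proof.
move=> ndp; apply: filterS (near_outside ndp) => q qr z.
by rewrite /chart_ham; case: pselect => // dq; rewrite H0// ltW// qr.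
Qed.

Lemma chart_flow0 z p : chart_flow 0 z p = p.
Proof.
have [dp|ndp] := pselect (cdom c p); last exact: chart_flow_out.
by rewrite chart_flowE// gflow0 (chart_cmapK ac).
Qed.

Lemma chart_flowK t z p : chart_flow (- t) (z + t *: zeta) (chart_flow t z p) = p.
Proof.
have [dp|ndp] := pselect (cdom c p); last by rewrite !chart_flow_out.
rewrite chart_flowE; last exact: chart_flow_dom.
by rewrite chart_flow_chart// gflowK (chart_cmapK ac).
Qed.

Lemma chart_flowKV t z p : chart_flow t z (chart_flow (- t) (z + t *: zeta) p) = p.
Proof.
have := chart_flowK (- t) (z + t *: zeta) p.
by rewrite opprK scaleNr addrK.
Qed.

Lemma chart_flow_family_at (T : set R) t (zz : R -> Z) t0 p0 : T t0 -> smooth_at T zz t0 ->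
  family_smooth_at S T (fun s => chart_flow t (zz s)) t0 p0.
Proof.
move=> Tt0 szz.
have [dp|ndp] := pselect (cdom c p0); last first.
  apply: (family_smooth_at_near (F := fun _ => id)) => //; last exact: family_smooth_at_id.
  have N : \forall z \near ((t0, p0) : R * M), forall t z', chart_flow t z' z.2 = z.2.
    exact: near_snd (chart_flow_near_out ndp).
  by apply: filterS N => z h _; rewrite h.
pose A := [set z : R * E | T z.1 /\ cimg c z.2].
have fRE : findim (R * E)%type by exact: findim_prod findim_real fE.
have At : A (t0, c p0) by split=> //; exact: chart_img.
have sm : smooth_at A (fun z => g t (zz z.1, z.2)) (t0, c p0).
  apply: (@smooth_at_compT R _ _ _ A (g t) (fun z => (zz z.1, z.2))) => //; first exact: gflow_smooth.
  apply: smooth_at_pair; last by apply: smoothT_at; apply: smoothT_snd; exact: smoothT_id.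
  apply: (smooth_at_comp (B := T) (g := zz) (f := fst)) => //.
  - exact: findim_real.
  - by apply: filterE => z [].
  - by apply: smoothT_at; apply: smoothT_fst; exact: smoothT_id.
apply: (family_smooth_atI (c := c) (c' := c)) => //.
- exact: chart_flow_dom.
- have N : \forall z \near ((t0, p0) : R * M), cdom c z.2 by exact: near_snd (chart_open_dom ac dp).
  by apply: filterS N => z dz _; exact: chart_flow_dom.
- apply: smooth_at_germ sm; apply: filterE => -[s x] [/= Ts cx]; split=> //.
  have dx := chart_cinv_dom ac cx.
  by rewrite chart_flow_chart// (chart_cinvK ac).
Qed.

Lemma chart_flow_family (T : set R) t (zz : R -> Z) : (forall s, T s -> smooth_at T zz s) ->
  smooth_family S T (fun s => chart_flow t (zz s)).
Proof. by move=> szz; apply/smooth_familyP => s p Ts; apply: chart_flow_family_at => //; exact: szz. Qed.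

Lemma chart_flow_smooth t z : smooth_map S (chart_flow t z).
Proof.
apply: (@smooth_family_map R n M S setT (fun _ => chart_flow t z) 0) => //.
by apply: chart_flow_family => s _; by apply: smoothT_at; exact: smoothT_cst.
Qed.

Lemma chart_flow_diffeo t z : diffeomorphism S (chart_flow t z).
Proof.
exists (chart_flow (- t) (z + t *: zeta)); split.
- by move=> p; exact: chart_flowK.
- by move=> p; exact: chart_flowKV.
- exact: chart_flow_smooth.
- exact: chart_flow_smooth.
Qed.

Lemma chart_flow_tangent t z p v : cdom c p ->
  tangent_map S (chart_flow t z) p (tangent_param S c (c p) v) =
  tangent_param S c (c (chart_flow t z p)) ('d (fun x => g t (z, x)) (c p) v).
Proof.
move=> dp.
have dg : differentiable (fun x => g t (z, x)) (c p).
  apply: smoothT_diff; apply: (smoothT_comp fZE (gflow_smooth zeta fZ chart_field_smooth chart_field_outside t)).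
  by apply: smoothT_pair; [exact: smoothT_cst|exact: smoothT_id].
apply: (tangent_map_chart (g := fun x => g t (z, x))) => //; first exact: chart_flow_dom.
apply: filterS (chart_open_img ac (chart_img dp)) => x cx; split=> //; last exact: gflow_img.
have dx := chart_cinv_dom ac cx.
by rewrite chart_flowE// (chart_cinvK ac).
Qed.

Lemma chart_flow_symplectic t z : symplectic_map S omega (chart_flow t z).
Proof.
move=> p u v; have [dp|ndp] := pselect (cdom c p); last first.
  have e : chart_flow t z p = p by exact: chart_flow_out.
  have T w : tangent_map S (chart_flow t z) p w = w.
    by apply: tangent_map_near_id; apply: filterS (chart_flow_near_out ndp) => q; exact.
  by rewrite !T e.
rewrite -(tangent_paramK u ac dp) -(tangent_paramK v ac dp) !chart_flow_tangent//.
have dq := chart_flow_dom t z dp; have e := chart_flow_chart t z dp.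
rewrite (form2_chart _ _ _ ac dq) (form2_chart _ _ _ ac dp) e.
have [xr|xr] := leP `|c p - y0| rho; first exact: gflow_symplectic.
have T w : 'd (fun x => g t (z, x)) (c p) w = w.
  by apply: near_id_diff; apply: filterS (outside_open xr) => x h; rewrite gflow_outside.
by rewrite !T gflow_outside.
Qed.

Lemma chart_hamE z p : cdom c p -> chart_ham z p = H (z, c p).
Proof. by rewrite /chart_ham; case: pselect. Qed.

Lemma chart_ham_dom z : forall x, cimg c x -> chart_ham z (cinv c x) = H (z, x).
Proof.
move=> x cx; have dx := chart_cinv_dom ac cx.
by rewrite chart_hamE// (chart_cinvK ac).
Qed.

Lemma dfun_chart z p v : cdom c p ->
  dfun S (chart_ham z) p v = 'D_(tangent_chart S c p v) (fun x => H (z, x)) (c p).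
Proof.
move=> dp; have ap := chart_at_atlas S p; have dp' := chart_at_dom S p.
have sHz : smoothT (fun x : E => H (z, x)).
  by apply: smoothT_comp => //; apply: smoothT_pair; [exact: smoothT_cst|exact: smoothT_id].
have D1 : differentiable (c \o cinv (chart_at S p)) (chart_at S p p).
  by apply: (transition_diff ap ac (chart_img dp')); rewrite (chart_cmapK ap).
have D2 : differentiable (fun x => H (z, x)) (c p) by exact: smoothT_diff.
have e1 : (c \o cinv (chart_at S p)) (chart_at S p p) = c p by rewrite /= (chart_cmapK ap).
have N : \forall x \near chart_at S p p, (chart_ham z \o cinv (chart_at S p)) x =
   (fun x => H (z, x)) ((c \o cinv (chart_at S p)) x).
  have K1 := near_cinv_dom ap ac (chart_img dp').
  rewrite (chart_cmapK ap dp') in K1; have {}K1 := K1 dp.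
  apply: filterS K1 => x [cx dx] /=.
  by rewrite -(chart_cmapK ac dx) chart_ham_dom ?(chart_cmapK ac)//; exact: chart_img.
have [_ E1] := diff_comp_near v e1 D1 D2 N.
by rewrite (deriveE _ D2); exact: E1.
Qed.

Lemma dfun_out z p v : ~ cdom c p -> dfun S (chart_ham z) p v = 0.
Proof.
move=> ndp; have ap := chart_at_atlas S p; have dp := chart_at_dom S p.
have C : cinv (chart_at S p) @ (chart_at S p p) --> p.
  by rewrite -[X in _ --> X](chart_cmapK ap dp); exact: (chart_cinv_cts ap (chart_img dp)).
have N1 : \forall x \near chart_at S p p, forall z, chart_ham z (cinv (chart_at S p) x) = 0 := C _ (chart_ham_near_out ndp).
have N : \forall x \near chart_at S p p, cst 0 x = (chart_ham z \o cinv (chart_at S p)) x.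
  by apply: filterS N1 => x h /=; rewrite h.
have [_ E1] := near_eq_diff N (differentiable_cst (0 : R) _).
by apply: etrans (congr1 (fun h : E -> R => h v) E1) _; rewrite diff_cst.
Qed.

Lemma chart_ham_smooth z : smooth_hamiltonian S (fun t => chart_ham (z + t *: zeta)).
Proof.
move=> c1 a1 [t x] /= cx.
have [dp|ndp] := pselect (cdom c (cinv c1 x)).
  apply: (smooth_at_germ (A := setT) (f := fun q : R * E => H (z + q.1 *: zeta, c (cinv c1 q.2)))).
    have N : \forall q \near ((t, x) : R * E), cimg c1 q.2 /\ cdom c (cinv c1 q.2).
      exact: near_snd (near_cinv_dom a1 ac cx dp).
    apply: filterS N => -[s y] /= [cy dy] _; split=> //.
    by rewrite /chart_ham; case: pselect.
  apply: (@smooth_at_compT R _ _ _ setT H (fun q : R * E => (z + q.1 *: zeta, c (cinv c1 q.2)))) => //.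
  apply: smooth_at_pair.
    apply: smoothT_at; apply: smoothTD; first exact: smoothT_cst.
    by apply: smoothTZ; [apply: smoothT_fst; exact: smoothT_id|exact: smoothT_cst].
  apply: (smooth_at_comp (B := setT) (g := fun y => c (cinv c1 y)) (f := snd)) => //.
  - exact: filterE.
  - by apply: smoothT_at; apply: smoothT_snd; exact: smoothT_id.
  - exact: (@transition_smooth R n M S setT c1 c x a1 ac cx dp).
apply: (smooth_at_germ (A := setT) (f := fun _ => 0)); last by apply: smoothT_at; exact: smoothT_cst.
have N1 : \forall y \near x, forall z, chart_ham z (cinv c1 y) = 0 :=
  chart_cinv_cts a1 cx (chart_ham_near_out ndp).
have N : \forall q \near ((t, x) : R * E), forall z, chart_ham z (cinv c1 q.2) = 0.
  exact: near_snd N1.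
by apply: filterS N => q h _; rewrite h.
Qed.

Definition ham_field (h : M -> R) (p : M) : E :=
  - ((\row_i dfun S h p (delta_mx 0 i)) *m invmx (omega p)).

Lemma ham_fieldE h p v : form2 omega p (ham_field h p) v = - dfun S h p v.
Proof.
rewrite /form2 /ham_field mulNmx mulmxKV; last exact: omega_unit somega p.
rewrite mulNmx mxE; congr (- _); rewrite mxE /dfun [in RHS](row_sum_delta v) linear_sum.
by apply: eq_bigr => i _; rewrite linearZ !mxE mulrC.
Qed.

Lemma form2_inj p u v : (forall w, form2 omega p u w = form2 omega p v w) -> u = v.
Proof.
move=> e; apply/eqP; rewrite -subr_eq0; apply/eqP; apply: (sform_nondegenerate somega (p := p)) => w.
have := e w; rewrite /form2 !mulmxBl !mxE => ->; by rewrite subrr.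
Qed.

(** The chart field carried to M and [ham_field] have the same pairing with every vector, hence
    coincide by nondegeneracy; off the chart domain both the velocity and the field are 0. *)
Lemma chart_flow_is_flow z :
  is_flow S (fun t => ham_field (chart_ham (z + t *: zeta))) (fun t => chart_flow t z).
Proof.
split; first by apply/funext => p; exact: chart_flow0.
move=> p; have [dp|ndp] := pselect (cdom c p); last first.
  have e t : chart_flow t z p = p by exact: chart_flow_out.
  have ec : (fun t => chart_flow t z p) = (fun=> p) by apply/funext.
  split; first by rewrite ec; exact: cst_continuous.
  move=> t; have -> : (fun s => chart_at S (chart_flow t z p) (chart_flow s z p)) = fun=> chart_at S p p.
    by apply/funext => s; rewrite !e.
  rewrite e.
  have -> : ham_field (chart_ham (z + t *: zeta)) p = 0.
    by apply: (@form2_inj p) => w; rewrite ham_fieldE dfun_out// oppr0 /form2 !mul0mx mxE.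
  exact: is_derive_cst.
have dg t := gflow_derive zeta fZ chart_field_smooth chart_field_outside z (c p) t.
have cg t : cimg c (g t (z, c p)) by apply: gflow_img; exact: chart_img.
have e t : chart_flow t z p = cinv c (g t (z, c p)) by exact: chart_flowE.
split.
  have -> : (fun t => chart_flow t z p) = (cinv c \o fun t => g t (z, c p)) by apply/funext.
  move=> t; apply: (@continuous_comp _ _ _ (fun t => g t (z, c p)) (cinv c)).
    exact: is_derive_cts (dg t).
  exact: chart_cinv_cts ac (cg t).
move=> t; set q := chart_flow t z p; set y := g t (z, c p).
have dq : cdom c q by exact: chart_flow_dom.
have cq : c q = y by exact: chart_flow_chart.
have qE : q = cinv c y by exact: chart_flowE.
have D : differentiable (chart_at S q \o cinv c) y.
  apply: (transition_diff ac (chart_at_atlas S q) (cg t)).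
  by rewrite -qE; exact: chart_at_dom.
have -> : (fun s => chart_at S q (chart_flow s z p)) = (chart_at S q \o cinv c) \o (fun s => g s (z, c p)).
  by apply/funext => s; rewrite /= e.
apply: is_derive_congr (is_derive_chain (dg t) D) _.
set X := chart_field _.
have -> : 'd (chart_at S q \o cinv c) y X = tangent_param S c (c q) X.
  by rewrite /tangent_param cq -qE.
apply: (@form2_inj q) => w; rewrite -(tangent_paramK w ac dq) form2_chart// ham_fieldE dfun_chart// tangent_chartK// cq.
have [yr|yr] := ltP `|y - y0| rho'; first exact: chart_field_hamiltonian.
have yr' : rho < `|y - y0| by exact: lt_le_trans yr.
rewrite /X chart_field_outside// hamiltonian_partial grad_outside//.
by rewrite /wform !mul0mx !mxE oppr0.
Qed.

Lemma chart_flow_hamiltonian z : hamiltonian_diffeomorphism S omega (chart_flow 1 z).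
Proof.
exists (fun t => chart_ham (z + t *: zeta)), (fun t => ham_field (chart_ham (z + t *: zeta))),
  (fun t => chart_flow t z); split => //.
- exact: chart_ham_smooth.
- by move=> t p v; exact: ham_fieldE.
- exact: chart_flow_is_flow.
Qed.

(** The isotopy time is the argument of zz, the flow itself always running for time 1. The
    alternative covers times near which zz may be a default value and jump, while the map is the
    identity. *)
Lemma chart_flow_isotopy (zz : R -> Z) :
  (forall t, `[0, 1]%classic t -> smooth_at (`[0, 1]%classic : set R) zz t \/
    \forall s \near t, `[0, 1]%classic s -> chart_flow 1 (zz s) = id) ->
  chart_flow 1 (zz 0) = id ->
  symplectic_isotopy S omega (fun t => chart_flow 1 (zz t)).
Proof.
move=> szz z0; split=> // [|t _|t _]; [|exact: chart_flow_diffeo|exact: chart_flow_symplectic].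
apply/smooth_familyP => t p Tt; have [sz|N] := szz t Tt; first exact: chart_flow_family_at.
apply: (family_smooth_at_near (F := fun _ => id)) => //; last exact: family_smooth_at_id.
have N1 : \forall q \near ((t, p) : R * M), `[0, 1]%classic q.1 -> chart_flow 1 (zz q.1) = id.
  exact: (@near_fst _ _ t p (fun s => `[0, 1]%classic s -> chart_flow 1 (zz s) = id) N).
by apply: filterS N1 => q h Tq; rewrite h.
Qed.

End ChartHamiltonian.

(** * Composition of Hamiltonian diffeomorphisms *)

Section HamiltonianComposition.
Context {R : realType} {n : nat} {M : topologicalType}.
Local Notation E := 'rV[R]_n.
Variables (S : smooth_structure R n M) (omega : M -> 'M[R]_n).
Implicit Types (t : R) (p : M).

Lemma symplectic_map_comp (f g : M -> M) : smooth_map S f -> smooth_map S g ->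
  symplectic_map S omega f -> symplectic_map S omega g -> symplectic_map S omega (f \o g).
Proof. by move=> sf sg wf wg p u v; rewrite (tangent_map_comp p u sf sg) (tangent_map_comp p v sf sg); exact: etrans (wf _ _ _) (wg _ _ _). Qed.

Lemma symplectic_isotopy_comp (F G : R -> M -> M) :
  symplectic_isotopy S omega F -> symplectic_isotopy S omega G ->
  symplectic_isotopy S omega (fun t p => F t (G t p)).
Proof.
move=> [sF dF wF F0] [sG dG wG G0]; split.
- exact: smooth_family_comp.
- by move=> t ht; apply: diffeomorphism_comp; [exact: dF|exact: dG].
- move=> t ht; have t01 : `[0, 1]%classic t by rewrite /= in_itv.
  apply: symplectic_map_comp; [exact: (smooth_family_map t01 sF)|exact: (smooth_family_map t01 sG)|exact: wF|exact: wG].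
- by rewrite F0 G0.
Qed.

Lemma smooth_hamiltonian_at (H : R -> M -> R) c t x : smooth_hamiltonian S H -> atlas S c ->
  cimg c x -> smooth_at setT (fun z : R * E => H z.1 (cinv c z.2)) (t, x).
Proof.
move=> sH ac cx; have := sH c ac (t, x) cx.
apply: smooth_at_germ.
have N : \forall z \near ((t, x) : R * E), cimg c z.2 by exact: near_snd (chart_open_img ac cx).
by apply: filterS N => z.
Qed.

Lemma smooth_hamiltonian_diff (H : R -> M -> R) t p : smooth_hamiltonian S H ->
  differentiable (H t \o cinv (chart_at S p)) (chart_at S p p).
Proof.
move=> sH; have ap := chart_at_atlas S p; have cp := chart_img (chart_at_dom S p).
apply: (smooth_at_diff (A := setT)); first exact: filterT.
apply: (smooth_at_comp (B := setT) (g := fun z : R * E => H z.1 (cinv (chart_at S p) z.2)) (f := fun x => (t, x))).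
- exact: findim_prod findim_real (findim_rV _).
- exact: I.
- exact: filterE.
- by apply: smoothT_at; apply: smoothT_pair; [exact: smoothT_cst|exact: smoothT_id].
- exact: smooth_hamiltonian_at.
Qed.

(* Running the first Hamiltonian during [0, 1/3] and the second during [2/3, 1]
   keeps the concatenated Hamiltonian smooth. *)
Lemma hamiltonian_comp (f g : M -> M) :
  hamiltonian_diffeomorphism S omega f -> hamiltonian_diffeomorphism S omega g ->
  hamiltonian_diffeomorphism S omega (f \o g).
Proof.
move=> [H2 [X2 [h2 [sH2 vX2 [h20 fl2] ->]]]] [H1 [X1 [h1 [sH1 vX1 [h10 fl1] ->]]]].
pose a := step_between (0 : R) (1 / 3); pose b := step_between (2 / 3 : R) 1.
have sa : smoothT a by exact: step_between_smooth.
have sb : smoothT b by exact: step_between_smooth.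
pose a' := 'D_1 a; pose b' := 'D_1 b.
have sa' : smoothT a' by exact: smoothT_D.
have sb' : smoothT b' by exact: smoothT_D.
have lt1 : (0 : R) < 1 / 3 by lra.
have lt2 : (2 / 3 : R) < 1 by lra.
have da t : is_derive t 1 a (a' t).
  by apply/is_deriveP; split; [exact: smoothT_diff|rewrite /a' deriveE//; exact: smoothT_diff].
have db t : is_derive t 1 b (b' t).
  by apply/is_deriveP; split; [exact: smoothT_diff|rewrite /b' deriveE//; exact: smoothT_diff].
exists (fun t p => a' t * H1 (a t) p + b' t * H2 (b t) p),
  (fun t p => a' t *: X1 (a t) p + b' t *: X2 (b t) p), (fun t p => h2 (b t) (h1 (a t) p)).
have sm (u u' : R -> R) (H : R -> M -> R) c t x : smoothT u -> smoothT u' ->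
    smooth_hamiltonian S H -> atlas S c -> cimg c x ->
    smooth_at setT (fun z : R * E => u' z.1 * H (u z.1) (cinv c z.2)) (t, x).
  move=> su su' sH ac cx.
  have fRE : findim (R * E)%type by exact: findim_prod findim_real (findim_rV _).
  apply: (@smooth_at_compT R _ _ _ setT (fun q : R * R => q.1 * q.2)
    (fun z : R * E => (u' z.1, H (u z.1) (cinv c z.2)))) => //.
  - exact: findim_prod findim_real findim_real.
  - by apply: smoothTM; [apply: smoothT_fst|apply: smoothT_snd]; exact: smoothT_id.
  - apply: smooth_at_pair.
      by apply: smoothT_at; apply: (smoothT_comp findim_real su'); apply: smoothT_fst; exact: smoothT_id.
    apply: (smooth_at_comp (B := setT) (g := fun z : R * E => H z.1 (cinv c z.2)) (f := fun z => (u z.1, z.2))) => //.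
    + exact: filterE.
    + apply: smoothT_at; apply: smoothT_pair; last by apply: smoothT_snd; exact: smoothT_id.
      by apply: (smoothT_comp findim_real su); apply: smoothT_fst; exact: smoothT_id.
    + exact: smooth_hamiltonian_at.
split.
- move=> c ac [t x] /= cx.
  have fRE : findim (R * E)%type by exact: findim_prod findim_real (findim_rV _).
  apply: (smooth_at_germ (A := setT) (f := fun z : R * E => a' z.1 * H1 (a z.1) (cinv c z.2) + b' z.1 * H2 (b z.1) (cinv c z.2))).
    by apply: filterE.
  apply: (@smooth_at_compT R _ _ _ setT (fun q : R * R => q.1 + q.2)
    (fun z : R * E => (a' z.1 * H1 (a z.1) (cinv c z.2), b' z.1 * H2 (b z.1) (cinv c z.2)))) => //.
  + exact: findim_prod findim_real findim_real.
  + by apply: smoothTD; [apply: smoothT_fst|apply: smoothT_snd]; exact: smoothT_id.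
  + by apply: smooth_at_pair; exact: sm.
- move=> t p v.
  have D1 := smooth_hamiltonian_diff (a t) p sH1; have D2 := smooth_hamiltonian_diff (b t) p sH2.
  have -> : form2 omega p (a' t *: X1 (a t) p + b' t *: X2 (b t) p) v =
      a' t * form2 omega p (X1 (a t) p) v + b' t * form2 omega p (X2 (b t) p) v.
    by rewrite /form2 !mulmxDl -!scalemxAl !mxE.
  rewrite vX1 vX2 /dfun.
  have -> : (fun p => a' t * H1 (a t) p + b' t * H2 (b t) p) \o cinv (chart_at S p) =
    a' t *: (H1 (a t) \o cinv (chart_at S p)) + b' t *: (H2 (b t) \o cinv (chart_at S p)) by [].
  rewrite diffD; [|exact: differentiableZ|exact: differentiableZ].
  rewrite !diffZ//= !mulrN opprD; congr (- _ - _).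
- split.
    by apply/funext => p; rewrite /a /b !step_between0// ?h10 ?h20//; lra.
  move=> p.
  (* The half-lines t < 2/3 and t > 1/3 cover R. On the first the second flow has not started, on
     the other the first has ended, so near each time only one of them moves. *)
  have loc1 t : t < 2 / 3 -> \forall s \near t, h1 (a s) p = h2 (b s) (h1 (a s) p) /\ b s = 0.
    move=> lt; have N : \forall s \near t, s < 2 / 3 by exact: lt_nbhsl.
    apply: filterS N => s ls.
    have e : b s = 0 by apply: step_between0 lt2 _; exact: ltW.
    by rewrite e h20.
  have loc2 t : 1 / 3 < t -> \forall s \near t, h2 (b s) (h1 1 p) = h2 (b s) (h1 (a s) p) /\ a s = 1.
    move=> lt; have N : \forall s \near t, 1 / 3 < s by exact: lt_nbhsr.
    apply: filterS N => s ls.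
    have e : a s = 1 by apply: step_between1 lt1 _; exact: ltW.
    by rewrite e.
  have der0 (u u' : R -> R) t k : is_derive t 1 u (u' t) -> (\forall s \near t, u s = k) -> u' t = 0.
    move=> du N; have d0 : is_derive t 1 u (0 : R).
      have d1 : is_derive t 1 (fun _ : R => k) (0 : R) by exact: is_derive_cst.
      by apply: is_derive_near d1; apply: filterS N.
    by case: du => _ <-; case: d0.
  split.
    move=> t; have [lt|lt] := ltP t (2 / 3).
      have N := loc1 t lt.
      have [e _] := nbhs_singleton N; rewrite /continuous_at -e.
      have C : (fun s => h1 (a s) p) @ t --> h1 (a t) p.
        apply: (@continuous_comp _ _ _ a (fun s => h1 s p)); first exact: smoothT_cts.
        exact: (fl1 p).1.
      apply: cvg_trans C; apply: near_eq_cvg.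
      by apply: filterS N => s [].
    have lt' : 1 / 3 < t by apply: lt_le_trans lt; lra.
    have N := loc2 t lt'; have [e _] := nbhs_singleton N; rewrite /continuous_at -e.
    have C : (fun s => h2 (b s) (h1 1 p)) @ t --> h2 (b t) (h1 1 p).
      apply: (@continuous_comp _ _ _ b (fun s => h2 s (h1 1 p))); first exact: smoothT_cts.
      exact: (fl2 _).1.
    apply: cvg_trans C; apply: near_eq_cvg.
    by apply: filterS N => s [].
  move=> t; have [lt|lt] := ltP t (2 / 3).
    have N := loc1 t lt; have [_ b0] := nbhs_singleton N; rewrite b0 h20 /=.
    have -> : b' t = 0 by apply: (der0 b b' t 0) => //; apply: filterS N => s [].
    rewrite scale0r addr0.
    apply: (is_derive_near (u := fun s => chart_at S (h1 (a t) p) (h1 (a s) p))).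
      by apply: filterS N => s [<- _].
    exact: (is_derive_comp_real (u := fun s => chart_at S (h1 (a t) p) (h1 s p)) (da t) ((fl1 p).2 (a t))).
  have lt' : 1 / 3 < t by apply: lt_le_trans lt; lra.
  have N := loc2 t lt'; have [_ a1] := nbhs_singleton N; rewrite a1 /=.
  have -> : a' t = 0 by apply: (der0 a a' t 1) => //; apply: filterS N => s [].
  rewrite scale0r add0r.
  apply: (is_derive_near (u := fun s => chart_at S (h2 (b t) (h1 1 p)) (h2 (b s) (h1 1 p)))).
    by apply: filterS N => s [<- _].
  exact: (is_derive_comp_real (u := fun s => chart_at S (h2 (b t) (h1 1 p)) (h2 s (h1 1 p))) (db t) ((fl2 _).2 (b t))).
- by apply/funext => p; rewrite /a /b /= !step_between1//; lra.
Qed.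

Lemma hamiltonian_id : hamiltonian_diffeomorphism S omega id.
Proof.
exists (fun _ _ => 0), (fun _ _ => 0), (fun _ => id); split => //.
- by move=> c ac z _; apply: smoothT_at; exact: smoothT_cst.
- move=> t p v; rewrite /dfun /form2 !mul0mx mxE.
  have -> : (fun=> 0) \o cinv (chart_at S p) = cst (0 : R) by [].
  by rewrite diff_cst oppr0.
- split=> // p; split; first exact: cst_continuous.
  by move=> t; exact: is_derive_cst.
Qed.

End HamiltonianComposition.

(** * Moving points in a chart *)

Section Cutoff.
Context {R : realType} {n : nat}.
Local Notation E := 'rV[R]_n.

Lemma ball_open_norm (y0 : E) r : open [set y : E | `|y - y0| < r].
Proof.
rewrite openE => q qr.
have C : (fun y : E => `|y - y0|) @ q --> `|q - y0| by exact: dist_continuous.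
exact: (cvgr_lt _ C _ qr).
Qed.

Lemma bump_mul_smooth (y0 : E) r1 r2 r3 (f : E -> R) : r1 < r2 -> 0 < r2 -> r2 < r3 ->
  (forall k, Ck_on k [set y | `|y - y0| < r3] f) -> smoothT (fun y => bump_rV y0 r1 r2 y * f y).
Proof.
move=> r12 r20 r23 sf; apply: smoothT_local => y.
have [yr|yr] := ltP `|y - y0| r3.
  apply: (@Ck_smooth_at R _ _ setT [set y : E | `|y - y0| < r3]) => //; first exact: ball_open_norm.
  move=> k; apply: CkM => //; first exact: ball_open_norm.
  by apply: Ck_sub (bump_rV_smooth y0 r1 r2 k).
apply: (smooth_at_germ (A := setT) (f := fun _ => 0)); last by apply: smoothT_at; exact: smoothT_cst.
have N := outside_open (lt_le_trans r23 yr).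
by apply: filterS N => x xr _; split=> //; rewrite bump_rV0 ?mul0r// ltW.
Qed.

End Cutoff.

Section Mover.
Context {R : realType} {n : nat} {M : topologicalType}.
Local Notation E := 'rV[R]_n.
Variables (S : smooth_structure R n M) (omega : M -> 'M[R]_n).
Hypotheses (somega : symplectic_form S omega) (hM : hausdorff_space M).
Variables (c : chart R n M) (y0 : E) (r1 r2 r3 : R).
Hypotheses (ac : atlas S c) (r12 : r1 < r2) (r20 : 0 < r2) (r23 : r2 < r3).
Hypothesis ball_img : forall x, `|x - y0| < r3 -> cimg c x.
Local Notation W := (chart_form S omega c).
Local Notation Z := (E * E * R)%type.

Let fE : findim E := findim_rV n.
Let fZ : findim Z := findim_prod (findim_prod fE fE) findim_real.
Let fZE : findim (Z * E)%type := findim_prod fZ fE.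
Let B := bump_rV y0 r1 r2.

(* In the ball of radius r1 the Hamiltonian of the parameters (a, w, s) is the
   linear function [x |-> - omega (w, x)], omega being taken at a + s w, so that
   its Hamiltonian vector field equals w at the point a + s w. *)
Definition mover_ham (q : Z * E) : R :=
  - (B q.2 * \sum_i \sum_j q.1.1.2 0 i * (B (q.1.1.1 + q.1.2 *: q.1.1.2) * W (q.1.1.1 + q.1.2 *: q.1.1.2) i j) * q.2 0 j).

(** W is smooth in the chart only; the bump factor at the point a + s w makes its coefficients
    smooth in all parameters, and equals 1 when that point is in the ball of radius r1. *)
Lemma mover_ham_smooth : smoothT mover_ham.
Proof.
have s1 : smoothT (fun q : Z * E => q.1.1.1) by do 3!apply: smoothT_fst; exact: smoothT_id.
have s2 : smoothT (fun q : Z * E => q.1.1.2) by apply: smoothT_snd; do 2!apply: smoothT_fst; exact: smoothT_id.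
have s3 : smoothT (fun q : Z * E => q.1.2) by apply: smoothT_snd; apply: smoothT_fst; exact: smoothT_id.
have s4 : smoothT (fun q : Z * E => q.2) by apply: smoothT_snd; exact: smoothT_id.
have s5 : smoothT (fun q : Z * E => q.1.1.1 + q.1.2 *: q.1.1.2) by apply: smoothTD => //; exact: smoothTZ.
apply: smoothTN; apply: smoothTM.
  by apply: (smoothT_comp (g := B) fE _ s4); exact: bump_rV_smooth.
apply: smoothT_sum => i; apply: smoothT_sum => j; apply: smoothTM.
  apply: smoothTM; first by apply: (smoothT_comp (g := fun x : E => x 0 i) fE _ s2); exact: smoothT_coord.
  apply: (smoothT_comp (g := fun y => B y * W y i j) fE _ s5).
  apply: (@bump_mul_smooth R n y0 r1 r2 r3 (fun y => W y i j)) => // k.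
  by apply: Ck_sub (chart_form_smooth somega k i j ac) => x; exact: ball_img.
by apply: (smoothT_comp (g := fun x : E => x 0 j) fE _ s4); exact: smoothT_coord.
Qed.

Lemma mover_ham_out z x : r2 <= `|x - y0| -> mover_ham (z, x) = 0.
Proof. by move=> xr; rewrite /mover_ham /B bump_rV0// mul0r oppr0. Qed.

Let zeta : Z := (0, 0, 1).
Local Notation X := (chart_field S omega c y0 r3 mover_ham).
Let sX : smoothT X := chart_field_smooth somega ac r23 ball_img mover_ham_smooth mover_ham_out.
Let X0 := chart_field_outside S omega c r3 mover_ham_out.
Local Notation g := (gflow zeta fZ sX X0).
Definition mover (z : Z) : M -> M := chart_flow somega ac r23 ball_img zeta fZ mover_ham_smooth mover_ham_out 1 z.

Lemma wform_inj x u v : cimg c x -> (forall w, wform W u w x = wform W v w x) -> u = v.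
Proof.
move=> cx e; have uW := chart_form_unit somega ac cx.
have {}e : u *m W x = v *m W x.
  apply/rowP => j; have := e (delta_mx 0 j); rewrite /wform trmx_delta -!colE !mxE; exact.
by rewrite -[u](mulmxK uW) e mulmxK.
Qed.

Lemma mover_field a w s : `|a + s *: w - y0| < r1 -> X ((a, w, s), a + s *: w) = w.
Proof.
set y := a + s *: w => yr; have yr3 : `|y - y0| < r3 by exact: lt_trans yr (lt_trans r12 r23).
have cy : cimg c y by exact: ball_img.
apply: (wform_inj cy) => u; rewrite (chart_field_hamiltonian somega ac ball_img fZ mover_ham_smooth)//.
pose L (x : E) : R := - (\sum_i \sum_j w 0 i * W y i j * x 0 j).
have sl : smoothT L.
  apply: smoothTN; apply: smoothT_sum => i; apply: smoothT_sum => j.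
  by apply: smoothTM; [exact: smoothT_cst|exact: smoothT_coord].
have N : \forall x \near y, L x = mover_ham ((a, w, s), x).
  have N1 : \forall x \near y, `|x - y0| < r1 by apply: open_nbhs_nbhs; split=> //; exact: ball_open_norm.
  apply: filterS N1 => x xr; rewrite /L /mover_ham /= -/y /B !bump_rV1 ?mul1r//; [|exact: ltW..].
  by congr (- _); apply: eq_bigr => i _; apply: eq_bigr => j _; rewrite mul1r.
have [_ e] := near_eq_diff N (smoothT_diff y sl).
rewrite deriveE; last by have [] := near_eq_diff N (smoothT_diff y sl).
rewrite e.
have lin : linear L.
  move=> k x x'; rewrite /L scalerN -opprD; congr (- _).
  rewrite /GRing.scale /= mulr_sumr -big_split; apply: eq_bigr => i _ /=.
  rewrite mulr_sumr -big_split; apply: eq_bigr => j _ /=.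
  by rewrite !mxE; ring.
pose lM := GRing.isLinear.Build _ _ _ _ _ lin.
pose l : {linear E -> R} := HB.pack L lM.
have cl : continuous l by exact: smoothT_cts sl.
have -> : 'd L y u = l u.
  by rewrite -[in RHS](diff_lin y cl).
by rewrite wform_sum /l /= /L opprK.
Qed.

Lemma ball_convex (a w : E) r s : `|a - y0| < r -> `|a + w - y0| < r -> 0 <= s <= 1 ->
  `|a + s *: w - y0| < r.
Proof.
move=> ar awr /andP[s0 s1].
have -> : a + s *: w - y0 = (1 - s) *: (a - y0) + s *: (a + w - y0).
  by apply/rowP => k; rewrite !mxE; ring.
apply: le_lt_trans (ler_normD _ _) _.
rewrite !normrZ (ger0_norm s0) ger0_norm ?subr_ge0//.
have [->|s0'] := eqVneq s 0; first by rewrite subr0 mul1r mul0r addr0.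
have {}s0 : 0 < s by rewrite lt_neqAle eq_sym s0'.
apply: (@lt_le_trans _ _ ((1 - s) * r + s * r)); last by lra.
by apply: ler_ltD; [apply: ler_wpM2l; [rewrite subr_ge0|exact: ltW]|rewrite ltr_pM2l].
Qed.

(** The straight segment from c p to c q is a solution: at time s it passes through the very point
    where [mover_field] computes the field. *)
Lemma mover_moves p q : cdom c p -> cdom c q -> `|c p - y0| < r1 -> `|c q - y0| < r1 ->
  mover ((c p, c q - c p), 0) p = q.
Proof.
move=> dp dq pr qr; rewrite /mover chart_flowE//.
pose u s := c p + s *: (c q - c p).
have e : u 1 = g 1 ((c p, c q - c p, 0), u 0).
  apply: gflow_unique => // s hs.
  have -> : ((c p, c q - c p, 0) : Z) + s *: zeta = (c p, c q - c p, s).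
    by rewrite /zeta; congr (_, _, _) => /=; rewrite ?scaler0 ?addr0// add0r [_ *: _]mulr1.
  rewrite mover_field; last by apply: ball_convex => //; rewrite [c p + _]addrC subrK.
  by rewrite -[X in is_derive _ _ _ X]add0r; apply: is_deriveD; exact: is_derive_scalel.
by move: e; rewrite /u scale1r scale0r addr0 addrC subrK => <-; rewrite (chart_cmapK ac).
Qed.

Lemma mover0 a s p : mover ((a, 0), s) p = p.
Proof.
have [dp|ndp] := pselect (cdom c p); last exact: chart_flow_out.
rewrite /mover chart_flowE//.
have e : c p = g 1 ((a, 0, s), c p).
  apply: (@gflow_unique R n Z X zeta y0 r2 fZ sX X0 (a, 0, s) (fun _ => c p) 1 ler01) => t _.
  have -> : ((a, 0, s) : Z) + t *: zeta = (a, 0, s + t).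
    by rewrite /zeta; congr (_, _, _) => /=; rewrite ?scaler0 ?addr0// [_ *: _]mulr1.
  have -> : X (a, 0, s + t, c p) = 0; last exact: is_derive_cst.
  have [pr|pr] := ltP `|c p - y0| r3; last by apply: X0; exact: lt_le_trans pr.
  apply: (wform_inj (chart_img dp)) => u; rewrite (chart_field_hamiltonian somega ac ball_img fZ mover_ham_smooth)//.
  have -> : (fun x : E => mover_ham ((a, 0, s + t), x)) = cst 0.
    apply/funext => x; rewrite /mover_ham big1 ?mulr0 ?oppr0// => i _.
    by rewrite big1// => j _; rewrite mxE !mul0r.
  by rewrite derive_cst oppr0 /wform !mul0mx mxE.
by rewrite -e (chart_cmapK ac).
Qed.

End Mover.

(** * Moving curves *)

Section MovingCurves.
Context {R : realType} {n : nat} {M : topologicalType}.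
Local Notation E := 'rV[R]_n.
Variables (S : smooth_structure R n M) (omega : M -> 'M[R]_n).
Hypotheses (somega : symplectic_form S omega) (hM : hausdorff_space M).
Implicit Types (t T : R) (a b : R -> M).
Local Notation I01 := [set t : R | 0 <= t <= 1].

Lemma chart_radii c p : atlas S c -> cdom c p -> exists r1 r2 r3 : R,
  [/\ 0 < r1, r1 < r2, 0 < r2, r2 < r3 & forall x : E, `|x - c p| < r3 -> cimg c x].
Proof.
move=> ac dp; have /nbhs_ballP[r /= r0 br] := chart_open_img ac (chart_img dp).
exists (r / 3), (2 * r / 3), r; split; [lra|lra|lra|lra|move=> x xr].
by apply: br; rewrite -ball_normE /ball_ /= distrC.
Qed.

Lemma near_chart_ball c y0 r p : atlas S c -> cdom c p -> `|c p - y0| < r ->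
  \forall q \near p, cdom c q /\ `|c q - y0| < r.
Proof.
move=> ac dp pr; apply: filterI; first exact: (chart_open_dom ac dp).
have N : nbhs (c p) [set y : E | `|y - y0| < r] by apply: open_nbhs_nbhs; split=> //; exact: ball_open_norm.
exact: (chart_cts ac dp N).
Qed.

(** Everything is relative to [0, 1], endpoints included, because an isotopy is controlled for these
    times only. *)
Definition curve01 a := forall t, I01 t ->
  (forall N, nbhs (a t) N -> \forall s \near t, I01 s -> N (a s)) /\
  forall c, atlas S c -> cdom c (a t) -> smooth_at I01 (fun s => c (a s)) t.

Definition moved a b := exists K : R -> M -> M,
  [/\ symplectic_isotopy S omega K,
      forall t, I01 t -> hamiltonian_diffeomorphism S omega (K t)
    & forall t, I01 t -> K t (a t) = b t].

Lemma I01E : `[0, 1]%classic = I01.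
Proof. by apply/seteqP; split=> t /=; rewrite in_itv. Qed.

Lemma smooth_map_id : smooth_map S id.
Proof.
apply: (@smooth_family_map R n M S setT (fun _ => id) 0) => //.
by apply/smooth_familyP => t p Tt; exact: family_smooth_at_id.
Qed.

Lemma symplectic_map_id : symplectic_map S omega id.
Proof.
by move=> p u v; rewrite !tangent_map_near_id//; exact: filterE.
Qed.

Lemma moved_refl a b : (forall t, I01 t -> a t = b t) -> moved a b.
Proof.
move=> ab; exists (fun _ => id); split=> //; last by move=> t _; exact: hamiltonian_id.
split=> // [|t _|t _]; last exact: symplectic_map_id.
  by apply/smooth_familyP => t p Tt; exact: family_smooth_at_id.
by exists id; split=> //; exact: smooth_map_id.
Qed.

Lemma moved_trans a b d : moved a b -> moved b d -> moved a d.
Proof.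
move=> [K [iK hK Kab]] [L [iL hL Lbd]]; exists (fun t p => L t (K t p)); split.
- exact: symplectic_isotopy_comp.
- by move=> t ht; apply: hamiltonian_comp; [exact: hL|exact: hK].
- by move=> t ht; rewrite Kab// Lbd.
Qed.

Lemma curve01_comp a (s : R -> R) : curve01 a -> smoothT s -> (forall t, I01 t -> I01 (s t)) ->
  curve01 (fun t => a (s t)).
Proof.
move=> ca ss s01 t ht; have [cont sm] := ca _ (s01 t ht); split.
  move=> N nN; have N1 : \forall u \near t, I01 (s u) -> N (a (s u)) := smoothT_cts ss (cont N nN).
  apply: filterS N1 => u Nu hu; exact: Nu (s01 u hu).
move=> c ac dc; apply: (smooth_at_comp (B := I01) (g := fun s => c (a s)) (f := s)) => //.
- exact: findim_real.
- by apply: filterE.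
- exact: smoothT_at.
- exact: sm.
Qed.

Section OneChart.
Variables (c : chart R n M) (y0 : E) (r1 r2 r3 : R).
Hypotheses (ac : atlas S c) (r12 : r1 < r2) (r20 : 0 < r2) (r23 : r2 < r3).
Hypothesis ball_img : forall x, `|x - y0| < r3 -> cimg c x.
Let V p := cdom c p /\ `|c p - y0| < r1.
Let mov := mover somega ac r12 r20 r23 ball_img.

Let near_V p : V p -> \forall q \near p, V q.
Proof. by move=> [dp pr]; exact: near_chart_ball. Qed.

(** K t is the mover from a t to b t while both points lie in [V]. Near any other time the curves
    agree; the displacement is then 0, or the parameter is the default 0, and in both cases the
    mover is the identity. Equal origins give K 0 = id. *)
Lemma moved_chart a b : curve01 a -> curve01 b -> a 0 = b 0 ->
  (forall t, I01 t -> (V (a t) /\ V (b t)) \/ \forall s \near t, I01 s -> a s = b s) ->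
  moved a b.
Proof.
move=> ca cb ab0 H.
pose W t := V (a t) /\ V (b t).
pose zz t : E * E * R := if pselect (W t) then (c (a t), c (b t) - c (a t), 0) else 0.
have zin t : W t -> zz t = (c (a t), c (b t) - c (a t), 0) by rewrite /zz; case: pselect.
have zeq t : a t = b t -> mov (zz t) = id.
  move=> e; have [w ->] : exists w, zz t = (w, 0, 0).
    by rewrite /zz; case: pselect => ?; [exists (c (a t)); rewrite e subrr|exists 0].
  by apply/funext => p; exact: mover0.
exists (fun t => mov (zz t)); split.
- apply: chart_flow_isotopy => //; last exact: zeq.
  rewrite I01E => t ht; have [[Va Vb]|ne] := H t ht; [left|right]; last first.
    by apply: filterS ne => s h hs; apply: zeq; exact: h.
  have [[conta sma] [contb smb]] := (ca t ht, cb t ht).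
  have sa : smooth_at I01 (fun s => c (a s)) t by apply: sma => //; case: Va.
  have sb : smooth_at I01 (fun s => c (b s)) t by apply: smb => //; case: Vb.
  apply: (smooth_at_germ (A := I01) (f := fun s => (c (a s), c (b s) - c (a s), 0 : R))).
    by apply: filterS2 (conta _ (near_V Va)) (contb _ (near_V Vb)) => s h1 h2 hs; rewrite zin//; split; [exact: h1|exact: h2].
  apply: smooth_at_pair; last by apply: smoothT_at; exact: smoothT_cst.
  apply: smooth_at_pair => //.
  apply: (@smooth_at_compT R _ _ _ I01 (fun q : E * E => q.2 - q.1) (fun s => (c (a s), c (b s)))) => //.
  + exact: findim_prod (findim_rV n) (findim_rV n).
  + by apply: smoothTB; [apply: smoothT_snd|apply: smoothT_fst]; exact: smoothT_id.
  + exact: smooth_at_pair.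
- by move=> t ht; exact: chart_flow_hamiltonian.
- move=> t ht; have [Vt|ne] := H t ht.
    by rewrite zin//; case: Vt => -[d1 l1] [d2 l2]; exact: mover_moves.
  have e := nbhs_singleton ne ht; by rewrite zeq.
Qed.

End OneChart.

(** With two reparametrizations of one curve, being in a common chart ball becomes a condition on
    times: d is such that a sends the times of [0, 1] within d of T0 into the ball of radius r1. *)
Lemma moved_local a T0 : curve01 a -> I01 T0 -> exists2 d : R, 0 < d & forall s s' : R -> R,
  smoothT s -> smoothT s' -> (forall t, I01 t -> I01 (s t)) -> (forall t, I01 t -> I01 (s' t)) ->
  s 0 = s' 0 ->
  (forall t, I01 t -> (`|s t - T0| < d /\ `|s' t - T0| < d) \/ \forall u \near t, s u = s' u) ->
  moved (fun t => a (s t)) (fun t => a (s' t)).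
Proof.
move=> ca hT0; have [conta _] := ca _ hT0.
pose p := a T0; pose c := chart_at S p.
have ac : atlas S c by exact: chart_at_atlas.
have dp : cdom c p by exact: chart_at_dom.
have [r1 [r2 [r3 [r10 r12 r20 r23 br]]]] := chart_radii ac dp.
have NV : \forall q \near p, cdom c q /\ `|c q - c p| < r1.
  by apply: near_chart_ball => //; rewrite subrr normr0.
have /nbhs_ballP[d d0 bd] := conta _ NV.
have Hd u : `|u - T0| < d -> I01 u -> cdom c (a u) /\ `|c (a u) - c p| < r1.
  by move=> ud hu; apply: bd => //; rewrite -ball_normE /ball_ /= distrC.
exists d => // s s' ss ss' s01 s'01 e0 H.
apply: (moved_chart ac r12 r20 r23 br).
- exact: curve01_comp.
- exact: curve01_comp.
- by rewrite e0.
- move=> t ht; have [[h1 h2]|N] := H t ht.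
    by left; split; apply: Hd => //; [exact: s01|exact: s'01].
  by right; apply: filterS N => u e _; rewrite e.
Qed.

(** * Contracting a curve to its origin *)

Section Contract.
Variable a : R -> M.
Hypothesis ca : curve01 a.

(** Induction on T over all reparametrizations with values in [0, T] keeps every curve defined on
    [0, 1]. Both directions are carried along, so that inverse isotopies need not be formed. *)
Let Q T := forall s : R -> R, smoothT s -> (forall t, I01 t -> 0 <= s t <= T) -> s 0 = 0 ->
  moved (fun t => a (s t)) (fun _ => a 0) /\ moved (fun _ => a 0) (fun t => a (s t)).

(** A smooth substitute for the minimum of x and T: the identity below L, with values at most T. *)
Let cut (L T x : R) := x + step_between L T x * (T - x).

Let cut_smooth L T : smoothT (cut L T).
Proof.
apply: smoothTD; first exact: smoothT_id.
apply: smoothTM; first exact: step_between_smooth.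
by apply: smoothTB; [exact: smoothT_cst|exact: smoothT_id].
Qed.

Let cut_below (L T x : R) : L < T -> x <= L -> cut L T x = x.
Proof. by move=> LT xL; rewrite /cut step_between0// mul0r addr0. Qed.

Let cut_bounds (L T x m : R) : L < T -> m <= x -> m <= T -> m <= cut L T x <= T.
Proof.
move=> LT mx mT; have [Tx|xT] := leP T x.
  by rewrite /cut step_between1// mul1r addrC subrK mT lexx.
have /andP[k0 k1] := step_between_itv L T x; rewrite /cut; move: (step_between _ _ _) k0 k1 => k k0 k1.
have h1 : 0 <= k * (T - x) by apply: mulr_ge0 => //; lra.
have h2 : 0 <= (1 - k) * (T - x) by apply: mulr_ge0; lra.
have h3 : (1 - k) * (T - x) = T - x - k * (T - x) by ring.
by apply/andP; split; lra.
Qed.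

Let Q0 : Q 0.
Proof.
move=> s ss s0 _; have e t : I01 t -> a (s t) = a 0.
  by move=> /s0 h; have -> : s t = 0 by apply/eqP; rewrite eq_le andbC.
by split; apply: moved_refl => t ht; rewrite e.
Qed.

(** The functions s and [cut L T] of s differ only while s >= L, and both are then in the window
    around T0. [moved_local] passes from one to the other, and [Q T] handles the cut one. *)
Let step T0 : I01 T0 -> exists2 d : R, 0 < d & forall T T', T0 - d < T -> T <= T' -> T' < T0 + d ->
  0 <= T -> T' <= 1 -> Q T -> Q T'.
Proof.
move=> hT0; have [d d0 Hd] := moved_local ca hT0; exists d => // T T' lT TT' T'l T0' T'1 QT s ss hs s0.
(* L >= 0 makes the cut keep the value 0 at time 0. For T = 0 no such L lies below T, but the cut
   then fixes 0 by its formula. *)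
have [L [lL LT LL]] : exists L, [/\ T0 - d < L, L < T & 0 <= L \/ T = 0].
  have [T00|Tn0] := eqVneq T 0; first by exists ((T0 - d) / 2); split; [lra|lra|right].
  have Tp : 0 < T by rewrite lt_neqAle eq_sym Tn0.
  have [h|h] := leP 0 (T0 - d); first by exists ((T + (T0 - d)) / 2); split; [lra|lra|left; lra].
  by exists 0; split; [lra|lra|left].
pose s' t := cut L T (s t).
have ss' : smoothT s' by apply: (smoothT_comp findim_real (@cut_smooth L T) ss).
have hs' t : I01 t -> 0 <= s' t <= T by move=> /hs /andP[h _]; exact: cut_bounds.
have s'0 : s' 0 = 0.
  rewrite /s' s0; case: LL => [L0|T00]; first exact: cut_below.
  by rewrite /cut T00 subrr mulr0 addr0.
have hs1 t : I01 t -> I01 (s t) by move=> /hs /andP[h1 h2] /=; rewrite h1 (le_trans h2).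
have hs'1 t : I01 t -> I01 (s' t).
  by move=> /hs' /andP[h1 h2] /=; rewrite h1 (le_trans h2)// (le_trans TT').
have key t : I01 t -> (`|s t - T0| < d /\ `|s' t - T0| < d) \/ \forall u \near t, s u = s' u.
  move=> ht; have [sL|Ls] := ltP (s t) L.
    right; have N : \forall u \near t, s u < L by exact: (cvgr_lt _ (smoothT_cts ss (x := t)) _ sL).
    by apply: filterS N => u uL; rewrite /s' cut_below// ltW.
  left; have /andP[h1 h2] := hs t ht.
  have /andP[h3 h4] := cut_bounds LT Ls (ltW LT).
  by rewrite !ltr_norml /s'; split; apply/andP; split; lra.
have [m1 m2] := QT s' ss' hs' s'0.
split.
  by apply: moved_trans m1; apply: Hd => //; rewrite s0 s'0.
apply: (moved_trans m2); apply: Hd => //; first by rewrite s0 s'0.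
move=> t ht; have [[h1 h2]|N] := key t ht; first by left.
by right; apply: filterS N => u ->.
Qed.

(** Continuity induction: the window around the supremum of the good T reaches past that supremum
    unless it is stopped at 1. *)
Lemma moved_contract : moved a (fun _ => a 0) /\ moved (fun _ => a 0) a.
Proof.
suff Q1 : Q 1.
  by apply: (Q1 id) => //; exact: smoothT_id.
pose A := [set T | I01 T /\ Q T].
have A0 : A 0 by split=> //=; rewrite lexx ler01.
have hA : has_sup A by split; [exists 0|exists 1 => T [/andP[]]].
have ubA := sup_upper_bound hA.
have hT0 : I01 (sup A).
  by rewrite /= (ubA 0 A0) ge_sup//; [exists 0|move=> T [/andP[]]].
have [d d0 Hd] := step hT0.
have [T [/andP[T0 T1] QT] lT] := sup_adherent d0 hA.
have TS : T <= sup A by apply: ubA; split=> //=; rewrite T0.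
(* d / 2 stays strictly inside the window and still exceeds the supremum; hence T' <= sup A is
   possible only if T' = 1. *)
pose T' := Num.min 1 (sup A + d / 2).
have T'1 : T' <= 1 by rewrite ge_min lexx.
have T'd : T' < sup A + d by rewrite gt_min; apply/orP; right; lra.
have TT' : T <= T' by rewrite le_min T1/=; lra.
have QT' : Q T' by exact: (Hd T T').
have : T' <= sup A by apply: ubA; split=> //=; rewrite T'1 (le_trans T0 TT').
rewrite ge_min => /orP[h|h]; last by lra.
have e : T' = 1 by apply/eqP; rewrite eq_le T'1 /T' le_min lexx/=; apply: le_trans h _; lra.
by rewrite -e.
Qed.

End Contract.

(** The first curve is contracted to the common origin, from which the second one is expanded. *)
Lemma moved_any a b : curve01 a -> curve01 b -> a 0 = b 0 -> moved a b.
Proof.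
move=> ca cb e; have [m _] := moved_contract ca; have [_ m'] := moved_contract cb.
by apply: (moved_trans m); rewrite e.
Qed.

Lemma smooth_curve01 (gamma : R -> M) : smooth_curve S gamma -> curve01 gamma.
Proof.
move=> [cg sg] t ht; split=> [N nN|c ac dc].
  by have N1 : \forall s \near t, N (gamma s) := cg t N nN; apply: filterS N1.
have := sg c ac t dc; apply: smooth_at_germ.
have N1 : \forall s \near t, cdom c (gamma s) := cg t _ (chart_open_dom ac dc).
by apply: filterS N1.
Qed.

Lemma family_curve01 (psi : R -> M -> M) p : smooth_family S `[0, 1] psi -> curve01 (fun t => psi t p).
Proof.
move=> sp t ht; have Tt : `[0, 1]%classic t by rewrite I01E.
have [cont _] := (smooth_familyP _ _ _).1 sp t p Tt.
have cont' N : nbhs (psi t p) N -> \forall s \near t, I01 s -> N (psi s p).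
  move=> /cont[[/= N1 N2] [nN1 nN2] HN]; have {}nN1 : \forall s \near t, N1 s := nN1; apply: filterS nN1 => s N1s hs.
  by apply: (HN (s, p)) => //; split=> //; exact: nbhs_singleton nN2.
split=> // c ac dc.
have a1 := chart_at_atlas S p; have d1 := chart_at_dom S p.
have sm := sp.2 _ c a1 ac (t, chart_at S p p).
apply: (smooth_at_germ (A := I01) (f := fun s => c (psi s (cinv (chart_at S p) (chart_at S p p))))).
  by apply: filterE => s hs; rewrite (chart_cmapK a1).
apply: (smooth_at_comp (B := [set z : R * E | [/\ `[0, 1]%classic z.1, cimg (chart_at S p) z.2 & cdom c (psi z.1 (cinv (chart_at S p) z.2))]])
  (g := fun z : R * E => c (psi z.1 (cinv (chart_at S p) z.2))) (f := fun s => (s, chart_at S p p))) => //.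
- exact: findim_prod findim_real (findim_rV n).
- apply: filterS (cont' _ (chart_open_dom ac dc)) => s h hs.
  by split=> /=; [rewrite in_itv|exact: chart_img|rewrite (chart_cmapK a1)//; exact: h].
- by apply: smoothT_at; apply: smoothT_pair; [exact: smoothT_id|exact: smoothT_cst].
- by apply: sm; split=> /=; [rewrite in_itv|exact: chart_img|rewrite (chart_cmapK a1)].
Qed.

End MovingCurves.

(** * Symplectic linear algebra *)

Section Lagrangian.
Variables (F : fieldType) (n : nat) (O : 'M[F]_n).
Hypotheses (uO : O \in unitmx) (altO : forall u : 'rV_n, u *m O *m u^T = 0).

Lemma alternating_tr : O^T = - O.
Proof.
apply/matrixP => i j; pose e k : 'rV[F]_n := delta_mx 0 k.
have ee k l : (e k *m O *m (e l)^T) 0 0 = O k l by rewrite trmx_delta -rowE -colE !mxE.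
have := altO (e i + e j); rewrite linearD /= mulmxDr !mulmxDl !altO add0r addr0.
move=> h; have : (e j *m O *m (e i)^T) 0 0 + (e i *m O *m (e j)^T) 0 0 = 0.
  by have := congr1 (fun X : 'M_1 => X 0 0) h; rewrite [LHS]mxE [RHS]mxE.
by rewrite !ee !mxE => /eqP; rewrite addr_eq0 => /eqP.
Qed.

(** Subspaces are row spaces; this is the orthogonal of the row space of V with respect to O. *)
Definition perp m (V : 'M[F]_(m, n)) : 'M_n := kermx (O *m V^T).

Lemma perpP m k (U : 'M_(m, n)) (V : 'M_(k, n)) : (U <= perp V)%MS = (U *m O *m V^T == 0).
Proof. by rewrite sub_kermx mulmxA. Qed.

Lemma perpC m k (U : 'M_(m, n)) (V : 'M_(k, n)) : (U <= perp V)%MS = (V <= perp U)%MS.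
Proof.
rewrite !perpP -(inj_eq trmx_inj) !trmx_mul trmxK alternating_tr trmx0.
by rewrite mulNmx mulmxN oppr_eq0 mulmxA.
Qed.

Lemma rank_perp m (V : 'M_(m, n)) : (\rank (perp V) = n - \rank V)%N.
Proof.
rewrite mxrank_ker -mxrank_tr trmx_mul trmxK mxrankMfree//.
by rewrite row_free_unit unitmx_tr.
Qed.

Lemma isotropic_add (I : 'M_n) (v : 'rV_n) : (I <= perp I)%MS -> (v <= perp I)%MS ->
  (I + v <= perp (I + v)%MS)%MS.
Proof.
move=> iI vI; rewrite addsmx_sub ![(_ <= perp (I + v)%MS)%MS]perpC !addsmx_sub iI vI perpC vI.
by rewrite perpP altO eqxx.
Qed.

Lemma max_subspace (P : 'M[F]_n -> Prop) (I0 : 'M_n) : P I0 ->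
  exists2 I, P I & forall v : 'rV_n, P (I + v)%MS -> (v <= I)%MS.
Proof.
move=> PI0; pose p k := `[< exists2 I, P I & \rank I = k >].
have ex : exists k, p k by exists (\rank I0); apply/asboolP; exists I0.
have ub k : p k -> (k <= n)%N by move=> /asboolP[I _ <-]; exact: rank_leq_col.
have [k /asboolP[I PI rI] kmax] := ex_maxnP ex ub.
exists I => // v PIv; have rk : (\rank (I + v)%MS <= \rank I)%N.
  by rewrite rI; apply: kmax; apply/asboolP; exists (I + v)%MS.
have := mxrank_leqif_sup (addsmxSl I v); move=> [le eq].
have : (I + v <= I)%MS by rewrite -eq eqn_leq le rk.
by rewrite addsmx_sub => /andP[].
Qed.

Definition lagrangian (L : 'M[F]_n) := (L <= perp L)%MS /\ (\rank L + \rank L = n)%N.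

Lemma isotropic_rank (I : 'M_n) : (I <= perp I)%MS -> (\rank I + \rank I <= n)%N.
Proof.
move=> /mxrankS; rewrite rank_perp => h; rewrite -leq_subRL//; exact: rank_leq_col.
Qed.

(** If I is maximal isotropic, every v in [perp I] can be adjoined, so that [perp I] is contained in
    I and n - rank I <= rank I. *)
Lemma lagrangian_exists : exists L, lagrangian L.
Proof.
have [|I iI mI] := @max_subspace (fun I => (I <= perp I)%MS) 0; first exact: sub0mx.
exists I; split=> //; apply/eqP; rewrite eqn_leq isotropic_rank//=.
rewrite -leq_subLR -rank_perp; apply: mxrankS; apply/row_subP => i; apply: mI.
by apply: isotropic_add => //; exact: row_sub.
Qed.

Lemma disjoint_add (I L : 'M[F]_n) (v : 'rV[F]_n) : (I :&: L <= (0 : 'M[F]_n))%MS -> ~~ (v <= I + L)%MS ->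
  ((I + v) :&: L <= (0 : 'M[F]_n))%MS.
Proof.
move=> IL vIL; apply/rV_subP => u; rewrite sub_capmx => /andP[/sub_addsmxP[[x y] /= uE] uL].
have [y0|y0] := eqVneq (y 0 0) 0.
  have ey : y = 0 by apply/matrixP => i j; rewrite !ord1 mxE.
  apply: submx_trans IL; rewrite sub_capmx uL uE ey mul0mx addr0 submxMl//.
case/negP: vIL; have yv : y *m v = u - x *m I by rewrite uE addrC addKr.
rewrite -(eqmx_scale v y0) -mul_scalar_mx.
have -> : (y 0 0)%:M = y by apply/matrixP => i j; rewrite !ord1 !mxE.
rewrite yv addmx_sub//; first exact: submx_trans uL (addsmxSr _ _).
by rewrite -scaleN1r scalemx_sub//; exact: submx_trans (submxMl _ _) (addsmxSl _ _).
Qed.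

(** By the modular law [perp I] is contained in I + (L meet [perp I]). The second summand is
    orthogonal to I and to L, hence of rank at most n - rank I - rank L, and counting dimensions
    gives the bound. *)
Lemma rank_of_perp_sub (I L : 'M_n) : (I <= perp I)%MS -> lagrangian L -> (I :&: L <= (0 : 'M[F]_n))%MS ->
  (perp I <= I + L)%MS -> (\rank L <= \rank I)%N.
Proof.
move=> iI [iL rL] IL pIL.
have e : (I + (L :&: perp I) :=: (I + L) :&: perp I)%MS by exact: matrix_modl.
have r1 : (\rank (perp I) <= \rank (I + (L :&: perp I))%MS)%N.
  by rewrite e mxrankS// sub_capmx pIL submx_refl.
have r2 : (\rank (I + (L :&: perp I))%MS <= \rank I + \rank (L :&: perp I))%N by exact: mxrank_adds_leqif.
have s3 : (L :&: perp I <= perp (I + L)%MS)%MS.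
  rewrite perpC addsmx_sub -!(perpC (L :&: perp I)%MS) capmxSr/=.
  exact: submx_trans (capmxSl _ _) iL.
have := mxrankS s3; rewrite rank_perp.
have r4 : (\rank (I + L)%MS = \rank I + \rank L)%N.
  by rewrite -mxrank_sum_cap; move: IL; rewrite submx0 -mxrank_eq0 => /eqP ->; rewrite addn0.
have := isotropic_rank iI; have := rank_leq_col (I + L)%MS; move: r1 r2; rewrite rank_perp r4.
lia.
Qed.

(** Let I be maximal among isotropic subspaces meeting L1 and L2 trivially. A vector of [perp I]
    outside I + L1 and I + L2 could be adjoined. If [perp I] lay in neither sum, one of v, w, v + w
    would be such a vector; so it lies in one of them, and [rank_of_perp_sub] applies. This works
    over any field. *)
Lemma lagrangian_complement (L1 L2 : 'M_n) : lagrangian L1 -> lagrangian L2 ->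
  exists2 L, lagrangian L & (L :&: L1 <= (0 : 'M[F]_n))%MS /\ (L :&: L2 <= (0 : 'M[F]_n))%MS.
Proof.
move=> l1 l2.
pose P (I : 'M[F]_n) := [/\ (I <= perp I)%MS, (I :&: L1 <= (0 : 'M[F]_n))%MS & (I :&: L2 <= (0 : 'M[F]_n))%MS].
have [|I [iI I1 I2] mI] := @max_subspace P 0.
  by split; [exact: sub0mx|exact: capmxSl|exact: capmxSl].
exists I => //; split=> //.
have r12 : \rank L1 = \rank L2 by case: l1 l2 => _ + [_]; lia.
have ext (v : 'rV[F]_n) : (v <= perp I)%MS -> ~~ (v <= I + L1)%MS -> ~~ (v <= I + L2)%MS -> False.
  move=> vI v1 v2; have : (v <= I)%MS.
    by apply: mI; split; [exact: isotropic_add|exact: disjoint_add|exact: disjoint_add].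
  by move=> h; case/negP: v1; exact: submx_trans h (addsmxSl _ _).
suff h : (\rank L1 <= \rank I)%N.
  by have := isotropic_rank iI; case: l1 => _; lia.
have [s1|/row_subPn[i ni]] := boolP (perp I <= I + L1)%MS; first exact: rank_of_perp_sub s1.
have [s2|/row_subPn[j nj]] := boolP (perp I <= I + L2)%MS.
  by rewrite r12; exact: rank_of_perp_sub s2.
exfalso; set v := row i _ in ni; set w := row j _ in nj.
have vI : (v <= perp I)%MS by exact: row_sub.
have wI : (w <= perp I)%MS by exact: row_sub.
have [v2|nv2] := boolP (v <= I + L2)%MS; last exact: (ext v).
have [w1|nw1] := boolP (w <= I + L1)%MS; last exact: (ext w).
apply: (ext (v + w)); first exact: addmx_sub.
  apply: contra ni => h; rewrite -[v](addrK w) addmx_sub// -scaleN1r scalemx_sub//.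
apply: contra nj => h; rewrite -[w](addKr v) addmx_sub// -scaleN1r scalemx_sub//.
Qed.

End Lagrangian.

(* The components of an eigenvector are determined by
   v A P = e mu v P and v Q = e mu^-1 v A Q. *)
Lemma eigenvector_splitting (F : fieldType) n (A P Q : 'M[F]_n) (v : 'rV[F]_n) (mu e : F) :
  P + Q = 1%:M -> P *m P = P -> P *m Q = 0 -> Q *m P = 0 -> Q *m Q = Q ->
  P *m A *m P + Q \in unitmx -> mu != 0 -> e != 0 ->
  v *m (A *m (e^-1 *: P + e *: Q)) = mu *: v ->
  v = e *: (mu *: (v *m (P *m invmx (P *m A *m P + Q))) +
            mu^-1 *: (v *m (A *m Q *m (1%:M - A *m P) *m invmx (P *m A *m P + Q)))).
Proof.
move=> PQ PP PQ0 QP0 QQ uM mu0 e0 ve; set M := _ + Q in uM *.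
have eP : (e^-1 *: P + e *: Q) *m P = e^-1 *: P by rewrite mulmxDl -!scalemxAl PP QP0 scaler0 addr0.
have eQ : (e^-1 *: P + e *: Q) *m Q = e *: Q by rewrite mulmxDl -!scalemxAl PQ0 QQ scaler0 add0r.
have h1 : v *m A *m P = (e * mu) *: (v *m P).
  have h : v *m (A *m (e^-1 *: P + e *: Q)) *m P = mu *: v *m P by rewrite ve.
  rewrite -!mulmxA eP -!scalemxAr -scalemxAl in h.
  by rewrite -mulmxA -[LHS]scale1r -(mulfV e0) -scalerA h scalerA.
have h2 : v *m Q = (e * mu^-1) *: (v *m A *m Q).
  have h : v *m (A *m (e^-1 *: P + e *: Q)) *m Q = mu *: v *m Q by rewrite ve.
  rewrite -!mulmxA eQ -!scalemxAr -scalemxAl in h.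
  by rewrite -mulmxA mulrC -scalerA h scalerA mulVf// scale1r.
(* Since v P A P = v A P - v Q A P, the vector v M is v A P + v Q (1 - A P), whose two terms are
   given by [h1] and [h2]. *)
have vM : v *m M = (e * mu) *: (v *m P) + (e * mu^-1) *: (v *m (A *m Q *m (1%:M - A *m P))).
  have vPQ : v *m P + v *m Q = v by rewrite -mulmxDr PQ mulmx1.
  have e1 : v *m A *m P = v *m P *m A *m P + v *m Q *m A *m P by rewrite -!mulmxDl vPQ.
  have e2 : (e * mu^-1) *: (v *m (A *m Q *m (1%:M - A *m P))) = v *m Q - v *m Q *m A *m P.
    by rewrite !mulmxA scalemxAl -h2 mulmxBr mulmx1 mulmxA.
  rewrite e2 -h1 e1 /M mulmxDr !mulmxA.
  by rewrite addrACA subrr addr0.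
by rewrite -[LHS](mulmxK uM) vM mulmxDl -!scalemxAl scalerDr !scalerA !mulmxA.
Qed.

(** * Hyperbolicity of a symplectic matrix followed by a strong twist *)

Section HyperbolicProduct.
Context {R : realType} {n : nat}.
Variables (O A : 'M[R]_n).
Hypotheses (uO : O \in unitmx) (altO : forall u : 'rV_n, u *m O *m u^T = 0).
Hypothesis symA : A *m O *m A^T = O.

Lemma symplectic_unit : A \in unitmx.
Proof.
have e : A *m (O *m A^T *m invmx O) = 1%:M by rewrite !mulmxA symA mulmxV.
by have [] := mulmx1_unit e.
Qed.

(** L is any Lagrangian, L' one transverse to both L and L A, and P, Q are the projections of this
    splitting. If u (P A P + Q) = 0, then u Q = 0 and u P A has no component in L; it lies in L' and
    in L A, hence is 0, and u P = 0 because A is invertible. *)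
Lemma lagrangian_splitting : exists P Q : 'M[R]_n,
  [/\ [/\ P + Q = 1%:M, P *m P = P, P *m Q = 0, Q *m P = 0 & Q *m Q = Q],
      P *m O *m P^T = 0, Q *m O *m Q^T = 0 & P *m A *m P + Q \in unitmx].
Proof.
have [L lL] := lagrangian_exists uO altO.
have lLA : lagrangian O (L *m A).
  case: lL => iL rL; split; last by rewrite mxrankMfree// row_free_unit symplectic_unit.
  rewrite perpP trmx_mul !mulmxA -[L *m A *m O *m _]mulmxA -2!(mulmxA L) mulmxA.
  by rewrite (mulmxA _ O) symA -perpP.
have [L' lL' [d1 d2]] := lagrangian_complement uO altO lL lLA.
have d : (L :&: L' = 0)%MS by apply/eqP; rewrite -submx0 capmxC.
have d' : (L' :&: L = 0)%MS by apply/eqP; rewrite -submx0.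
have full : (1%:M <= L + L')%MS.
  rewrite sub1mx row_full_unit -row_free_unit /row_free.
  have := mxrank_sum_cap L L'; rewrite d mxrank0 addn0 => ->.
  by apply/eqP; case: lL lL' => _ + [_]; lia.
pose P := proj_mx L L'; pose Q := proj_mx L' L.
have PL : (P <= L)%MS by rewrite -[P]mul1mx proj_mx_sub.
have QL : (Q <= L')%MS by rewrite -[Q]mul1mx proj_mx_sub.
have PQ : P + Q = 1%:M by have := add_proj_mx d full; rewrite !mul1mx.
have PP : P *m P = P by exact: proj_mx_id.
have QQ : Q *m Q = Q by exact: proj_mx_id.
have PQ0 : P *m Q = 0 by exact: proj_mx_0.
have QP0 : Q *m P = 0 by exact: proj_mx_0.
have iso (X Y : 'M[R]_n) : (Y <= X)%MS -> (X <= perp O X)%MS -> Y *m O *m Y^T = 0.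
  by move=> YX iX; apply/eqP; rewrite -perpP (submx_trans YX)// perpC// (submx_trans YX).
exists P, Q; split=> //; [by apply: iso PL _; case: lL|by apply: iso QL _; case: lL'|].
rewrite -row_free_unit -kermx_eq0 -submx0; apply/rV_subP => u; rewrite sub_kermx mulmxDr => /eqP e.
have e1 : u *m P *m A *m P = 0.
  have h : u *m P *m A *m (P *m P) + u *m (Q *m P) = (u *m (P *m A *m P) + u *m Q) *m P.
    by rewrite [RHS]mulmxDl !mulmxA.
  by rewrite PP QP0 mulmx0 addr0 e mul0mx in h.
have e2 : u *m Q = 0.
  have h : u *m P *m A *m (P *m Q) + u *m (Q *m Q) = (u *m (P *m A *m P) + u *m Q) *m Q.
    by rewrite [RHS]mulmxDl !mulmxA.
  by rewrite PQ0 QQ mulmx0 add0r e mul0mx in h.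
have s1 : (u *m P *m A <= L *m A)%MS by rewrite submxMr//; exact: submx_trans (submxMl _ _) PL.
have s2 : (u *m P *m A <= L')%MS.
  have -> : u *m P *m A = u *m P *m A *m Q by rewrite -[LHS]mulmx1 -PQ mulmxDr e1 add0r.
  exact: submx_trans (submxMl _ _) QL.
have uPA : u *m P *m A = 0.
  by apply/eqP; rewrite -submx0; apply: submx_trans d2; rewrite sub_capmx s1 s2.
have uP : u *m P = 0 by rewrite -[LHS](mulmxK symplectic_unit) uPA mul0mx.
by rewrite submx0 -[u]mulmx1 -PQ mulmxDr uP e2 addr0.
Qed.

(** P - Q, which is 1 on L and -1 on L', belongs to the Lie algebra of the symplectic group of O
    because both spaces are isotropic. Symmetry is what makes it the linear field of a quadratic
    Hamiltonian. *)
Lemma splitting_symmetric (P Q : 'M[R]_n) (l : R) : P + Q = 1%:M ->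
  P *m O *m P^T = 0 -> Q *m O *m Q^T = 0 -> (l *: (P - Q) *m O)^T = l *: (P - Q) *m O.
Proof.
move=> PQ iP iQ; have tPQ : P^T + Q^T = 1%:M by rewrite -linearD /= PQ trmx1.
have PO : P *m O = P *m O *m Q^T by rewrite -[LHS]mulmx1 -tPQ mulmxDr iP add0r.
have QO : Q *m O = Q *m O *m P^T by rewrite -[LHS]mulmx1 -tPQ mulmxDr iQ addr0.
have OP : O *m P^T = Q *m O *m P^T by rewrite -[LHS]mul1mx -PQ mulmxDl !mulmxA iP add0r.
have OQ : O *m Q^T = P *m O *m Q^T by rewrite -[LHS]mul1mx -PQ mulmxDl !mulmxA iQ addr0.
rewrite -scalemxAl linearZ /= trmx_mul (alternating_tr altO) linearB /= mulNmx mulmxBr OP OQ.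
by rewrite mulmxBl -PO -QO opprB.
Qed.

Let N (v : 'rV[complex R]_n) : complex R := \sum_j `|v 0 j|.

Let N_mul (B : 'M[complex R]_n) v : N (v *m B) <= (\sum_i \sum_j `|B i j|) * N v.
Proof.
rewrite /N; apply: (@le_trans _ _ (\sum_j \sum_i `|v 0 i| * `|B i j|)).
  apply: ler_sum => j _; rewrite mxE; apply: le_trans (ler_norm_sum _ _ _) _.
  by apply: ler_sum => i _; rewrite normrM.
rewrite exchange_big mulr_sumr; apply: ler_sum => i _.
rewrite -mulr_sumr mulrC ler_wpM2r// [leRHS](bigD1 i)//= lerDl.
by apply: sumr_ge0 => k _; apply: sumr_ge0.
Qed.

Let N_scale a v : N (a *: v) = `|a| * N v.
Proof. by rewrite /N mulr_sumr; apply: eq_bigr => j _; rewrite mxE normrM. Qed.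

Let N_add v w : N (v + w) <= N v + N w.
Proof. by rewrite /N -big_split; apply: ler_sum => j _; rewrite mxE ler_normD. Qed.

Let N_ge0 v : 0 <= N v.
Proof. by apply: sumr_ge0. Qed.

Let N_eq0 v : N v = 0 -> v = 0.
Proof.
move=> /eqP; rewrite psumr_eq0// => /allP h; apply/rowP => j; rewrite mxE; apply/eqP.
by rewrite -normr_eq0; exact: (h j (mem_index_enum _)).
Qed.

(** For |mu| = 1, [eigenvector_splitting] with e = exp (- l) bounds the norm of an eigenvector by
    exp (- l) (K C1 + K C2) times itself. The bound is uniform in mu, since mu and its inverse have
    modulus 1. *)
Lemma hyperbolic_product (P Q : 'M[R]_n) :
  [/\ P + Q = 1%:M, P *m P = P, P *m Q = 0, Q *m P = 0 & Q *m Q = Q] ->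
  P *m A *m P + Q \in unitmx ->
  exists l : R, forall mu : complex R,
    eigenvalue (map_mx (real_complex R) (A *m (expR l *: P + expR (- l) *: Q))) mu -> `|mu| != 1.
Proof.
move=> [PQ PP PQ0 QP0 QQ] uM.
pose rc := real_complex R; pose M := P *m A *m P + Q.
pose C1 := map_mx rc (P *m invmx M); pose C2 := map_mx rc (A *m Q *m (1%:M - A *m P) *m invmx M).
pose K (B : 'M[complex R]_n) := \sum_i \sum_j `|B i j|.
have K0 B : 0 <= K B by apply: sumr_ge0 => i _; apply: sumr_ge0.
have [l hl] : exists l : R, rc (expR (- l)) * (K C1 + K C2) < 1.
  have rK : K C1 + K C2 \is Num.real by rewrite ger0_real// addr_ge0.
  (* With l = k the product k exp (- k) is below 1, as exp k >= 1 + k. The sum is a complex number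
     that happens to be real, hence the real part. *)
  exists (complex.Re (K C1 + K C2)); rewrite -{2}(RRe_real rK) -rmorphM /= -[1]/(rc 1) ltcR.
  set k := complex.Re _; rewrite expRN mulrC ltr_pdivrMr ?expR_gt0// mul1r.
  by apply: lt_le_trans (expR_ge1Dx k); rewrite ltrDr.
exists l => mu /eigenvalueP[v ve v0]; apply/negP => /eqP mu1.
pose eps := rc (expR (- l)).
have eps0 : 0 < eps by rewrite -[0]/(rc 0) ltcR expR_gt0.
have mu0 : mu != 0 by rewrite -normr_eq0 mu1 oner_neq0.
have key : v = eps *: (mu *: (v *m C1) + mu^-1 *: (v *m C2)).
  rewrite /C1 /C2 !map_mxM map_invmx map_mxB map_mx1 map_mxM.
  have -> : map_mx rc M = map_mx rc P *m map_mx rc A *m map_mx rc P + map_mx rc Q by rewrite map_mxD !map_mxM.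
  apply: eigenvector_splitting => //.
  - by rewrite -map_mxD PQ map_mx1.
  - by rewrite -map_mxM PP.
  - by rewrite -map_mxM PQ0 map_mx0.
  - by rewrite -map_mxM QP0 map_mx0.
  - by rewrite -map_mxM QQ.
  - by rewrite -!map_mxM -map_mxD map_unitmx.
  - exact: lt0r_neq0.
  - rewrite -ve; congr (_ *m _).
    have -> : eps^-1 = rc (expR l) by rewrite /eps /rc expRN (fmorphV (real_complex R)) invrK.
    by rewrite [RHS]map_mxM [in RHS]map_mxD !map_mxZ.
have Nv : N v <= eps * (K C1 + K C2) * N v.
  rewrite {1}key N_scale (gtr0_norm eps0) -mulrA ler_pM2l// mulrDl.
  apply: le_trans (N_add _ _) _; rewrite !N_scale normrV ?unitfE// mu1 invr1 !mul1r.
  by apply: lerD; exact: N_mul.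
have : N v = 0.
  apply/eqP; apply: contraT => Nv0; have Np : 0 < N v by rewrite lt_neqAle eq_sym Nv0 N_ge0.
  have lt : eps * (K C1 + K C2) * N v < N v by rewrite gtr_pMl.
  by have := le_lt_trans Nv lt; rewrite ltxx.
by move=> /N_eq0 e; rewrite e eqxx in v0.
Qed.

End HyperbolicProduct.

(** * Quadratic Hamiltonians *)

Section QuadraticTwist.
Context {R : realType} {n : nat} {M : topologicalType}.
Local Notation E := 'rV[R]_n.
Variables (S : smooth_structure R n M) (omega : M -> 'M[R]_n).
Hypotheses (somega : symplectic_form S omega) (hM : hausdorff_space M).
Variables (c : chart R n M) (y0 : E) (r1 r2 r3 : R).
Hypotheses (ac : atlas S c) (r12 : r1 < r2) (r20 : 0 < r2) (r23 : r2 < r3).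
Hypothesis ball_img : forall x, `|x - y0| < r3 -> cimg c x.
Variable B : 'M[R]_n.
Hypothesis symB : B^T = B.
Local Notation W := (chart_form S omega c).
Local Notation Z := (E * R)%type.
Implicit Types (t th : R).

Let fE : findim E := findim_rV n.
Let fZ : findim Z := findim_prod fE findim_real.
Let fZE : findim (Z * E)%type := findim_prod fZ fE.
Local Notation q := (wform (fun _ : E => B)).

(** The parameters are the center a, which will follow the curve, and the strength th, for which 0
    gives the identity. Both stay constant along the flow, whose drift [zeta] is 0. *)
Definition quad_ham (p : Z * E) : R :=
  p.1.2 * (bump_rV y0 r1 r2 p.2 * (2^-1 * q (p.2 - p.1.1) (p.2 - p.1.1) 0)).

Let quad_smooth (V : normedModType R) (u : V -> E) : smoothT u -> smoothT (fun x => q (u x) (u x) 0).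
Proof.
move=> su; have -> : (fun x => q (u x) (u x) 0) = fun x => \sum_i \sum_j u x 0 i * B i j * u x 0 j.
  by apply/funext => x; rewrite wform_sum.
have sc i : smoothT (fun x => u x 0 i) by apply: (smoothT_comp (g := fun x : E => x 0 i) fE _ su); exact: smoothT_coord.
apply: smoothT_sum => i; apply: smoothT_sum => j; apply: smoothTM => //.
by apply: smoothTM => //; exact: smoothT_cst.
Qed.

Lemma quad_ham_smooth : smoothT quad_ham.
Proof.
have s1 : smoothT (fun p : Z * E => p.1.1) by do 2!apply: smoothT_fst; exact: smoothT_id.
have s2 : smoothT (fun p : Z * E => p.1.2) by apply: smoothT_snd; apply: smoothT_fst; exact: smoothT_id.
have s3 : smoothT (fun p : Z * E => p.2) by apply: smoothT_snd; exact: smoothT_id.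
apply: smoothTM => //; apply: smoothTM.
  by apply: (smoothT_comp (g := bump_rV y0 r1 r2) fE _ s3); exact: bump_rV_smooth.
apply: smoothTM; first exact: smoothT_cst.
by apply: (quad_smooth (u := fun p : Z * E => p.2 - p.1.1)); exact: smoothTB.
Qed.

Lemma quad_ham_out z x : r2 <= `|x - y0| -> quad_ham (z, x) = 0.
Proof. by move=> xr; rewrite /quad_ham bump_rV0// mul0r mulr0. Qed.

Let zeta : Z := 0.
Local Notation X := (chart_field S omega c y0 r3 quad_ham).
Let sX : smoothT X := chart_field_smooth somega ac r23 ball_img quad_ham_smooth quad_ham_out.
Let X0 := chart_field_outside S omega c r3 quad_ham_out.
Local Notation g := (gflow zeta fZ sX X0).
Definition twist (z : Z) : M -> M := chart_flow somega ac r23 ball_img zeta fZ quad_ham_smooth quad_ham_out 1 z.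

Let is_derive_unique (V : normedModType R) (f : R -> V) t a b :
  is_derive t 1 f a -> is_derive t 1 f b -> a = b.
Proof. by move=> [_ <-] [_ <-]. Qed.

Let wform0l (w : E -> 'M[R]_n) v : wform w 0 v = cst 0.
Proof. by apply/funext => y; rewrite /wform !mul0mx mxE. Qed.

Let line_derive (a u : E) t : is_derive t 1 (fun s => a + s *: u) u.
Proof. by rewrite -[X in is_derive _ _ _ X]add0r; apply: is_deriveD; exact: is_derive_scalel. Qed.

(** Symmetry of B makes the two terms of the Leibniz rule equal, which absorbs the factor 1 / 2. *)
Lemma quad_ham_derive a th x u : `|x - y0| < r1 ->
  'D_u (fun x => quad_ham ((a, th), x)) x = th * (((x - a) *m B) *m u^T) 0 0.
Proof.
move=> xr; pose f (x : E) := th * (2^-1 * q (x - a) (x - a) 0).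
have sf : smoothT f.
  apply: smoothTM; first exact: smoothT_cst.
  apply: smoothTM; first exact: smoothT_cst.
  by apply: (quad_smooth (u := fun x : E => x - a)); apply: smoothTB; [exact: smoothT_id|exact: smoothT_cst].
have N : \forall x \near x, f x = quad_ham ((a, th), x).
  have N1 : \forall x \near x, `|x - y0| < r1 by apply: open_nbhs_nbhs; split=> //; exact: ball_open_norm.
  by apply: filterS N1 => y yr; rewrite /quad_ham /= bump_rV1 ?mul1r//; exact: ltW.
have [d e] := near_eq_diff N (smoothT_diff x sf).
rewrite (deriveE _ d) e.
have D1 : is_derive (0 : R) 1 (fun s => f (x + s *: u)) ('d f x u).
  have := is_derive_chain (line_derive x u 0) (smoothT_diff (x + 0 *: u) sf).
  by rewrite scale0r addr0.
pose k := ((x - a) *m B *m u^T) 0 0.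
have dc : is_derive (0 : R) 1 (fun s => x - a + s *: u) u by exact: line_derive.
have D2 := is_derive_form (w := fun _ : E => B) (t := 0) (fun i j => differentiable_cst _ _) dc dc (is_derive_cst (0 : E) (0 : R) 1).
have D3 : is_derive (0 : R) 1 (fun s => f (x + s *: u)) (th * k).
  have -> : (fun s => f (x + s *: u)) = fun s => (th * 2^-1) *: q (x - a + s *: u) (x - a + s *: u) 0.
    by apply/funext => s; rewrite /f (addrAC x); exact: mulrA.
  apply: is_derive_congr (is_deriveZ _ D2) _.
  have -> : wform (fun _ : E => B) (x - a + 0 *: u) (x - a + 0 *: u) = cst (q (x - a + 0 *: u) (x - a + 0 *: u) 0) by [].
  rewrite derive_cst addr0 scale0r addr0 /wform.
  have -> : (u *m B *m (x - a)^T) 0 0 = k.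
    have -> : u *m B *m (x - a)^T = ((x - a) *m B *m u^T)^T by rewrite !trmx_mul trmxK symB mulmxA.
    by rewrite mxE.
  by rewrite -/k /GRing.scale /=; field.
exact: is_derive_unique D1 D3.
Qed.

Lemma twist_field_center a th : `|a - y0| < r1 -> X ((a, th), a) = 0.
Proof.
move=> ar; have ar3 : `|a - y0| < r3 by exact: lt_trans ar (lt_trans r12 r23).
apply: (wform_inj somega ac (ball_img ar3)) => u.
rewrite (chart_field_hamiltonian somega ac ball_img fZ quad_ham_smooth)// quad_ham_derive//.
by rewrite subrr !mul0mx mxE mulr0 oppr0 /wform !mul0mx mxE.
Qed.

Lemma twist_center a th t : `|a - y0| < r1 -> 0 <= t -> g t ((a, th), a) = a.
Proof.
move=> ar t0; apply/esym.
apply: (@gflow_unique R n Z X zeta y0 r2 fZ sX X0 (a, th) (fun _ => a) t t0) => s _.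
by rewrite scaler0 addr0 twist_field_center//; exact: is_derive_cst.
Qed.

Lemma twist0 a p : twist (a, 0) p = p.
Proof.
have [dp|ndp] := pselect (cdom c p); last exact: chart_flow_out.
rewrite /twist chart_flowE//.
have e : c p = g 1 ((a, 0), c p).
  apply: (@gflow_unique R n Z X zeta y0 r2 fZ sX X0 (a, 0) (fun _ => c p) 1 ler01) => t _.
  rewrite scaler0 addr0.
  have -> : X (a, 0, c p) = 0; last exact: is_derive_cst.
  have [pr|pr] := ltP `|c p - y0| r3; last by apply: X0; exact: lt_le_trans pr.
  apply: (wform_inj somega ac (chart_img dp)) => u; rewrite (chart_field_hamiltonian somega ac ball_img fZ quad_ham_smooth)//.
  have -> : (fun x : E => quad_ham ((a, 0), x)) = cst 0.
    by apply/funext => x; rewrite /quad_ham mul0r.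
  by rewrite derive_cst oppr0 /wform !mul0mx mxE.
by rewrite -e (chart_cmapK ac).
Qed.

Lemma twist_fix p th : cdom c p -> `|c p - y0| < r1 -> twist (c p, th) p = p.
Proof. by move=> dp pr; rewrite /twist chart_flowE// twist_center// (chart_cmapK ac). Qed.

(* Differentiating wform W (X x) u x = - dH u along x = a + s v; the terms in
   which X is not differentiated vanish because X vanishes at a. *)
Lemma twist_field_linear a th v (N : 'M[R]_n) : `|a - y0| < r1 -> B = - (N *m W a) ->
  'd (fun x => X ((a, th), x)) a v = th *: (v *m N).
Proof.
move=> ar BE; have ar3 : `|a - y0| < r3 by exact: lt_trans ar (lt_trans r12 r23).
have ca := ball_img ar3.
have sXa : smoothT (fun x => X ((a, th), x)).
  by apply: (smoothT_comp fZE sX); apply: smoothT_pair; [exact: smoothT_cst|exact: smoothT_id].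
apply: (wform_inj somega ac ca) => u.
have dl := line_derive a v 0.
have a0 : a + 0 *: v = a by rewrite scale0r addr0.
have dX := is_derive_chain dl (smoothT_diff (a + 0 *: v) sXa).
have dW i j : differentiable (fun y => W y i j) (a + 0 *: v).
  by rewrite a0; exact: Ck_diff (chart_form_smooth somega 1 i j ac) ca.
have D1 := is_derive_form dW dX (is_derive_cst u (0 : R) 1) dl.
pose k := - (th * (v *m B *m u^T) 0 0).
have D2 : is_derive (0 : R) 1 (fun s => s *: (k : R^o)) k by exact: is_derive_scalel.
have N1 : \forall s \near (0 : R), s *: (k : R^o) = wform W (X ((a, th), a + s *: v)) (cst u s) (a + s *: v).
  have N2 : \forall s \near (0 : R), `|a + s *: v - y0| < r1.
    have C : (fun s : R => a + s *: v) @ 0 --> a + 0 *: v := is_derive_cts dl.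
    rewrite a0 in C.
    by have := C [set y | `|y - y0| < r1]; apply; apply: open_nbhs_nbhs; split=> //; exact: ball_open_norm.
  apply: filterS N2 => s sr.
  rewrite (chart_field_hamiltonian somega ac ball_img fZ quad_ham_smooth); last exact: lt_trans sr (lt_trans r12 r23).
  rewrite quad_ham_derive// [a + _]addrC addrK -!scalemxAl mxE /k.
  by rewrite /GRing.scale /= mulrN; congr (- _); ring.
have := is_derive_unique D1 (is_derive_near N1 D2).
rewrite a0 twist_field_center//.
rewrite (wform0l W (cst u 0)).
rewrite derive_cst addr0 /cst /=.
have -> : wform W 0 0 a = 0 by rewrite /wform !mul0mx mxE.
rewrite addr0 => ->; rewrite /k BE /wform mulmxN mulNmx mulmxA -!scalemxAl !mxE.
by rewrite mulrN opprK.
Qed.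

(** The orbit of a is constant, so the linearized flow solves the autonomous equation xi' = xi N
    with N = l (P - Q), and [eta] is its explicit solution starting at v. *)
Lemma twist_tangent a (l : R) (P Q : 'M[R]_n) v : `|a - y0| < r1 ->
  [/\ P + Q = 1%:M, P *m P = P, P *m Q = 0, Q *m P = 0 & Q *m Q = Q] ->
  B = - ((l *: (P - Q)) *m W a) ->
  'd (fun x => g 1 ((a, 1), x)) a v = v *m (expR l *: P + expR (- l) *: Q).
Proof.
move=> ar [PQ PP PQ0 QP0 QQ] BE.
pose N := l *: (P - Q).
pose xi s := 'd (fun x => g s ((a, 1), x)) a v.
pose eta (s : R) := expR (l * s) *: (v *m P) + expR (- l * s) *: (v *m Q).
pose lN : {linear E -> E} := mulmxr N.
have cN : continuous lN.
  apply: smoothT_cts; apply: smoothT_rV => j.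
  have -> : (fun x : E => lN x 0 j) = fun x => \sum_i x 0 i * N i j by apply/funext => x; rewrite /= mxE.
  apply: smoothT_sum => i; apply: smoothTM; [exact: smoothT_coord|exact: smoothT_cst].
have [L L0 HL] : exists2 L : R, 0 <= L & forall x, `|lN x| <= L * `|x|.
  have /linear_boundedP := continuous_linear_bounded 0 (cN 0).
  move=> /(filterI (nbhs_pinfty_ge (num_real 0))) /filter_ex[L [L0 HL]].
  by exists L.
have dxi (s : R) : 0 <= s <= 1 -> is_derive s 1 xi (lN (xi s)).
  move=> /andP[s0 _].
  have zE : ((a, 1) : Z) + s *: zeta = (a, 1) by rewrite scaler0 addr0.
  have D := gflow_tangent zeta fZ sX X0 (a, 1) a v s.
  rewrite zE (twist_center 1 ar s0) in D.
  apply: is_derive_congr D _.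
  by apply: etrans (@twist_field_linear a 1 _ N ar BE) _; rewrite scale1r.
have deta (s : R) : 0 <= s <= 1 -> is_derive s 1 eta (lN (eta s)).
  move=> _; have de (k : R) (w : E) : is_derive s 1 (fun s => expR (k * s) *: w) ((k * expR (k * s)) *: w).
    have dk : is_derive s 1 (fun s : R => expR (k * s)) (k * expR (k * s)).
      have h : is_derive s 1 (fun s : R => k *: (s : R^o)) (k *: (1 : R^o)) by exact: is_deriveZ.
      apply: is_derive_congr (is_derive_comp_real (u := expR) h (is_derive_expR _)) _.
      by rewrite [k *: 1]mulr1.
    apply: is_derive_congr (is_derive_comp_real (u := fun s => s *: w) dk (is_derive_scalel _ _)) _.
    by [].
  apply: is_derive_congr (is_deriveD (de l (v *m P)) (de (- l) (v *m Q))) _.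
  rewrite /lN /= /N /eta mulmxDl -!scalemxAl -!scalemxAr !mulmxBr -!mulmxA PP PQ0 QP0 QQ !mulmx0 subr0 sub0r.
  rewrite [l *: - _]scalerN -scaleNr !scalerA.
  by congr (_ *: _ + _ *: _); rewrite mulrC.
have e0 : xi 0 = eta 0.
  rewrite /xi gflow_tangent0 /eta !mulr0 expR0 !scale1r -mulmxDr PQ mulmx1//.
have := @ode_unique R E (findim_rV n) (fun _ x => lN x) xi eta L 1 ler01 L0 dxi deta.
rewrite /xi /eta !mulr1 => -> //.
- by rewrite mulmxDr -!scalemxAr.
- by move=> t _; rewrite -linearB; exact: HL.
Qed.

Lemma twist_tangent_map p (l : R) (P Q : 'M[R]_n) v : cdom c p -> `|c p - y0| < r1 ->
  [/\ P + Q = 1%:M, P *m P = P, P *m Q = 0, Q *m P = 0 & Q *m Q = Q] ->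
  B = - ((l *: (P - Q)) *m W (c p)) ->
  tangent_map S (twist (c p, 1)) p (tangent_param S c (c p) v) =
  tangent_param S c (c p) (v *m (expR l *: P + expR (- l) *: Q)).
Proof.
move=> dp pr proj BE; rewrite -(twist_tangent v pr proj BE).
have e := congr1 c (twist_fix 1 dp pr).
apply: etrans (congr1 (fun y => tangent_param S c y _) e).
exact: chart_flow_tangent dp.
Qed.

End QuadraticTwist.

(** * Twisting along the curve near time 1, and the theorem *)

Section Conclusion.
Context {R : realType} {n : nat} {M : topologicalType}.
Local Notation E := 'rV[R]_n.
Variables (S : smooth_structure R n M) (omega : M -> 'M[R]_n).
Implicit Types (t : R) (p : M).
Local Notation I01 := [set t : R | 0 <= t <= 1].

Lemma tangent_param_id p v : tangent_param S (chart_at S p) (chart_at S p p) v = v.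
Proof.
have ap := chart_at_atlas S p; have dp := chart_at_dom S p.
rewrite /tangent_param (chart_cmapK ap dp).
apply: near_id_diff; apply: filterS (chart_open_img ap (chart_img dp)) => x cx /=.
by rewrite (chart_cinvK ap).
Qed.

Lemma tangent_map_mx (f : M -> M) p v : v *m lin1_mx (tangent_map S f p) = tangent_map S f p v.
Proof. by rewrite /tangent_map mul_rV_lin1. Qed.

(** One chart around gamma 1 suffices, because the twist is active only while the curve is in the
    ball [V]. It is centered at gamma t and so fixes it at every time; at t = 1 its strength is 1,
    and the differential of the composite is the matrix of [hyperbolic_product]. *)
Lemma hyperbolic_twist (gamma : R -> M) (f : M -> M) :
  symplectic_form S omega -> hausdorff_space M -> curve01 S gamma ->
  smooth_map S f -> symplectic_map S omega f -> f (gamma 1) = gamma 1 ->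
  exists G : R -> M -> M,
    [/\ symplectic_isotopy S omega G,
        forall t, I01 t -> hamiltonian_diffeomorphism S omega (G t),
        forall t, I01 t -> G t (gamma t) = gamma t
      & hyperbolic_at S (G 1 \o f) (gamma 1)].
Proof.
move=> somega hM cgamma sf wf fp.
pose p := gamma 1; pose c := chart_at S p.
have ac : atlas S c by exact: chart_at_atlas.
have dp : cdom c p by exact: chart_at_dom.
have [r1 [r2 [r3 [r10 r12 r20 r23 br]]]] := chart_radii ac dp.
pose O := chart_form S omega c (c p).
have uO : O \in unitmx by apply: (chart_form_unit somega ac); exact: chart_img.
have OE u v : form2 omega p u v = (u *m O *m v^T) 0 0.
  by have := form2_chart omega u v ac dp; rewrite !tangent_param_id.
pose A := lin1_mx (tangent_map S f p).
have mx11 (X Y : 'M[R]_1) : X 0 0 = Y 0 0 -> X = Y by move=> e; apply/matrixP => i j; rewrite !ord1.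
have altO (u : E) : u *m O *m u^T = 0.
  by apply: mx11; rewrite [RHS]mxE -OE; exact: (sform_alternating somega).
have symA : A *m O *m A^T = O.
  have e (u v : E) : (u *m (A *m O *m A^T) *m v^T) 0 0 = (u *m O *m v^T) 0 0.
    rewrite -OE -(wf p u v) fp -/p OE -!tangent_map_mx -/A trmx_mul !mulmxA; by [].
  apply/matrixP => i j; have := e (delta_mx 0 i) (delta_mx 0 j).
  by rewrite !trmx_delta -!rowE -!colE !mxE.
have [P [Q [proj iP iQ uM]]] := lagrangian_splitting uO altO symA.
have [l hl] := hyperbolic_product proj uM.
(* The sign for which the linearized field at the center is l (P - Q), as in
   [twist_field_linear]. *)
pose B := - ((l *: (P - Q)) *m O).
have symB : B^T = B.
  by case: proj => PQ _ _ _ _; rewrite /B linearN /= (splitting_symmetric altO).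
pose V q := cdom c q /\ `|c q - c p| < r1.
have pr : `|c p - c p| < r1 by rewrite subrr normr0.
have NV : \forall q \near p, V q := near_chart_ball ac dp pr.
have h1 : I01 1 by rewrite /= ler01 lexx.
(* The bound d <= 1 makes the strength vanish at t = 0, so that G starts at the identity. *)
have [d [d0 d1 Hd]] : exists d : R, [/\ 0 < d, d <= 1 & forall t, `|t - 1| < d -> I01 t -> V (gamma t)].
  have [cont _] := cgamma 1 h1; have /nbhs_ballP[d /= d0 bd] := cont _ NV.
  exists (Num.min d 1); split; [by rewrite lt_min d0 ltr01|by rewrite ge_min lexx orbT|].
  move=> t td ht; apply: bd => //; rewrite -ball_normE /ball_ /= distrC.
  by apply: lt_le_trans td _; rewrite ge_min lexx.
(* The strength vanishes up to 1 - d / 2, while the center is a chart coordinate whenever |t - 1| <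
   d. Every time thus has a neighbourhood in [0, 1] where zz is smooth or the twist is the
   identity. *)
pose th := step_between (1 - d / 2) 1.
have ld : 1 - d / 2 < 1 by lra.
pose zz t : E * R := if pselect (V (gamma t)) then (c (gamma t), th t) else 0.
have zin t : V (gamma t) -> zz t = (c (gamma t), th t) by rewrite /zz; case: pselect.
pose tw := twist somega ac r12 r20 r23 br B.
have th0 t : t <= 1 - d / 2 -> tw (zz t) = id.
  move=> tl; have e : th t = 0 by exact: step_between0.
  have [w ->] : exists w, zz t = (w, 0).
    by rewrite /zz; case: pselect => ?; [exists (c (gamma t)); rewrite e|exists 0].
  by apply/funext => q; exact: twist0.
have far t : I01 t -> ~ `|t - 1| < d -> t <= 1 - d.
  move=> /= /andP[_ t1] /negP; rewrite -leNgt distrC ger0_norm ?subr_ge0//; lra.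
have Gfix t : I01 t -> tw (zz t) (gamma t) = gamma t.
  move=> ht; have [Vt|nV] := pselect (V (gamma t)).
    by rewrite zin//; case: Vt => ? ?; exact: twist_fix.
  by rewrite th0//; have := far t ht (fun h => nV (Hd t h ht)); lra.
exists (fun t => tw (zz t)); split.
- apply: chart_flow_isotopy => //; last by apply: th0; lra.
  rewrite I01E => t ht; have [td|td] := pselect (`|t - 1| < d); [left|right].
    have N1 : \forall s \near t, `|s - 1| < d.
      have C : (fun s : R => `|s - 1|) @ t --> `|t - 1|.
        by apply: cvg_norm; apply: cvgB; [exact: cvg_id|exact: cvg_cst].
      exact: (cvgr_lt _ C _ td).
    apply: (smooth_at_germ (A := I01) (f := fun s => (c (gamma s), th s))).
      by apply: filterS N1 => s sd hs; rewrite zin//; exact: Hd.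
    have [dt _] := Hd t td ht.
    apply: smooth_at_pair; first by have [_] := cgamma t ht; exact.
    by apply: smoothT_at; exact: step_between_smooth.
  have tl : t < 1 - d / 2 by have := far t ht td; lra.
  have N1 : \forall s \near t, s < 1 - d / 2 by exact: lt_nbhsl.
  by apply: filterS N1 => s sl _; apply: th0; exact: ltW.
- by move=> t _; exact: chart_flow_hamiltonian.
- exact: Gfix.
- have Vp : V p by [].
  have z1 : zz 1 = (c p, 1) by rewrite zin// /th step_between1.
  have smt : smooth_map S (tw (zz 1)) by exact: chart_flow_smooth.
  have twp : tw (zz 1) p = p by exact: Gfix.
  have T (w : E) : tangent_map S (tw (zz 1)) p w = w *m (expR l *: P + expR (- l) *: Q).
    have := twist_tangent_map somega ac r12 r20 r23 br symB w dp Vp.2 proj (erefl B).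
    by rewrite !tangent_param_id -z1.
  have e : lin1_mx (tangent_map S (tw (zz 1) \o f) p) = A *m (expR l *: P + expR (- l) *: Q).
    apply/row_matrixP => i; rewrite !rowE tangent_map_mx (tangent_map_comp p _ smt sf) fp -/p T.
    by rewrite -tangent_map_mx mulmxA.
  by move=> mu; rewrite -/p e; exact: hl.
Qed.

End Conclusion.

Theorem proposition1p3 (R : realType) (n : nat) (M : topologicalType)
  (S : smooth_structure R n M) (omega : M -> 'M[R]_n)
  (psi : R -> M -> M) (gamma : R -> M) :
  closed_manifold M ->
  symplectic_form S omega ->
  symplectic_isotopy S omega psi ->
  smooth_loop S gamma ->
  contractible_loop gamma ->
  exists phi : R -> M -> M,
    [/\ symplectic_isotopy S omega phi,
        hamiltonian_deformation S omega phi psi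
      & hyperbolic_orbit S phi gamma].
Proof.
move=> [_ hM] somega ipsi [sgamma pgamma] _.
have [spsi dpsi wpsi psi0] := ipsi.
have cgamma := smooth_curve01 sgamma.
have [|K [iK hK Kgamma]] := moved_any somega hM (family_curve01 (gamma 0) spsi) cgamma.
  by rewrite psi0.
(* Periodicity closes the orbit: K 1 psi 1 sends gamma 0 to gamma 1 = gamma 0, hence fixes gamma 1,
   as [hyperbolic_twist] requires. *)
have g01 : gamma 1 = gamma 0 by have := pgamma 0; rewrite add0r.
have h1 : 0 <= (1 : R) <= 1 by rewrite ler01 lexx.
have h1' : `[0, 1]%classic (1 : R) by rewrite /= in_itv.
have iF := symplectic_isotopy_comp iK ipsi.
have [sF _ wF _] := iF.
have [] := hyperbolic_twist (f := fun p => K 1 (psi 1 p)) somega hM cgamma.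
- exact: smooth_family_map h1' sF.
- exact: wF.
- by rewrite g01 Kgamma.
move=> G [iG hG Ggamma hyp].
(* Composing with the inverse of psi t leaves G t K t, a product of two Hamiltonian
   diffeomorphisms. *)
exists (fun t p => G t (K t (psi t p))); split.
- exact: symplectic_isotopy_comp iG iF.
- move=> t ht; have [psi' [psiK psiK' _ _]] := dpsi t ht.
  exists psi'; split=> //.
  have -> : (fun p => G t (K t (psi t p))) \o psi' = G t \o K t by apply/funext => p; rewrite /= psiK'.
  by apply: hamiltonian_comp; [exact: hG|exact: hK].
- split; last by rewrite -g01.
  by move=> t ht; rewrite Kgamma// Ggamma.
Qed.
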